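(* Let $A$ and $H$ be Hopf algebras over $\mathbb{C}$. Assume that there exists an equivalence of linear tensor categories $\Theta : \mathcal{M}^A \simeq^{\otimes} \mathcal{M}^H$ between their categories of right comodules. Then $\Theta$ induces an equivalence of linear tensor categories $\widehat{\Theta} : \mathcal{YD}_A^A \simeq^{\otimes} \mathcal{YD}_H^H$ together with, for all $V \in \mathcal{M}^A$, natural isomorphisms $$\widehat{\Theta}(V \boxtimes A) \simeq \Theta(V) \boxtimes H .$$ Moreover, the functor $\widehat{\Theta}$ associates to any free Yetter-Drinfeld resolution of the counit of $A$ $$\cdots \to V_{n+1} \boxtimes A \to V_n \boxtimes A \to \cdots \to V_0 \boxtimes A \to 0$$ a free Yetter-Drinfeld resolution of the counit of $H$ $$\cdots \to \Theta(V_{n+1}) \boxtimes H \to \Theta(V_n) \boxtimes H \to \cdots \to \Theta(V_0) \boxtimes H \to 0 .$$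
   Context: The base field is $\mathbb{C}$. For a Hopf algebra $A$, $\mathcal{M}^A$ is the tensor category of right $A$-comodules. A (right-right) Yetter-Drinfeld module over $A$ is a right $A$-comodule and right $A$-module $V$ such that for all $v\in V$, $a \in A$, $(v \leftarrow a)_{(0)} \otimes (v \leftarrow a)_{(1)} = v_{(0)} \leftarrow a_{(2)} \otimes S(a_{(1)}) v_{(1)} a_{(3)}$. The category $\mathcal{YD}_A^A$ of Yetter-Drinfeld modules has as morphisms the $A$-linear and $A$-colinear maps, and is a tensor category with the usual tensor product of modules and comodules. $\mathbb{C}$ is the trivial Yetter-Drinfeld module (action via the counit $\varepsilon$, coaction via the unit). For a right $A$-comodule $V$, $V \boxtimes A$ is the Yetter-Drinfeld module $V \otimes A$ with right multiplication on $A$ as module structure and coaction $v \otimes a \mapsto v_{(0)} \otimes a_{(2)} \otimes S(a_{(1)}) v_{(1)} a_{(3)}$. A Yetter-Drinfeld module is free if it is isomorphic to $V \boxtimes A$ for some right $A$-comodule $V$. A free Yetter-Drinfeld resolution of $M \in \mathcal{YD}_A^A$ is a complex of free Yetter-Drinfeld modules (with morphisms of Yetter-Drinfeld modules) $\cdots \to P_{n+1} \to P_n \to \cdots \to P_0 \to 0$ for which there is a Yetter-Drinfeld module map $\epsilon : P_0 \to M$ such that $\cdots \to P_{n+1}\to P_n \to \cdots \to P_0 \xrightarrow{\epsilon} M \to 0$ is exact. A free Yetter-Drinfeld resolution of the counit of $A$ is a free Yetter-Drinfeld resolution of $M=\mathbb{C}$. That $\widehat\Theta$ is induced by $\Theta$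 means that $R_H \widehat{\Theta} \simeq \Theta R_A$ as functors, where $R_A : \mathcal{YD}_A^A \to \mathcal{M}^A$ and $R_H : \mathcal{YD}_H^H \to \mathcal{M}^H$ are the forgetful functors. The maps in the second complex are those obtained by applying $\widehat{\Theta}$ to the maps of the first and using the identifications $\widehat{\Theta}(V \boxtimes A) \simeq \Theta(V) \boxtimes H$ (and $\widehat\Theta(\mathbb{C}) \simeq \mathbb{C}$). *)

(* Defs.v *)
From HB Require Import structures.
From mathcomp Require Import all_boot all_order all_algebra.
From mathcomp Require Import generic_quotient boolp functions.

Set Implicit Arguments.
Unset Strict Implicit.
Unset Printing Implicit Defensive.

Import GRing.Theory.
Local Open Scope quotient_scope.
Local Open Scope ring_scope.

Definition bilin (K : fieldType) (U V W : lmodType K) (b : U -> V -> W) : Prop :=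
  (forall v, linear (b^~ v)) /\ (forall u, linear (b u)).

Section Tensor.
Variables (K : fieldType) (V W : lmodType K).

(* Formal sums of pairs are identified when no bilinear map separates them;
   as a Prop, this may quantify over all modules U. *)
Definition tensor_rel (s t : seq (V * W)) : bool :=
  `[< forall (U : lmodType K) (b : V -> W -> U), bilin b ->
        \sum_(p <- s) b p.1 p.2 = \sum_(p <- t) b p.1 p.2 >].

Lemma tensor_relP (s t : seq (V * W)) :
  reflect (forall (U : lmodType K) (b : V -> W -> U), bilin b ->
        \sum_(p <- s) b p.1 p.2 = \sum_(p <- t) b p.1 p.2) (tensor_rel s t).
Proof. exact: asboolP. Qed.

Lemma tensor_rel_refl : reflexive tensor_rel.
Proof. by move=> s; apply/tensor_relP. Qed.

Lemma tensor_rel_sym : symmetric tensor_rel.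
Proof.
by move=> s t; apply/tensor_relP/tensor_relP => st U b bb; rewrite st.
Qed.

Lemma tensor_rel_trans : transitive tensor_rel.
Proof.
move=> s r t /tensor_relP rs /tensor_relP st; apply/tensor_relP => U b bb.
by rewrite rs // st.
Qed.

Canonical tensor_equiv :=
  EquivRel tensor_rel tensor_rel_refl tensor_rel_sym tensor_rel_trans.

Definition tensor : Type := {eq_quot tensor_equiv}.

HB.instance Definition _ := Choice.on tensor.
HB.instance Definition _ := Quotient.on tensor.
HB.instance Definition _ := EqQuotient.on tensor.

Lemma bilin_nmod (U : lmodType K) (b : V -> W -> U) : bilin b ->
  [/\ (forall v v' w, b (v + v') w = b v w + b v' w),
      (forall v w w', b v (w + w') = b v w + b v w') &
      (forall a v w, b (a *: v) w = a *: b v w) /\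
      (forall a v w, b v (a *: w) = a *: b v w)].
Proof.
move=> [bl br]; split; [| |split].
- by move=> v v' w; have := bl w 1 v v'; rewrite /= !scale1r.
- by move=> v w w'; have := br v 1 w w'; rewrite /= !scale1r.
- by move=> a v w; have := scalable_linear (bl w) a v.
- by move=> a v w; have := scalable_linear (br v) a w.
Qed.

Lemma bilin_suml (U : lmodType K) (b : V -> W -> U) (s t : seq (V * W)) :
  bilin b -> s = t %[mod tensor] ->
  \sum_(p <- s) b p.1 p.2 = \sum_(p <- t) b p.1 p.2.
Proof. by move=> bb /eqmodP/tensor_relP; apply. Qed.

Definition tadd (x y : tensor) : tensor := \pi_tensor (repr x ++ repr y).
Definition tscale (a : K) (x : tensor) : tensor :=
  \pi_tensor [seq (a *: p.1, p.2) | p <- repr x].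
Definition tzero : tensor := \pi_tensor [::].

Lemma tensor_eqP (x y : tensor) :
  (forall (U : lmodType K) (b : V -> W -> U), bilin b ->
    \sum_(p <- repr x) b p.1 p.2 = \sum_(p <- repr y) b p.1 p.2) -> x = y.
Proof.
by move=> xy; rewrite -[x]reprK -[y]reprK; apply/eqmodP/tensor_relP.
Qed.

Lemma sum_repr (U : lmodType K) (b : V -> W -> U) s : bilin b ->
  \sum_(p <- repr (\pi_tensor s)) b p.1 p.2 = \sum_(p <- s) b p.1 p.2.
Proof. by move=> bb; apply: bilin_suml => //; rewrite reprK. Qed.

Lemma sum_tadd (U : lmodType K) (b : V -> W -> U) x y : bilin b ->
  \sum_(p <- repr (tadd x y)) b p.1 p.2 =
  \sum_(p <- repr x) b p.1 p.2 + \sum_(p <- repr y) b p.1 p.2.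
Proof. by move=> bb; rewrite sum_repr // big_cat. Qed.

Lemma sum_tscale (U : lmodType K) (b : V -> W -> U) a x : bilin b ->
  \sum_(p <- repr (tscale a x)) b p.1 p.2 =
  a *: \sum_(p <- repr x) b p.1 p.2.
Proof.
move=> bb; rewrite sum_repr // big_map scaler_sumr; apply: eq_bigr => p _ /=.
by have [_ _ [-> _]] := bilin_nmod bb.
Qed.

Lemma sum_tzero (U : lmodType K) (b : V -> W -> U) : bilin b ->
  \sum_(p <- repr tzero) b p.1 p.2 = 0.
Proof. by move=> bb; rewrite sum_repr // big_nil. Qed.

Lemma taddA : associative tadd.
Proof.
by move=> x y z; apply: tensor_eqP => U b bb; rewrite !sum_tadd // addrA.
Qed.
Lemma taddC : commutative tadd.
Proof.
by move=> x y; apply: tensor_eqP => U b bb; rewrite !sum_tadd // addrC.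
Qed.
Lemma tadd0 : left_id tzero tadd.
Proof.
by move=> x; apply: tensor_eqP => U b bb; rewrite !sum_tadd // sum_tzero // add0r.
Qed.
Lemma taddN : left_inverse tzero (tscale (-1)) tadd.
Proof.
move=> x; apply: tensor_eqP => U b bb.
by rewrite sum_tadd // sum_tzero // sum_tscale // scaleN1r addNr.
Qed.

HB.instance Definition _ :=
  GRing.isZmodule.Build tensor taddA taddC tadd0 taddN.

Lemma tscaleA a b (x : tensor) : tscale a (tscale b x) = tscale (a * b) x.
Proof.
by apply: tensor_eqP => U c bc; rewrite !sum_tscale // scalerA.
Qed.
Lemma tscale1 : left_id 1 tscale.
Proof. by move=> x; apply: tensor_eqP => U c bc; rewrite !sum_tscale // scale1r. Qed.
Lemma tscaleDr : right_distributive tscale +%R.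
Proof.
move=> a x y; apply: tensor_eqP => U c bc.
by rewrite [_ + _ in RHS]/(tadd _ _) !(sum_tscale, sum_tadd) // scalerDr.
Qed.
Lemma tscaleDl (x : tensor) : {morph tscale^~ x : a b / a + b}.
Proof.
move=> a b; apply: tensor_eqP => U c bc.
by rewrite [_ + _ in RHS]/(tadd _ _) !(sum_tscale, sum_tadd) // scalerDl.
Qed.

HB.instance Definition _ :=
  GRing.Zmodule_isLmodule.Build K tensor tscaleA tscale1 tscaleDr tscaleDl.

Lemma taddE (x y : tensor) : x + y = tadd x y. Proof. by []. Qed.
Lemma tscaleE a (x : tensor) : a *: x = tscale a x. Proof. by []. Qed.

Definition tens (v : V) (w : W) : tensor := \pi_tensor [:: (v, w)].

(* For bilinear b this is the linear map tensor -> U induced by b (tliftE,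
   tlift_linear); it is a total function so that iterated Sweedler notation
   can be written without carrying proofs of bilinearity. *)
Definition tlift (U : lmodType K) (b : V -> W -> U) (x : tensor) : U :=
  \sum_(p <- repr x) b p.1 p.2.

Lemma tliftE (U : lmodType K) (b : V -> W -> U) v w :
  bilin b -> tlift b (tens v w) = b v w.
Proof. by move=> bb; rewrite /tlift sum_repr // big_seq1. Qed.

Lemma tliftD (U : lmodType K) (b : V -> W -> U) x y : bilin b ->
  tlift b (x + y) = tlift b x + tlift b y.
Proof. exact: sum_tadd. Qed.

Lemma tliftZ (U : lmodType K) (b : V -> W -> U) a x : bilin b ->
  tlift b (a *: x) = a *: tlift b x.
Proof. exact: sum_tscale. Qed.

Lemma tlift_linear (U : lmodType K) (b : V -> W -> U) :
  bilin b -> linear (tlift b).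
Proof.
by move=> bb a x y; rewrite tliftD // tliftZ.
Qed.

Lemma tens_bilin : bilin tens.
Proof.
by split=> [w|v] a x y; apply: tensor_eqP => U b bb;
  rewrite -!/(tlift b _) tliftD // tliftZ // !tliftE //;
  have [Dl Dr [Zl Zr]] := bilin_nmod bb; rewrite ?Dl ?Dr ?Zl ?Zr.
Qed.

Lemma tensE (x : tensor) : x = tlift tens x.
Proof.
apply: tensor_eqP => U b bb; rewrite -!/(tlift b _).
have/tlift_linear lb := bb.
pose g := GRing.isLinear.Build K tensor U *:%R (tlift b) lb.
pose f : {linear tensor -> U} := HB.pack (tlift b) g.
rewrite [X in _ = X](_ : _ = f (tlift tens x)) // [tlift tens x]/tlift raddf_sum.
by apply: eq_bigr => p _; rewrite /= tliftE.
Qed.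

End Tensor.

Notation "V \ox W" := (tensor V W) (at level 40, left associativity) : type_scope.
Notation "v *t w" := (tens v w) (at level 40, left associativity) : ring_scope.
Notation "\sw_ ( x , y <- t ) e" := (tlift (fun x y => e) t)
  (at level 41, x name, y name, e at level 41, right associativity,
   format "\sw_ ( x ,  y  <-  t )  e") : ring_scope.

Section Linearity.
Variables (K : fieldType).
Implicit Types (U V W X : lmodType K).

Lemma lin0 U V (f : U -> V) : linear f -> f 0 = 0.
Proof. by move=> lf; have := zmod_morphism_linear lf 0 0; rewrite subr0 subrr. Qed.

Lemma linD U V (f : U -> V) : linear f -> {morph f : x y / x + y}.
Proof. by move=> lf x y; have := lf 1 x y; rewrite !scale1r. Qed.

Lemma linZ U V (f : U -> V) : linear f -> forall a, {morph f : x / a *: x}.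
Proof. by move=> lf a x; exact: scalable_linear. Qed.

Lemma lin_sum U V (f : U -> V) I (r : seq I) (F : I -> U) : linear f ->
  f (\sum_(i <- r) F i) = \sum_(i <- r) f (F i).
Proof.
move=> lf; elim: r => [|i r IHr]; first by rewrite !big_nil lin0.
by rewrite !big_cons linD // IHr.
Qed.

Definition mklin U V (f : U -> V) (lf : linear f) : {linear U -> V} :=
  HB.pack f (GRing.isLinear.Build K U V *:%R f lf).

Lemma lin_lin U V (f : {linear U -> V}) : linear f.
Proof. exact: linearP. Qed.

Lemma linI U V (f : U -> V) :
  (forall a x y, f (a *: x + y) = a *: f x + f y) -> linear f.
Proof. by []. Qed.

Lemma linP U V (f : U -> V) :
  linear f -> (forall a x y, f (a *: x + y) = a *: f x + f y).
Proof. by []. Qed.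

Lemma lin_id U : linear (fun x : U => x).
Proof. by []. Qed.

Lemma lin_comp U V W (f : V -> W) (g : U -> V) :
  linear f -> linear g -> linear (fun x => f (g x)).
Proof. by move=> lf lg; apply: linI => a x y; rewrite (linP lg) (linP lf). Qed.

Lemma lin_app U V W (f : {linear V -> W}) (g : U -> V) :
  linear g -> linear (fun x => f (g x)).
Proof. by move=> lg; exact: (lin_comp (f := f) (@linearP _ _ _ _ f) lg). Qed.

Lemma bilinI U V W (b : U -> V -> W) :
  (forall v, linear (fun u => b u v)) -> (forall u, linear (fun v => b u v)) ->
  bilin b.
Proof. by []. Qed.

Lemma lin_bill U V W X (b : U -> V -> W) (g : X -> U) v :
  bilin b -> linear g -> linear (fun x => b (g x) v).
Proof. by move=> [bl _] lg; exact: (lin_comp (f := b^~ v) (bl v) lg). Qed.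

Lemma lin_bilr U V W X (b : U -> V -> W) (g : X -> V) u :
  bilin b -> linear g -> linear (fun x => b u (g x)).
Proof. by move=> [_ br] lg; exact: (lin_comp (br u) lg). Qed.

Lemma lin_tensl U V X (g : X -> U) (v : V) :
  linear g -> linear (fun x => g x *t v).
Proof. exact: (lin_bill (b := @tens K U V) v (@tens_bilin K U V)). Qed.

Lemma lin_tensr U V X (g : X -> V) (u : U) :
  linear g -> linear (fun x => u *t g x).
Proof. exact: (lin_bilr (b := @tens K U V) u (@tens_bilin K U V)). Qed.

Lemma lin_tlift_body U V W X (b : X -> U -> V -> W) t :
  (forall y z, linear (fun x => b x y z)) -> linear (fun x => tlift (b x) t).
Proof.
move=> lb; apply: linI => a x y; rewrite /tlift scaler_sumr -big_split /=.
by apply: eq_bigr => p _; rewrite (linP (lb _ _)).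
Qed.

Lemma lin_tlift_arg U V W X (b : U -> V -> W) (g : X -> U \ox V) :
  bilin b -> linear g -> linear (fun x => tlift b (g x)).
Proof. by move=> bb lg; exact: (lin_comp (tlift_linear bb) lg). Qed.

Lemma lin_scaler U V (a : K) (g : U -> V) :
  linear g -> linear (fun x => a *: g x).
Proof.
move=> lg; apply: linI => b x y.
by rewrite (linP lg) scalerDr !scalerA mulrC.
Qed.

Lemma lin_scalel U V (k : U -> K^o) (v : V) :
  linear k -> linear (fun x => (k x : K) *: v).
Proof. by move=> lk; apply: linI => b x y; rewrite (linP lk) scalerDl scalerA. Qed.

Lemma lin_mull (A : algType K) X (g : X -> A) (b : A) :
  linear g -> linear (fun x => g x * b).
Proof. by move=> lg; apply: linI => a x y; rewrite (linP lg) mulrDl scalerAl. Qed.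

Lemma lin_mulr (A : algType K) X (g : X -> A) (b : A) :
  linear g -> linear (fun x => b * g x).
Proof. by move=> lg; apply: linI => a x y; rewrite (linP lg) mulrDr scalerAr. Qed.

Lemma lin_tlift U V W X (f : W -> X) (b : U -> V -> W) t :
  linear f -> f (\sw_(x, y <- t) b x y) = \sw_(x, y <- t) f (b x y).
Proof. exact: lin_sum. Qed.

Lemma tlift_tlift U V U' V' W (b : U' -> V' -> W) (b' : U -> V -> U' \ox V') t :
  bilin b ->
  tlift b (\sw_(x, y <- t) b' x y) = \sw_(x, y <- t) tlift b (b' x y).
Proof. by move=> bb; apply: lin_tlift; apply: tlift_linear. Qed.

Lemma tlift_exch U V U' V' W (b : U -> V -> U' -> V' -> W) s t :
  \sw_(x, y <- s) \sw_(z, w <- t) b x y z w =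
  \sw_(z, w <- t) \sw_(x, y <- s) b x y z w.
Proof. exact: exchange_big. Qed.

Lemma eq_tlift U V W (b b' : U -> V -> W) t :
  (forall x y, b x y = b' x y) -> \sw_(x, y <- t) b x y = \sw_(x, y <- t) b' x y.
Proof. by move=> bb'; apply: eq_bigr => p _; apply: bb'. Qed.

Lemma tliftZr U V W (a : K) (b : U -> V -> W) t :
  a *: (\sw_(x, y <- t) b x y) = \sw_(x, y <- t) a *: b x y.
Proof. exact: scaler_sumr. Qed.

Lemma tens_ext U V W (f g : U \ox V -> W) :
  linear f -> linear g -> (forall u v, f (u *t v) = g (u *t v)) ->
  forall x, f x = g x.
Proof.
move=> lf lg fg x; rewrite (tensE x) [LHS]lin_tlift // [RHS]lin_tlift //.
exact: eq_tlift.
Qed.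

Lemma tensZl U V (a : K) (u : U) (v : V) : (a *: u) *t v = a *: (u *t v).
Proof. by rewrite (linZ (lin_tensl v (@lin_id U))). Qed.
Lemma tensZr U V (a : K) (u : U) (v : V) : u *t (a *: v) = a *: (u *t v).
Proof. by rewrite (linZ (lin_tensr u (@lin_id V))). Qed.

End Linearity.

(* Proves goals of the form linear (fun x => e) and bilin (fun x y => e). *)
Ltac lin_ext := fail.
Ltac lin_step :=
  lazymatch goal with
  | |- forall _, _ => intro
  | |- bilin _ => apply: bilinI; cbv beta
  | |- GRing.linear_for _ (fun x => x) => apply: lin_id
  | |- GRing.linear_for _ (fun x => _) =>
    first [ exact: lin_id | assumption | apply: lin_tensl | apply: lin_tensr
          | apply: lin_mull | apply: lin_mulr
          | apply: lin_tlift_arg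
          | apply: lin_tlift_body
          | apply: lin_scaler | apply: lin_scalel
          | apply: lin_app
          | lin_ext ]
  | |- GRing.linear_for _ ?f => first [assumption | apply: (lin_app f); exact: lin_id | change (linear (fun x => f x))]
  end.
Ltac lin := solve [repeat lin_step].

Record hopfAlgebra (K : fieldType) := HopfAlgebra {
  hopf_alg :> algType K;
  comul : {linear hopf_alg -> hopf_alg \ox hopf_alg};
  counit : {linear hopf_alg -> K^o};
  antipode : {linear hopf_alg -> hopf_alg};
  comulA : forall a,
    \sw_(a1, a2 <- comul a) \sw_(a11, a12 <- comul a1) a11 *t (a12 *t a2) =
    \sw_(a1, a2 <- comul a) a1 *t comul a2;
  counitl : forall a, \sw_(a1, a2 <- comul a) (counit a1 : K) *: a2 = a;
  counitr : forall a, \sw_(a1, a2 <- comul a) (counit a2 : K) *: a1 = a;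
  comul1 : comul 1 = 1 *t 1;
  comulM : forall a b, comul (a * b) =
    \sw_(a1, a2 <- comul a) \sw_(b1, b2 <- comul b) (a1 * b1) *t (a2 * b2);
  counit1 : counit 1 = 1 :> K;
  counitM : forall a b, counit (a * b) = (counit a : K) * (counit b : K) :> K;
  antipodel : forall a,
    \sw_(a1, a2 <- comul a) antipode a1 * a2 = (counit a : K) *: 1;
  antipoder : forall a,
    \sw_(a1, a2 <- comul a) a1 * antipode a2 = (counit a : K) *: 1 }.

Arguments comul {K h} : rename.
Arguments counit {K h} : rename.
Arguments antipode {K h} : rename.

Section HopfTheory.
Variables (K : fieldType) (A : hopfAlgebra K).
Implicit Types (a b c : A) (U : lmodType K).
Local Notation S := (@antipode K A).
Local Notation Δ := (@comul K A).
Local Notation ε := (@counit K A).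

Lemma coassoc U (f : A -> A -> A -> U) a :
  (forall y z, linear (fun x => f x y z)) ->
  (forall x z, linear (fun y => f x y z)) ->
  (forall x y, linear (fun z => f x y z)) ->
  \sw_(a1, a2 <- Δ a) \sw_(a11, a12 <- Δ a1) f a11 a12 a2 =
  \sw_(a1, a2 <- Δ a) \sw_(a21, a22 <- Δ a2) f a1 a21 a22.
Proof.
move=> f1 f2 f3.
have := congr1 (tlift (fun x t => \sw_(y, z <- t) f x y z)) (comulA a).
have b23 x : bilin (f x) by split; [move=> z; apply: f2|apply: f3].
have bb : bilin (fun x (t : A \ox A) => \sw_(y, z <- t) f x y z).
  split=> [t|x]; first exact: lin_tlift_body.
  exact: tlift_linear.
rewrite !tlift_tlift // => h.
etransitivity; [etransitivity; [|exact: h]|].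
  apply: eq_tlift => x y; rewrite tlift_tlift //.
  by apply: eq_tlift => z w; rewrite !tliftE.
by apply: eq_tlift => x y; rewrite tliftE.
Qed.

Lemma sw_counitl U (f : A -> U) a : linear f ->
  \sw_(a1, a2 <- Δ a) (ε a1 : K) *: f a2 = f a.
Proof.
move=> lf; rewrite -[in RHS](counitl a) lin_tlift //.
by apply: eq_tlift => x y; rewrite linZ.
Qed.

Lemma sw_counitr U (f : A -> U) a : linear f ->
  \sw_(a1, a2 <- Δ a) (ε a2 : K) *: f a1 = f a.
Proof.
move=> lf; rewrite -[in RHS](counitr a) lin_tlift //.
by apply: eq_tlift => x y; rewrite linZ.
Qed.

Lemma sw_antipodel U (f : A -> U) a : linear f ->
  \sw_(a1, a2 <- Δ a) f (S a1 * a2) = (ε a : K) *: f 1.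
Proof. by move=> lf; rewrite -linZ // -antipodel lin_tlift. Qed.

Lemma sw_antipoder U (f : A -> U) a : linear f ->
  \sw_(a1, a2 <- Δ a) f (a1 * S a2) = (ε a : K) *: f 1.
Proof. by move=> lf; rewrite -linZ // -antipoder lin_tlift. Qed.

Lemma sw_comulM U (f : A -> A -> U) a b : bilin f ->
  \sw_(x, y <- Δ (a * b)) f x y =
  \sw_(a1, a2 <- Δ a) \sw_(b1, b2 <- Δ b) f (a1 * b1) (a2 * b2).
Proof.
move=> bf; rewrite comulM tlift_tlift //; apply: eq_tlift => x y.
by rewrite tlift_tlift //; apply: eq_tlift => z w; rewrite tliftE.
Qed.

Lemma antipode1 : S 1 = 1.
Proof.
have := antipodel (1 : A); rewrite comul1 tliftE; last by lin.
by rewrite mulr1 counit1 scale1r.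
Qed.

Lemma counit_antipode a : ε (S a) = ε a.
Proof.
rewrite -[LHS](sw_counitr (f := fun x => ε (S x))); last by lin.
transitivity (\sw_(x, y <- Δ a) ε (S x * y)).
  by apply: eq_tlift => x y; rewrite counitM mulrC.
by rewrite (sw_antipodel (f := ε)) ?counit1 ?[_ *: _]mulr1 //; lin.
Qed.

Lemma antipodeM a b : S (a * b) = S b * S a.
Proof.
pose f a1 a21 a22 b1 b21 b22 := S (a1 * b1) * (a21 * b21) * (S b22 * S a22).
transitivity (\sw_(a1, a2 <- Δ a) \sw_(b1, b2 <- Δ b)
  \sw_(a21, a22 <- Δ a2) \sw_(b21, b22 <- Δ b2) f a1 a21 a22 b1 b21 b22).
  rewrite -[LHS](sw_counitr (f := fun x => S (x * b))); last by lin.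
  apply: eq_tlift => a1 a2.
  rewrite -(sw_counitr (f := fun x => S (a1 * x))); last by lin.
  rewrite lin_tlift; last by lin.
  apply: eq_tlift => b1 b2; symmetry.
  transitivity (\sw_(a21, a22 <- Δ a2)
    (ε b2 : K) *: (S (a1 * b1) * (a21 * S a22))).
    apply: eq_tlift => x y.
    rewrite -[X in _ *: (_ * (X * _))]mulr1.
    rewrite -(sw_antipoder (f := fun z => S (a1 * b1) * (x * z * S y))); last by lin.
    by apply: eq_tlift => z w; rewrite /f !mulrA.
  rewrite (sw_antipoder (f := fun z => (ε b2 : K) *: (S (a1 * b1) * z))); last by lin.
  by rewrite mulr1.
transitivity (\sw_(a1, a2 <- Δ a) \sw_(b1, b2 <- Δ b)
  \sw_(a11, a12 <- Δ a1) \sw_(b11, b12 <- Δ b1) f a11 a12 a2 b11 b12 b2).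
  transitivity (\sw_(a1, a2 <- Δ a) \sw_(a21, a22 <- Δ a2)
     \sw_(b1, b2 <- Δ b) \sw_(b21, b22 <- Δ b2) f a1 a21 a22 b1 b21 b22).
    by apply: eq_tlift => a1 a2; rewrite tlift_exch.
  rewrite -(coassoc (f := fun x y z => \sw_(b1, b2 <- Δ b)
     \sw_(b21, b22 <- Δ b2) f x y z b1 b21 b22)); try by rewrite /f; lin.
  apply: eq_tlift => a1 a2; rewrite tlift_exch.
  transitivity (\sw_(a11, a12 <- Δ a1) \sw_(b1, b2 <- Δ b)
     \sw_(b11, b12 <- Δ b1) f a11 a12 a2 b11 b12 b2).
    rewrite tlift_exch; apply: eq_tlift => a11 a12.
    by rewrite -coassoc //; rewrite /f; lin.
  by rewrite tlift_exch.
rewrite /f -[in RHS](sw_counitl (f := fun x => S b * S x)); last by lin.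
apply: eq_tlift => a1 a2.
rewrite -[in RHS](sw_counitl (f := fun x => S x * S a2)); last by lin.
rewrite scaler_sumr; apply: eq_bigr => -[b1 b2] _ /=.
rewrite -(sw_comulM (f := fun x y => S x * y * (S b2 * S a2))); last by lin.
rewrite (sw_antipodel (f := fun x => x * (S b2 * S a2))); last by lin.
by rewrite counitM mul1r scalerA.
Qed.

Definition tmul (x y : A \ox A) : A \ox A :=
  \sw_(x1, x2 <- x) \sw_(y1, y2 <- y) (x1 * y1) *t (x2 * y2).

Lemma tmul_bilin : bilin tmul.
Proof. by rewrite /tmul; lin. Qed.

Lemma tmulE a b c d : tmul (a *t b) (c *t d) = (a * c) *t (b * d).
Proof. by rewrite /tmul tliftE ?tliftE //; lin. Qed.

Lemma tmul1l x : tmul (1 *t 1) x = x.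
Proof.
move: x; apply: tens_ext => [||u v]; first exact: tmul_bilin.2; first exact: lin_id.
by rewrite tmulE !mul1r.
Qed.

Lemma tmul1r x : tmul x (1 *t 1) = x.
Proof.
move: x; apply: tens_ext => [||u v]; first exact: tmul_bilin.1; first exact: lin_id.
by rewrite tmulE !mulr1.
Qed.

Lemma tmulA x y z : tmul x (tmul y z) = tmul (tmul x y) z.
Proof.
have [lm rm] := tmul_bilin.
move: x; apply: tens_ext => [||x1 x2]; first exact: lm.
  exact: (lin_comp (lm z) (lm y)).
move: y; apply: tens_ext => [||y1 y2].
- exact: (lin_comp (rm _) (lm z)).
- exact: (lin_comp (lm z) (rm _)).
move: z; apply: tens_ext => [||z1 z2].
- exact: (lin_comp (rm _) (rm _)).
- exact: rm.
by rewrite !tmulE !mulrA.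
Qed.

Lemma comul_antipode a : Δ (S a) = \sw_(a1, a2 <- Δ a) S a2 *t S a1.
Proof.
have [lm rm] := tmul_bilin.
have lm' U (g : U -> A \ox A) t : linear g -> linear (fun x => tmul (g x) t).
  by move=> lg; exact: (lin_comp (lm t) lg).
have rm' U (g : U -> A \ox A) t : linear g -> linear (fun x => tmul t (g x)).
  by move=> lg; exact: (lin_comp (rm t) lg).
pose f x y z w : A \ox A := tmul (Δ (S x)) (tmul (Δ y) (S w *t S z)).
transitivity (\sw_(a1, a2 <- Δ a) \sw_(a21, a22 <- Δ a2) \sw_(z, w <- Δ a22)
   f a1 a21 z w).
  rewrite -[LHS](sw_counitr (f := fun x => Δ (S x))); last by lin.
  apply: eq_tlift => x y.
  transitivity (tmul (Δ (S x)) ((ε y : K) *: (1 *t 1))).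
    by rewrite (linZ (rm _)) tmul1r.
  transitivity (tmul (Δ (S x)) (\sw_(y1, y2 <- Δ y) \sw_(z, w <- Δ y2)
       tmul (Δ y1) (S w *t S z))).
    congr tmul; symmetry.
    transitivity (\sw_(y1, y2 <- Δ y) \sw_(z, w <- Δ y2) \sw_(p, q <- Δ y1)
       (p * S w) *t (q * S z)).
      apply: eq_tlift => y1 y2; apply: eq_tlift => z w.
      rewrite {1}(tensE (Δ y1)) (lin_tlift _ _ (lm _)).
      by apply: eq_tlift => p q; rewrite tmulE.
    transitivity (\sw_(y1, y2 <- Δ y) \sw_(p, q <- Δ y1) \sw_(z, w <- Δ y2)
       (p * S w) *t (q * S z)).
      by apply: eq_tlift => y1 y2; rewrite tlift_exch.
    rewrite (coassoc (f := fun p q r => \sw_(z, w <- Δ r) (p * S w) *t (q * S z)));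
      try by lin.
    transitivity (\sw_(p, r <- Δ y) (p * S r) *t (1 : A)).
      apply: eq_tlift => p r.
      rewrite -(coassoc (f := fun q z w => (p * S w) *t (q * S z))); try by lin.
      rewrite -[RHS](sw_counitl (f := fun r => (p * S r) *t (1 : A))); last by lin.
      apply: eq_tlift => r1 r2.
      by rewrite (sw_antipoder (f := fun q => (p * S r2) *t q)) //; lin.
    by rewrite (sw_antipoder (f := fun q => q *t (1 : A))) //; lin.
  rewrite (lin_tlift _ _ (rm _)); apply: eq_tlift => y1 y2.
  by rewrite (lin_tlift _ _ (rm _)).
rewrite -(coassoc (f := fun x y r => \sw_(z, w <- Δ r) f x y z w)); last first.
- by move=> x y; rewrite /f; lin.
- by move=> x z; apply: lin_tlift_body => p q; rewrite /f; apply: rm'; apply: lm'; lin.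
- by move=> x z; apply: lin_tlift_body => p q; rewrite /f; apply: lm'; lin.
rewrite -[RHS](sw_counitl (f := fun x => \sw_(a1, a2 <- Δ x) S a2 *t S a1)); last by lin.
apply: eq_tlift => x y; rewrite tlift_exch scaler_sumr.
apply: eq_bigr => -[z w] _ /=; rewrite /f.
transitivity (\sw_(p, q <- Δ x) tmul (Δ (S p * q)) (S w *t S z)).
  apply: eq_tlift => p q; rewrite tmulA; congr (tmul _ _).
  by rewrite comulM.
rewrite (sw_antipodel (f := fun t => tmul (Δ t) (S w *t S z))); last first.
  by apply: lm'; lin.
by rewrite comul1 tmul1l.
Qed.
End HopfTheory.

Record linCat (K : fieldType) := LinCat {
  cob :> Type;
  chom : cob -> cob -> lmodType K;
  idm : forall X, chom X X;
  ccomp : forall X Y Z, chom Y Z -> chom X Y -> chom X Z;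
  ccompA : forall X Y Z T (h : chom Z T) (g : chom Y Z) (f : chom X Y),
    ccomp h (ccomp g f) = ccomp (ccomp h g) f;
  ccomp1f : forall X Y (f : chom X Y), ccomp (idm Y) f = f;
  ccompf1 : forall X Y (f : chom X Y), ccomp f (idm X) = f;
  ccomp_bilin : forall X Y Z, bilin (@ccomp X Y Z) }.

Arguments idm {K} l X : rename.
Notation "g \oc f" := (ccomp g f) (at level 50, left associativity).

Record ciso (K : fieldType) (C : linCat K) (X Y : C) := CIso {
  iso_fw :> chom X Y;
  iso_bw : chom Y X;
  iso_fwK : iso_bw \oc iso_fw = idm C X;
  iso_bwK : iso_fw \oc iso_bw = idm C Y }.

Record tensorCat (K : fieldType) := TensorCat {
  tc_cat :> linCat K;
  tob : tc_cat -> tc_cat -> tc_cat;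
  thom : forall X X' Y Y' : tc_cat,
    chom X X' -> chom Y Y' -> chom (tob X Y) (tob X' Y');
  thom1 : forall X Y, thom (idm tc_cat X) (idm tc_cat Y) = idm tc_cat (tob X Y);
  thom_comp : forall X X' X'' Y Y' Y'' (f' : chom X' X'') (f : chom X X')
    (g' : chom Y' Y'') (g : chom Y Y'),
    thom (f' \oc f) (g' \oc g) = thom f' g' \oc thom f g;
  thom_bilin : forall X X' Y Y', bilin (@thom X X' Y Y');
  tunit : tc_cat;
  tassoc : forall X Y Z, ciso (tob (tob X Y) Z) (tob X (tob Y Z));
  tassoc_nat : forall X X' Y Y' Z Z'
    (f : chom X X') (g : chom Y Y') (h : chom Z Z'),
    thom f (thom g h) \oc tassoc X Y Z = tassoc X' Y' Z' \oc thom (thom f g) h;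
  tlunit : forall X, ciso (tob tunit X) X;
  tlunit_nat : forall X X' (f : chom X X'),
    f \oc tlunit X = tlunit X' \oc thom (idm tc_cat tunit) f;
  trunit : forall X, ciso (tob X tunit) X;
  trunit_nat : forall X X' (f : chom X X'),
    f \oc trunit X = trunit X' \oc thom f (idm tc_cat tunit);
  tpentagon : forall X Y Z T,
    tassoc X Y (tob Z T) \oc tassoc (tob X Y) Z T =
    thom (idm tc_cat X) (tassoc Y Z T) \oc tassoc X (tob Y Z) T
      \oc thom (tassoc X Y Z) (idm tc_cat T);
  ttriangle : forall X Y,
    thom (idm tc_cat X) (tlunit Y) \oc tassoc X tunit Y =
    thom (trunit X) (idm tc_cat Y) }.

Arguments tunit {K} t : rename.

Record linFunctor (K : fieldType) (C D : linCat K) := LinFunctor {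
  fob :> C -> D;
  fhom : forall X Y : C, chom X Y -> chom (fob X) (fob Y);
  fhom1 : forall X, fhom (idm C X) = idm D (fob X);
  fhom_comp : forall X Y Z (g : chom Y Z) (f : chom X Y),
    fhom (g \oc f) = fhom g \oc fhom f;
  fhom_linear : forall X Y, linear (@fhom X Y) }.

Arguments fhom {K C D} l {X Y} _ : rename.

Section Functors.
Variable K : fieldType.

Definition idFunctor (C : linCat K) : linFunctor C C :=
  @LinFunctor K C C (fun X => X) (fun X Y f => f)
    (fun X => erefl) (fun X Y Z g f => erefl) (fun X Y a f g => erefl).

Section Comp.
Variables (C D E : linCat K) (G : linFunctor D E) (F : linFunctor C D).

Lemma compFunctor1 X : fhom G (fhom F (idm C X)) = idm E (G (F X)).
Proof. by rewrite !fhom1. Qed.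

Lemma compFunctor_comp X Y Z (g : chom Y Z) (f : chom X Y) :
  fhom G (fhom F (g \oc f)) = fhom G (fhom F g) \oc fhom G (fhom F f).
Proof. by rewrite !fhom_comp. Qed.

Lemma compFunctor_linear X Y : linear (fun f : chom X Y => fhom G (fhom F f)).
Proof. exact: (lin_comp (@fhom_linear _ _ _ G _ _) (@fhom_linear _ _ _ F _ _)). Qed.

Definition compFunctor : linFunctor C E :=
  @LinFunctor K C E (fun X => G (F X)) _
    compFunctor1 compFunctor_comp compFunctor_linear.

End Comp.

Record natIso (C D : linCat K) (F G : linFunctor C D) := NatIso {
  ni :> forall X, ciso (F X) (G X);
  ni_nat : forall X Y (f : chom X Y), ni Y \oc fhom F f = fhom G f \oc ni X }.

Definition is_equivalence (C D : linCat K) (F : linFunctor C D) : Prop :=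
  exists G : linFunctor D C,
    inhabited (natIso (compFunctor G F) (idFunctor C)) /\
    inhabited (natIso (compFunctor F G) (idFunctor D)).

Record tensorFunctor (C D : tensorCat K) := TensorFunctor {
  tf_fun :> linFunctor C D;
  tf_mul : forall X Y : C, ciso (tob (tf_fun X) (tf_fun Y)) (tf_fun (tob X Y));
  tf_mul_nat : forall X X' Y Y' (f : chom X X') (g : chom Y Y'),
    fhom tf_fun (thom f g) \oc tf_mul X Y =
    tf_mul X' Y' \oc thom (fhom tf_fun f) (fhom tf_fun g);
  tf_unit : ciso (tunit D) (tf_fun (tunit C));
  tf_assoc : forall X Y Z : C,
    fhom tf_fun (tassoc X Y Z) \oc tf_mul (tob X Y) Z
      \oc thom (tf_mul X Y) (idm D (tf_fun Z)) =
    tf_mul X (tob Y Z) \oc thom (idm D (tf_fun X)) (tf_mul Y Z)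
      \oc tassoc (tf_fun X) (tf_fun Y) (tf_fun Z);
  tf_lunit : forall X : C,
    fhom tf_fun (tlunit X) \oc tf_mul (tunit C) X
      \oc thom tf_unit (idm D (tf_fun X)) = tlunit (tf_fun X);
  tf_runit : forall X : C,
    fhom tf_fun (trunit X) \oc tf_mul X (tunit C)
      \oc thom (idm D (tf_fun X)) tf_unit = trunit (tf_fun X) }.

(* As usual for monoidal functors, the quasi-inverse carries no monoidal
   structure: one is induced on it. *)
Record tensorEquiv (C D : tensorCat K) := TensorEquiv {
  te_fun :> tensorFunctor C D;
  te_equiv : is_equivalence te_fun }.

End Functors.

Record comodule (K : fieldType) (A : hopfAlgebra K) := Comodule {
  comod_mod :> lmodType K;
  coact : {linear comod_mod -> comod_mod \ox A};
  coactA : forall v,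
    \sw_(v0, v1 <- coact v) \sw_(v00, v01 <- coact v0) v00 *t (v01 *t v1) =
    \sw_(v0, v1 <- coact v) v0 *t comul v1;
  coact_counit : forall v, \sw_(v0, v1 <- coact v) (counit v1 : K) *: v0 = v }.

Arguments coact {K A c} : rename.

Section Comodules.
Variables (K : fieldType) (A : hopfAlgebra K).
Implicit Types (V W X : comodule A) (U : lmodType K).

Lemma coactA_sw V U (f : V -> A -> A -> U) (v : V) :
  (forall y z, linear (fun x => f x y z)) ->
  (forall x z, linear (fun y => f x y z)) ->
  (forall x y, linear (fun z => f x y z)) ->
  \sw_(v0, v1 <- coact v) \sw_(v00, v01 <- coact v0) f v00 v01 v1 =
  \sw_(v0, v1 <- coact v) \sw_(v1', v1'' <- comul v1) f v0 v1' v1''.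
Proof.
move=> f1 f2 f3.
have := congr1 (tlift (fun x t => \sw_(y, z <- t) f x y z)) (coactA v).
have b23 x : bilin (f x) by split; [move=> z; apply: f2|apply: f3].
have bb : bilin (fun x (t : A \ox A) => \sw_(y, z <- t) f x y z).
  split=> [t|x]; first exact: lin_tlift_body.
  exact: tlift_linear.
rewrite !tlift_tlift // => h.
etransitivity; [etransitivity; [|exact: h]|].
  apply: eq_tlift => x y; rewrite tlift_tlift //.
  by apply: eq_tlift => z w; rewrite !tliftE.
by apply: eq_tlift => x y; rewrite tliftE.
Qed.

Lemma coact_counit_sw V U (f : V -> U) (v : V) : linear f ->
  \sw_(v0, v1 <- coact v) (counit v1 : K) *: f v0 = f v.
Proof.
move=> lf; rewrite -[in RHS](coact_counit v) lin_tlift //.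
by apply: eq_tlift => x y; rewrite linZ.
Qed.

Definition colinear V W (f : V -> W) : Prop :=
  forall v, coact (f v) = \sw_(v0, v1 <- coact v) f v0 *t v1.

Definition comod_morph V W : {pred V -> W} :=
  fun f => `[< linear f /\ colinear f >].
Arguments comod_morph : clear implicits.

Lemma colinear_sw V W U (f : V -> W) (b : W -> A -> U) v : bilin b -> colinear f ->
  \sw_(w0, w1 <- coact (f v)) b w0 w1 = \sw_(v0, v1 <- coact v) b (f v0) v1.
Proof.
move=> bb ->; rewrite tlift_tlift //; apply: eq_tlift => x y.
by rewrite tliftE.
Qed.

Lemma lin_fct_comb U U' a (f g : U -> U') :
  linear f -> linear g -> linear (a *: f + g).
Proof.
move=> lf lg; apply: linI => b x y.
have E z : (a *: f + g) z = a *: f z + g z by [].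
rewrite !E (linP lf) (linP lg) !scalerDr !scalerA mulrC -!addrA.
by congr (_ + _); rewrite addrCA.
Qed.

Lemma colinear_comb V W a (f g : V -> W) :
  colinear f -> colinear g -> colinear (a *: f + g).
Proof.
have E z : (a *: f + g) z = a *: f z + g z by [].
move=> cf cg v; rewrite E linearP cf cg /tlift scaler_sumr -big_split.
by apply: eq_bigr => p _ /=; rewrite E (linP (lin_tensl _ (@lin_id _ _))).
Qed.

Lemma comod_morph_submod V W : submod_closed (comod_morph V W).
Proof.
split=> [|a f g].
  rewrite unfold_in; apply/asboolP; split.
    by apply: linI => a x y; rewrite -[RHS]/(a *: 0 + 0) scaler0 addr0.
  move=> v; rewrite [0 v]/(0 : W) linear0 /tlift big1 // => p _.
  by rewrite (lin0 (lin_tensl _ (@lin_id _ _))).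
rewrite !unfold_in => /asboolP [lf cf] /asboolP [lg cg]; apply/asboolP.
by split; [exact: lin_fct_comb|exact: colinear_comb].
Qed.

HB.instance Definition _ V W :=
  GRing.isSubmodClosed.Build K (V -> W) (comod_morph V W)
    (comod_morph_submod V W).

Record comodHom V W := ComodHom {
  comodHom_fun :> V -> W;
  comodHom_subproof : comodHom_fun \in comod_morph V W }.

HB.instance Definition _ V W := [isSub for @comodHom_fun V W].
HB.instance Definition _ V W := [Choice of comodHom V W by <:].
HB.instance Definition _ V W := [SubChoice_isSubLmodule of comodHom V W by <:].

Lemma comodHom_linear V W (f : comodHom V W) : linear f.
Proof. by case: f => f /= /asboolP[]. Qed.
Lemma comodHom_colinear V W (f : comodHom V W) : colinear f.
Proof. by case: f => f /= /asboolP[]. Qed.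

Lemma comodHomP V W (f g : comodHom V W) : (forall v, f v = g v) -> f = g.
Proof. by move=> fg; apply/val_inj/funext. Qed.

Definition mkComodHom V W (f : V -> W) (lf : linear f) (cf : colinear f) :
  comodHom V W := ComodHom (asboolT (conj lf cf)).

End Comodules.

Arguments comod_morph {K A} V W _.

Ltac lin_ext ::=
  lazymatch goal with
  | |- GRing.linear_for _ (fun x => comodHom_fun ?f _) =>
    apply: (lin_comp (comodHom_linear f))
  end.

Section ComodTensor.
Variables (K : fieldType) (A : hopfAlgebra K).
Implicit Types (V W X : comodule A) (U : lmodType K).

Definition tens_coact_fun V W (x : V \ox W) : (V \ox W) \ox A :=
  \sw_(v, w <- x) \sw_(v0, v1 <- coact v) \sw_(w0, w1 <- coact w)
    (v0 *t w0) *t (v1 * w1).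

Lemma tens_coact_linear V W : linear (@tens_coact_fun V W).
Proof. by rewrite /tens_coact_fun; lin. Qed.

Lemma tens_coactE V W (v : V) (w : W) :
  tens_coact_fun (v *t w) =
  \sw_(v0, v1 <- coact v) \sw_(w0, w1 <- coact w) (v0 *t w0) *t (v1 * w1).
Proof. by rewrite /tens_coact_fun tliftE //; lin. Qed.

Lemma tens_coact_sw V W U (b : V \ox W -> A -> U) v w : bilin b ->
  \sw_(x, y <- tens_coact_fun (v *t w)) b x y =
  \sw_(v0, v1 <- coact v) \sw_(w0, w1 <- coact w) b (v0 *t w0) (v1 * w1).
Proof.
move=> bb; rewrite tens_coactE tlift_tlift //; apply: eq_tlift => x y.
by rewrite tlift_tlift //; apply: eq_tlift => z t; rewrite tliftE.
Qed.

Definition tens_coact V W := mklin (@tens_coact_linear V W).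

Lemma tens_coactA V W (x : V \ox W) :
  \sw_(v0, v1 <- tens_coact V W x) \sw_(v00, v01 <- tens_coact V W v0)
     v00 *t (v01 *t v1) =
  \sw_(v0, v1 <- tens_coact V W x) v0 *t comul v1.
Proof.
move: x; apply: tens_ext => [||v w]; [by lin|by lin|].
rewrite /= !tens_coact_sw; [|by lin|by have := @tens_coact_linear V W; lin].
transitivity (\sw_(v0, v1 <- coact v) \sw_(v00, v01 <- coact v0)
  \sw_(w0, w1 <- coact w) \sw_(w00, w01 <- coact w0)
    (v00 *t w00) *t ((v01 * w01) *t (v1 * w1))).
  apply: eq_tlift => v0 v1; rewrite [RHS]tlift_exch.
  by apply: eq_tlift => w0 w1; rewrite tens_coact_sw //; lin.
rewrite (coactA_sw (f := fun x y z => \sw_(w0, w1 <- coact w)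
  \sw_(w00, w01 <- coact w0) (x *t w00) *t ((y * w01) *t (z * w1)))); try by lin.
apply: eq_tlift => v0 v1.
transitivity (\sw_(v1', v1'' <- comul v1) \sw_(w0, w1 <- coact w)
  \sw_(w1', w1'' <- comul w1) (v0 *t w0) *t ((v1' * w1') *t (v1'' * w1''))).
  apply: eq_tlift => x y.
  by rewrite (coactA_sw (f := fun w0 z t => (v0 *t w0) *t ((x * z) *t (y * t))));
    try by lin.
rewrite tlift_exch; apply: eq_tlift => w0 w1.
rewrite comulM lin_tlift; last by lin.
by apply: eq_tlift => x y; rewrite lin_tlift; last by lin.
Qed.

Lemma tens_coact_counit V W (x : V \ox W) :
  \sw_(v0, v1 <- tens_coact V W x) (counit v1 : K) *: v0 = x.
Proof.
move: x; apply: tens_ext => [||v w]; [by lin|by lin|].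
rewrite /= tens_coact_sw; last by lin.
rewrite -[RHS](coact_counit_sw (f := fun x => x *t w)); last by lin.
apply: eq_tlift => v0 v1.
rewrite -[X in _ = _ *: X](coact_counit_sw (f := fun x => v0 *t x)); last by lin.
rewrite [RHS]lin_tlift; last by lin.
by apply: eq_tlift => w0 w1; rewrite counitM scalerA.
Qed.

Definition comod_tens V W : comodule A :=
  @Comodule K A (V \ox W) (tens_coact V W) (@tens_coactA V W)
    (@tens_coact_counit V W).

Definition triv_coact_fun (x : K^o) : K^o \ox A := x *t 1.

Lemma triv_coact_linear : linear triv_coact_fun.
Proof. by rewrite /triv_coact_fun; lin. Qed.

Definition triv_coact := mklin triv_coact_linear.

Lemma triv_coactA (x : K^o) :
  \sw_(v0, v1 <- triv_coact x) \sw_(v00, v01 <- triv_coact v0)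
     v00 *t (v01 *t v1) =
  \sw_(v0, v1 <- triv_coact x) v0 *t comul v1.
Proof.
rewrite /= /triv_coact_fun tliftE; last by lin.
by rewrite !tliftE ?comul1 //; lin.
Qed.

Lemma triv_coact_counit (x : K^o) :
  \sw_(v0, v1 <- triv_coact x) (counit v1 : K) *: v0 = x.
Proof.
rewrite /= /triv_coact_fun tliftE; last by lin.
by rewrite counit1 scale1r.
Qed.

Definition comod_unit : comodule A :=
  @Comodule K A K^o triv_coact triv_coactA triv_coact_counit.

End ComodTensor.

Section TensorMaps.
Variable K : fieldType.
Implicit Types U V W X : lmodType K.

Definition tmap U V W X (f : U -> V) (g : W -> X) (x : U \ox W) : V \ox X :=
  \sw_(u, w <- x) f u *t g w.

Lemma tmap_bilin_subproof U V W X (f : U -> V) (g : W -> X) :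
  linear f -> linear g -> bilin (fun u w => f u *t g w).
Proof. by move=> lf lg; lin. Qed.

Lemma tmapE U V W X (f : U -> V) (g : W -> X) u w : linear f -> linear g ->
  tmap f g (u *t w) = f u *t g w.
Proof. by move=> lf lg; rewrite /tmap tliftE //; exact: tmap_bilin_subproof. Qed.

Lemma tmap_linear U V W X (f : U -> V) (g : W -> X) : linear f -> linear g ->
  linear (tmap f g).
Proof. by move=> lf lg; apply: tlift_linear; exact: tmap_bilin_subproof. Qed.

Definition tassoc_fun U V W (x : (U \ox V) \ox W) : U \ox (V \ox W) :=
  \sw_(y, w <- x) \sw_(u, v <- y) u *t (v *t w).
Definition tassocV_fun U V W (x : U \ox (V \ox W)) : (U \ox V) \ox W :=
  \sw_(u, y <- x) \sw_(v, w <- y) (u *t v) *t w.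
Definition tlunit_fun V (x : K^o \ox V) : V := tlift (fun (k : K^o) v => (k : K) *: v) x.
Definition tlunitV_fun V (v : V) : K^o \ox V := (1 : K^o) *t v.
Definition trunit_fun V (x : V \ox K^o) : V := tlift (fun v (k : K^o) => (k : K) *: v) x.
Definition trunitV_fun V (v : V) : V \ox K^o := v *t (1 : K^o).

Lemma tassoc_linear U V W : linear (@tassoc_fun U V W).
Proof. by rewrite /tassoc_fun; lin. Qed.
Lemma tassocV_linear U V W : linear (@tassocV_fun U V W).
Proof. by rewrite /tassocV_fun; lin. Qed.
Lemma tlunit_linear V : linear (@tlunit_fun V).
Proof. by rewrite /tlunit_fun; lin. Qed.
Lemma tlunitV_linear V : linear (@tlunitV_fun V).
Proof. by rewrite /tlunitV_fun; lin. Qed.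
Lemma trunit_linear V : linear (@trunit_fun V).
Proof. by rewrite /trunit_fun; lin. Qed.
Lemma trunitV_linear V : linear (@trunitV_fun V).
Proof. by rewrite /trunitV_fun; lin. Qed.

Lemma tassocE U V W (u : U) (v : V) (w : W) :
  tassoc_fun ((u *t v) *t w) = u *t (v *t w).
Proof. by rewrite /tassoc_fun tliftE ?tliftE //; lin. Qed.
Lemma tassocVE U V W (u : U) (v : V) (w : W) :
  tassocV_fun (u *t (v *t w)) = (u *t v) *t w.
Proof. by rewrite /tassocV_fun tliftE ?tliftE //; lin. Qed.
Lemma tlunitE V (k : K^o) (v : V) : tlunit_fun (k *t v) = (k : K) *: v.
Proof. by rewrite /tlunit_fun tliftE //; lin. Qed.
Lemma trunitE V (k : K^o) (v : V) : trunit_fun (v *t k) = (k : K) *: v.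
Proof. by rewrite /trunit_fun tliftE //; lin. Qed.

Lemma tassocK U V W (x : (U \ox V) \ox W) : tassocV_fun (tassoc_fun x) = x.
Proof.
move: x; apply: tens_ext => [||x w].
- exact: (lin_comp (@tassocV_linear _ _ _) (@tassoc_linear _ _ _)).
- exact: lin_id.
move: x; apply: tens_ext => [||u v].
- apply: (lin_comp (@tassocV_linear _ _ _)).
  by apply: (lin_comp (@tassoc_linear _ _ _)); lin.
- by lin.
by rewrite tassocE tassocVE.
Qed.

Lemma tassocVK U V W (x : U \ox (V \ox W)) : tassoc_fun (tassocV_fun x) = x.
Proof.
move: x; apply: tens_ext => [||u x].
- exact: (lin_comp (@tassoc_linear _ _ _) (@tassocV_linear _ _ _)).
- exact: lin_id.
move: x; apply: tens_ext => [||v w].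
- apply: (lin_comp (@tassoc_linear _ _ _)).
  by apply: (lin_comp (@tassocV_linear _ _ _)); lin.
- by lin.
by rewrite tassocVE tassocE.
Qed.

Lemma tlunitK V (x : K^o \ox V) : tlunitV_fun (tlunit_fun x) = x.
Proof.
move: x; apply: tens_ext => [||k v].
- exact: (lin_comp (@tlunitV_linear _) (@tlunit_linear _)).
- exact: lin_id.
by rewrite tlunitE /tlunitV_fun tensZr -tensZl [_ *: _]mulr1.
Qed.
Lemma tlunitVK V (v : V) : tlunit_fun (tlunitV_fun v) = v.
Proof. by rewrite /tlunitV_fun tlunitE scale1r. Qed.

Lemma trunitK V (x : V \ox K^o) : trunitV_fun (trunit_fun x) = x.
Proof.
move: x; apply: tens_ext => [||v k].
- exact: (lin_comp (@trunitV_linear _) (@trunit_linear _)).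
- exact: lin_id.
by rewrite trunitE /trunitV_fun tensZl -tensZr [_ *: _]mulr1.
Qed.
Lemma trunitVK V (v : V) : trunit_fun (trunitV_fun v) = v.
Proof. by rewrite /trunitV_fun trunitE scale1r. Qed.

Lemma tmap_id V W (x : V \ox W) : tmap (fun v => v) (fun w => w) x = x.
Proof. exact/esym/tensE. Qed.

Lemma tmap_comp U V W U' V' W' (f : U -> V) (g : V -> W) (f' : U' -> V')
    (g' : V' -> W') : linear f -> linear g -> linear f' -> linear g' ->
  forall x, tmap (fun u => g (f u)) (fun u => g' (f' u)) x =
    tmap g g' (tmap f f' x).
Proof.
move=> lf lg lf' lg'; apply: tens_ext => [||u v].
- exact: (tmap_linear (lin_comp lg lf) (lin_comp lg' lf')).
- exact: (lin_comp (tmap_linear lg lg') (tmap_linear lf lf')).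
- rewrite !tmapE //.
    exact: (lin_comp lg lf).
  exact: (lin_comp lg' lf').
Qed.

Lemma tassoc_natE U U' V V' W W' (f : U -> U') (g : V -> V') (h : W -> W') :
  linear f -> linear g -> linear h -> forall x,
  tmap f (tmap g h) (tassoc_fun x) = tassoc_fun (tmap (tmap f g) h x).
Proof.
move=> lf lg lh.
have lfg := tmap_linear lf lg; have lgh := tmap_linear lg lh.
have lf_gh := tmap_linear lf lgh; have lfg_h := tmap_linear lfg lh.
have la1 := @tassoc_linear U V W; have la2 := @tassoc_linear U' V' W'.
apply: tens_ext => [||x w].
- exact: (lin_comp lf_gh la1).
- exact: (lin_comp la2 lfg_h).
move: x; apply: tens_ext => [||u v].
- by apply: (lin_comp lf_gh); apply: (lin_comp la1); lin.
- by apply: (lin_comp la2); apply: (lin_comp lfg_h); lin.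
by rewrite tassocE !tmapE // tassocE.
Qed.

Lemma tlunit_natE V W (f : V -> W) : linear f -> forall x : K^o \ox V,
  f (tlunit_fun x) = tlunit_fun (tmap (fun k => k) f x).
Proof.
move=> lf; apply: tens_ext => [||k v].
- exact: (lin_comp lf (@tlunit_linear V)).
- exact: (lin_comp (@tlunit_linear W) (tmap_linear (@lin_id _ _) lf)).
by rewrite tmapE // !tlunitE (linZ lf).
Qed.

Lemma trunit_natE V W (f : V -> W) : linear f -> forall x : V \ox K^o,
  f (trunit_fun x) = trunit_fun (tmap f (fun k => k) x).
Proof.
move=> lf; apply: tens_ext => [||v k].
- exact: (lin_comp lf (@trunit_linear V)).
- exact: (lin_comp (@trunit_linear W) (tmap_linear lf (@lin_id _ _))).
by rewrite tmapE // !trunitE (linZ lf).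
Qed.

Lemma tpentagonE U V W X (x : ((U \ox V) \ox W) \ox X) :
  tassoc_fun (tassoc_fun x) =
  tmap (fun u => u) (@tassoc_fun V W X)
    (tassoc_fun (tmap (@tassoc_fun U V W) (fun x => x) x)).
Proof.
have a1 := @tassoc_linear U V W; have a2 := @tassoc_linear V W X.
have a3 := @tassoc_linear (U \ox V) W X; have a4 := @tassoc_linear U V (W \ox X).
have a5 := @tassoc_linear U (V \ox W) X.
have t1 := tmap_linear (@lin_id _ U) a2; have t2 := tmap_linear a1 (@lin_id _ X).
have L1 := lin_comp a4 a3; have L2 := lin_comp t1 (lin_comp a5 t2).
move: x; apply: tens_ext => [//|//|x t].
move: x; apply: tens_ext => [||x w].
- by apply: (lin_comp L1); lin.
- by apply: (lin_comp L2); lin.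
move: x; apply: tens_ext => [||u v].
- by apply: (lin_comp L1); lin.
- by apply: (lin_comp L2); lin.
by rewrite !(tassocE, tmapE).
Qed.

Lemma ttriangleE V W (x : (V \ox K^o) \ox W) :
  tmap (fun v => v) (@tlunit_fun W) (tassoc_fun x) =
  tmap (@trunit_fun V) (fun w => w) x.
Proof.
have a := @tassoc_linear V K^o W; have l := @tlunit_linear W.
have r := @trunit_linear V.
have t1 := tmap_linear (@lin_id _ V) l; have t2 := tmap_linear r (@lin_id _ W).
have L1 := lin_comp t1 a.
move: x; apply: tens_ext => [//|//|x w].
move: x; apply: tens_ext => [||v k].
- by apply: (lin_comp L1); lin.
- by apply: (lin_comp t2); lin.
by rewrite tassocE !tmapE // tlunitE trunitE tensZr tensZl.
Qed.

End TensorMaps.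

Section ComodCat.
Variables (K : fieldType) (A : hopfAlgebra K).
Implicit Types (V W X Y : comodule A) (U : lmodType K).

Lemma colinear_id V : colinear (fun x : V => x).
Proof. by move=> v; rewrite -tensE. Qed.

Lemma colinear_comp V W X (g : W -> X) (f : V -> W) :
  linear g -> colinear g -> colinear f -> colinear (fun x => g (f x)).
Proof.
move=> lg cg cf v; rewrite cg (colinear_sw (b := fun x y => g x *t y)) //.
by apply: bilinI => [a|x]; [apply: lin_tensl|lin].
Qed.

Lemma colinear_tmap V V' W W' (f : V -> V') (g : W -> W') :
  linear f -> linear g -> colinear f -> colinear g ->
  @colinear K A (comod_tens V W) (comod_tens V' W') (tmap f g).
Proof.
move=> lf lg cf cg.
have lt := tmap_linear lf lg.
have bt : bilin (fun x (y : A) => tmap f g x *t y).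
  by apply: bilinI => [y|x]; [apply: lin_tensl|lin].
apply: tens_ext => [||v w].
- exact: (lin_comp (@tens_coact_linear _ _ _ _) lt).
- by apply: lin_tlift_arg (@tens_coact_linear _ _ _ _).
rewrite tmapE //= tens_coactE.
rewrite (tens_coact_sw _ _ bt).
have b2 v0 v1 : bilin (fun w0 (w1 : A) => (v0 *t w0 : V' \ox W') *t ((v1 : A) * w1)).
  by lin.
rewrite (colinear_sw (b := fun v0 v1 => \sw_(w0, w1 <- coact (g w))
   (v0 *t w0) *t (v1 * w1))) //; last by lin.
apply: eq_tlift => v0 v1.
rewrite colinear_sw //; apply: eq_tlift => w0 w1.
by rewrite tmapE.
Qed.

Lemma colinear_tassoc V W X :
  @colinear K A (comod_tens (comod_tens V W) X) (comod_tens V (comod_tens W X))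
    (@tassoc_fun K V W X).
Proof.
have la := @tassoc_linear K V W X.
have bt : bilin (fun x (y : A) => @tassoc_fun K V W X x *t y).
  by apply: bilinI => [y|x]; [apply: lin_tensl|lin].
apply: tens_ext => [||x w].
- exact: (lin_comp (@tens_coact_linear _ _ V (comod_tens W X)) la).
- by apply: lin_tlift_arg (@tens_coact_linear _ _ (comod_tens V W) X).
move: x; apply: tens_ext => [||u v].
- apply: (lin_comp (@tens_coact_linear _ _ V (comod_tens W X))).
  by apply: (lin_comp la); lin.
- apply: lin_tlift_arg => //.
  by apply: (lin_comp (@tens_coact_linear _ _ (comod_tens V W) X)); lin.
rewrite tassocE /=.
rewrite (@tens_coact_sw _ _ (comod_tens V W) X _ _ _ _ bt) /=.
rewrite (@tens_coact_sw _ _ V W _ (fun v0 v1 => \sw_(w0, w1 <- coact w)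
   (tassoc_fun (v0 *t w0) *t (v1 * w1)))); last first.
  apply: bilinI => [y|y]; last by lin.
  by apply: lin_tlift_body => z t; apply: lin_tensl; apply: (lin_comp la); lin.
rewrite (@tens_coactE _ _ V (comod_tens W X)).
apply: eq_tlift => u0 u1 /=.
rewrite (@tens_coact_sw _ _ W X _ (fun w0 w1 => u0 *t w0 *t (u1 * w1))); last by lin.
apply: eq_tlift => v0 v1; apply: eq_tlift => w0 w1.
by rewrite tassocE mulrA.
Qed.

Lemma colinear_tlunit V :
  @colinear K A (comod_tens (comod_unit A) V) V (@tlunit_fun K V).
Proof.
have la := @tlunit_linear K V.
have bt : bilin (fun x (y : A) => @tlunit_fun K V x *t y).
  by apply: bilinI => [y|x]; [apply: lin_tensl|lin].
apply: tens_ext => [||x v].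
- exact: lin_app.
- by apply: lin_tlift_arg (@tens_coact_linear _ _ (comod_unit A) V).
rewrite tlunitE /= (@tens_coact_sw _ _ (comod_unit A) V _ _ _ _ bt) /=.
rewrite /triv_coact_fun tliftE; last first.
  apply: bilinI => [y|y]; last by lin.
  by apply: lin_tlift_body => z t; apply: lin_tensl; apply: (lin_comp la); lin.
rewrite linearZ.
rewrite [LHS](_ : _ = \sw_(a, b <- coact v) (x : K) *: (a *t b)); last first.
  by rewrite -tliftZr -tensE.
by apply: eq_tlift => a b; rewrite tlunitE mul1r tensZl.
Qed.

Lemma colinear_trunit V :
  @colinear K A (comod_tens V (comod_unit A)) V (@trunit_fun K V).
Proof.
have la := @trunit_linear K V.
have bt : bilin (fun x (y : A) => @trunit_fun K V x *t y).
  by apply: bilinI => [y|x]; [apply: lin_tensl|lin].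
apply: tens_ext => [||v x].
- exact: lin_app.
- by apply: lin_tlift_arg (@tens_coact_linear _ _ V (comod_unit A)).
rewrite trunitE /= (@tens_coact_sw _ _ V (comod_unit A) _ _ _ _ bt) /=.
rewrite linearZ.
rewrite [LHS](_ : _ = \sw_(a, b <- coact v) (x : K) *: (a *t b)); last first.
  by rewrite -tliftZr -tensE.
apply: eq_tlift => a b; rewrite /triv_coact_fun tliftE; last first.
  apply: bilinI => [y|y]; last by lin.
  by apply: lin_tensl; apply: (lin_comp la); lin.
by rewrite trunitE mulr1 tensZl.
Qed.

Lemma colinear_inv V W (f : V -> W) (g : W -> V) :
  linear f -> linear g -> cancel f g -> cancel g f -> colinear f -> colinear g.
Proof.
move=> lf lg fK gK cf w; rewrite -[in RHS](gK w) cf tlift_tlift; last first.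
  by apply: bilinI => [a|x]; [apply: lin_tensl|lin].
rewrite [LHS]tensE; apply: eq_tlift => x y; rewrite tliftE ?fK //.
by apply: bilinI => [a|z]; [apply: lin_tensl|lin].
Qed.

Definition comod_id V : comodHom V V :=
  mkComodHom (@lin_id K V) (@colinear_id V).

Definition comod_comp V W X (g : comodHom W X) (f : comodHom V W) :
    comodHom V X :=
  mkComodHom (lin_comp (comodHom_linear g) (comodHom_linear f))
    (colinear_comp (comodHom_linear g) (comodHom_colinear g)
       (comodHom_colinear f)).

Lemma comod_compA V W X Y (h : comodHom X Y) (g : comodHom W X)
    (f : comodHom V W) :
  comod_comp h (comod_comp g f) = comod_comp (comod_comp h g) f.
Proof. exact: comodHomP. Qed.
Lemma comod_comp1f V W (f : comodHom V W) : comod_comp (comod_id W) f = f.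
Proof. exact: comodHomP. Qed.
Lemma comod_compf1 V W (f : comodHom V W) : comod_comp f (comod_id V) = f.
Proof. exact: comodHomP. Qed.
Lemma comod_comp_bilin V W X : bilin (@comod_comp V W X).
Proof.
split=> [f a g h|g a f h]; apply: comodHomP => v //=.
exact: (comodHom_linear g).
Qed.

Definition comodLinCat : linCat K :=
  @LinCat K (comodule A) (fun V W => comodHom V W : lmodType K) comod_id
    comod_comp comod_compA comod_comp1f comod_compf1 comod_comp_bilin.

Definition comod_thom V V' W W' (f : comodHom V V') (g : comodHom W W') :
    comodHom (comod_tens V W) (comod_tens V' W') :=
  @mkComodHom K A (comod_tens V W) (comod_tens V' W') (tmap f g)
    (tmap_linear (comodHom_linear f) (comodHom_linear g))
    (colinear_tmap (comodHom_linear f) (comodHom_linear g)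
       (comodHom_colinear f) (comodHom_colinear g)).

Lemma comod_thomE V V' W W' (f : comodHom V V') (g : comodHom W W') v w :
  comod_thom f g (v *t w) = f v *t g w.
Proof. by rewrite /= tmapE //; exact: comodHom_linear. Qed.

Lemma comod_tens_ext V W X (f g : comodHom (comod_tens V W) X) :
  (forall v w, f (v *t w) = g (v *t w)) -> f = g.
Proof.
move=> fg; apply: comodHomP; apply: tens_ext => //.
- exact: (comodHom_linear f).
- exact: (comodHom_linear g).
Qed.

Definition mkComodIso V W (f : V -> W) (g : W -> V) (lf : linear f)
    (lg : linear g) (fK : cancel f g) (gK : cancel g f) (cf : colinear f) :
    @ciso K comodLinCat V W :=
  @CIso K comodLinCat V W (mkComodHom lf cf)
    (mkComodHom lg (colinear_inv lf lg fK gK cf))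
    (@comodHomP _ _ _ _ (comod_comp (mkComodHom lg (colinear_inv lf lg fK gK cf))
       (mkComodHom lf cf)) (comod_id V) fK)
    (@comodHomP _ _ _ _ (comod_comp (mkComodHom lf cf)
       (mkComodHom lg (colinear_inv lf lg fK gK cf))) (comod_id W) gK).

Definition comod_tassoc V W X :
    @ciso K comodLinCat (comod_tens (comod_tens V W) X)
      (comod_tens V (comod_tens W X)) :=
  @mkComodIso (comod_tens (comod_tens V W) X) (comod_tens V (comod_tens W X))
    _ _ (@tassoc_linear K V W X) (@tassocV_linear K V W X)
    (@tassocK _ _ _ _) (@tassocVK _ _ _ _) (@colinear_tassoc V W X).

Definition comod_tlunit V : @ciso K comodLinCat (comod_tens (comod_unit A) V) V :=
  @mkComodIso (comod_tens (comod_unit A) V) V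
    _ _ (@tlunit_linear K V) (@tlunitV_linear K V)
    (@tlunitK _ _) (@tlunitVK _ _) (@colinear_tlunit V).

Definition comod_trunit V : @ciso K comodLinCat (comod_tens V (comod_unit A)) V :=
  @mkComodIso (comod_tens V (comod_unit A)) V
    _ _ (@trunit_linear K V) (@trunitV_linear K V)
    (@trunitK _ _) (@trunitVK _ _) (@colinear_trunit V).

End ComodCat.

Section ComodTensorCat.
Variables (K : fieldType) (A : hopfAlgebra K).
Local Notation MA := (comodLinCat A).

Lemma comod_thom1 (V W : MA) :
  comod_thom (idm MA V) (idm MA W) = idm MA (comod_tens V W).
Proof. by apply: comodHomP => x; apply: tmap_id. Qed.

Lemma comod_thom_comp (V V' V'' W W' W'' : MA) (f' : chom V' V'')
    (f : chom V V') (g' : chom W' W'') (g : chom W W') :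
  comod_thom (f' \oc f) (g' \oc g) =
  (comod_thom f' g' : @chom K MA (comod_tens V' W') (comod_tens V'' W''))
    \oc (comod_thom f g : @chom K MA (comod_tens V W) (comod_tens V' W')).
Proof.
by apply: comodHomP; apply: tmap_comp; apply: comodHom_linear.
Qed.

Lemma comod_thom_bilin (V V' W W' : MA) :
  bilin (@comod_thom K A V V' W W').
Proof.
split=> [g a f f'|f a g g']; apply: comod_tens_ext => v w.
  rewrite -[RHS]/(a *: (comod_thom f g (v *t w)) + comod_thom f' g (v *t w)).
  by rewrite !comod_thomE -[in LHS]/(a *: f v + f' v) (linP (lin_tensl _ (@lin_id _ _))).
rewrite -[RHS]/(a *: (comod_thom f g (v *t w)) + comod_thom f g' (v *t w)).
by rewrite !comod_thomE -[in LHS]/(a *: g w + g' w) (linP (lin_tensr _ (@lin_id _ _))).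
Qed.

Lemma comod_tassoc_nat (V V' W W' X X' : MA) (f : chom V V')
    (g : chom W W') (h : chom X X') :
  (comod_thom f (comod_thom g h) :
     @chom K MA (comod_tens V (comod_tens W X)) (comod_tens V' (comod_tens W' X')))
    \oc comod_tassoc V W X =
  comod_tassoc V' W' X' \oc
    (comod_thom (comod_thom f g) h :
     @chom K MA (comod_tens (comod_tens V W) X) (comod_tens (comod_tens V' W') X')).
Proof. by apply: comodHomP; apply: tassoc_natE; apply: comodHom_linear. Qed.

Lemma comod_tlunit_nat (V V' : MA) (f : chom V V') :
  f \oc comod_tlunit V = comod_tlunit V' \oc
    (comod_thom (idm MA (comod_unit A)) f :
     @chom K MA (comod_tens (comod_unit A) V) (comod_tens (comod_unit A) V')).
Proof. by apply: comodHomP; apply: tlunit_natE; apply: comodHom_linear. Qed.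

Lemma comod_trunit_nat (V V' : MA) (f : chom V V') :
  f \oc comod_trunit V = comod_trunit V' \oc
    (comod_thom f (idm MA (comod_unit A)) :
     @chom K MA (comod_tens V (comod_unit A)) (comod_tens V' (comod_unit A))).
Proof. by apply: comodHomP; apply: trunit_natE; apply: comodHom_linear. Qed.

Lemma comod_tpentagon (V W X Y : MA) :
  comod_tassoc V W (comod_tens X Y) \oc comod_tassoc (comod_tens V W) X Y =
  (comod_thom (idm MA V) (iso_fw (comod_tassoc W X Y)) :
     @chom K MA (comod_tens V (comod_tens (comod_tens W X) Y))
       (comod_tens V (comod_tens W (comod_tens X Y))))
    \oc comod_tassoc V (comod_tens W X) Y
    \oc (comod_thom (iso_fw (comod_tassoc V W X)) (idm MA Y) :
     @chom K MA (comod_tens (comod_tens (comod_tens V W) X) Y)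
       (comod_tens (comod_tens V (comod_tens W X)) Y)).
Proof. by apply: comodHomP; apply: tpentagonE. Qed.

Lemma comod_ttriangle (V W : MA) :
  (comod_thom (idm MA V) (iso_fw (comod_tlunit W)) :
     @chom K MA (comod_tens V (comod_tens (comod_unit A) W)) (comod_tens V W))
    \oc comod_tassoc V (comod_unit A) W =
  comod_thom (iso_fw (comod_trunit V)) (idm MA W).
Proof. by apply: comodHomP; apply: ttriangleE. Qed.

Definition comodCat : tensorCat K :=
  @TensorCat K MA (@comod_tens K A) (@comod_thom K A) comod_thom1 comod_thom_comp
    comod_thom_bilin (comod_unit A) (@comod_tassoc K A) comod_tassoc_nat
    (@comod_tlunit K A) comod_tlunit_nat (@comod_trunit K A) comod_trunit_nat
    comod_tpentagon comod_ttriangle.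

End ComodTensorCat.

Record ydModule (K : fieldType) (A : hopfAlgebra K) := YDModule {
  yd_comod :> comodule A;
  yd_act : yd_comod -> A -> yd_comod;
  yd_act_bilin : bilin yd_act;
  yd_act1 : forall v, yd_act v 1 = v;
  yd_actM : forall v a b, yd_act v (a * b) = yd_act (yd_act v a) b;
  yd_compat : forall v a, coact (yd_act v a) =
    \sw_(v0, v1 <- coact v) \sw_(a1, a23 <- comul a) \sw_(a2, a3 <- comul a23)
      yd_act v0 a2 *t (antipode a1 * v1 * a3) }.

Arguments yd_act {K A y} _ _ : rename.
Arguments yd_act_bilin {K A} y : rename.

Ltac lin_ext ::=
  lazymatch goal with
  | |- GRing.linear_for _ (fun x => comodHom_fun ?f _) =>
    apply: (lin_comp (comodHom_linear f))
  | |- GRing.linear_for _ (fun x => @yd_act _ _ ?V _ _) =>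
    first [apply: (lin_bill _ (yd_act_bilin V))
          |apply: (lin_bilr _ (yd_act_bilin V))]
  end.

Section YD.
Variables (K : fieldType) (A : hopfAlgebra K).
Implicit Types (V W X : ydModule A) (M : comodule A) (U : lmodType K).
Local Notation S := (@antipode K A).
Local Notation Δ := (@comul K A).
Local Notation ε := (@counit K A).

Definition act_linear V W (f : V -> W) : Prop :=
  forall v a, f (yd_act v a) = yd_act (f v) a.

Definition yd_morph V W : {pred V -> W} :=
  fun f => `[< [/\ linear f, colinear f & act_linear f] >].
Arguments yd_morph : clear implicits.

Lemma yd_morph_submod V W : submod_closed (yd_morph V W).
Proof.
split=> [|a f g].
  have /asboolP [l0 c0] : 0 \in comod_morph V W by exact: rpred0.
  rewrite unfold_in; apply/asboolP; split=> // v a.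
  exact/esym/(lin0 ((yd_act_bilin W).1 a)).
rewrite !unfold_in => /asboolP [lf cf af] /asboolP [lg cg ag]; apply/asboolP.
split; [exact: lin_fct_comb|exact: colinear_comb|] => v b.
rewrite -[LHS]/(a *: f (yd_act v b) + g (yd_act v b)) af ag.
exact/esym/(linP ((yd_act_bilin W).1 b)).
Qed.

HB.instance Definition _ V W :=
  GRing.isSubmodClosed.Build K (V -> W) (yd_morph V W) (yd_morph_submod V W).

Record ydHom V W := YDHom {
  ydHom_fun :> V -> W;
  ydHom_subproof : ydHom_fun \in yd_morph V W }.

HB.instance Definition _ V W := [isSub for @ydHom_fun V W].
HB.instance Definition _ V W := [Choice of ydHom V W by <:].
HB.instance Definition _ V W := [SubChoice_isSubLmodule of ydHom V W by <:].

Lemma ydHom_linear V W (f : ydHom V W) : linear f.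
Proof. by case: f => f /= /asboolP[]. Qed.
Lemma ydHom_colinear V W (f : ydHom V W) : colinear f.
Proof. by case: f => f /= /asboolP[]. Qed.
Lemma ydHom_act V W (f : ydHom V W) : act_linear f.
Proof. by case: f => f /= /asboolP[]. Qed.

Lemma ydHomP V W (f g : ydHom V W) : (forall v, f v = g v) -> f = g.
Proof. by move=> fg; apply/val_inj/funext. Qed.

Definition mkYDHom V W (f : V -> W) (lf : linear f) (cf : colinear f)
  (af : act_linear f) : ydHom V W := YDHom (asboolT (And3 lf cf af)).

Definition tens_act V W (x : comod_tens V W) (a : A) : comod_tens V W :=
  \sw_(a1, a2 <- Δ a) tmap (fun v => yd_act v a1) (fun w => yd_act w a2) x.

Let actl V a := (yd_act_bilin V).1 a.

Lemma tens_actE V W (v : V) (w : W) a :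
  tens_act (v *t w) a = \sw_(a1, a2 <- Δ a) yd_act v a1 *t yd_act w a2.
Proof.
by rewrite /tens_act; apply: eq_tlift => a1 a2; rewrite tmapE //; exact: actl.
Qed.

Lemma tens_act_bilin V W : bilin (@tens_act V W).
Proof.
apply: bilinI => [a|x]; rewrite /tens_act.
  by apply: lin_tlift_body => a1 a2; apply: tmap_linear; exact: actl.
by rewrite /tmap; lin.
Qed.

Lemma tens_act1 V W (x : comod_tens V W) : tens_act x 1 = x.
Proof.
move: x; apply: tens_ext => [||v w]; first exact: (@tens_act_bilin V W).1.
  exact: lin_id.
by rewrite tens_actE comul1 tliftE ?yd_act1 //; lin.
Qed.

Lemma tens_actM V W (x : comod_tens V W) a b :
  tens_act x (a * b) = tens_act (tens_act x a) b.
Proof.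
have lt c := (@tens_act_bilin V W).1 c.
move: x; apply: tens_ext => [||v w]; first exact: lt.
  exact: (lin_comp (lt b) (lt a)).
rewrite !tens_actE (sw_comulM (f := fun x y => yd_act v x *t yd_act w y)); last by lin.
rewrite (lin_tlift _ _ (lt b)); apply: eq_tlift => x y.
rewrite tens_actE; apply: eq_tlift => z t.
by rewrite !yd_actM.
Qed.

Lemma tens_yd_compat V W (x : comod_tens V W) a : coact (tens_act x a) =
  \sw_(v0, v1 <- coact x) \sw_(a1, a23 <- Δ a) \sw_(a2, a3 <- Δ a23)
    tens_act v0 a2 *t (S a1 * v1 * a3).
Proof.
have lt c := (@tens_act_bilin V W).1 c.
have bt : bilin (fun (y : V \ox W) z => \sw_(a1, a23 <- Δ a) \sw_(a2, a3 <- Δ a23)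
    tens_act y a2 *t (S a1 * z * a3)).
  apply: bilinI => [z|y]; last by lin.
  apply: lin_tlift_body => p q; apply: lin_tlift_body => r s.
  exact: lin_tensl.
move: x; apply: tens_ext => [||v w].
- exact: (lin_app _ (lt a)).
- by apply: lin_tlift_arg bt _; exact: linearP.
rewrite /= (tens_coact_sw _ _ bt) tens_actE.
rewrite (lin_tlift _ _ (@tens_coact_linear _ _ V W)).
transitivity (\sw_(v0, v1 <- coact v) \sw_(w0, w1 <- coact w)
  \sw_(a1, a2 <- Δ a) \sw_(p, q <- Δ a1) \sw_(x, r <- Δ q)
  \sw_(s, t <- Δ a2) \sw_(y, z <- Δ t)
    (yd_act v0 x *t yd_act w0 y) *t (S p * v1 * r * (S s * w1 * z))).
  transitivity (\sw_(a1, a2 <- Δ a)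
    \sw_(v0, v1 <- coact v) \sw_(w0, w1 <- coact w)
    \sw_(p, q <- Δ a1) \sw_(x, r <- Δ q) \sw_(s, t <- Δ a2) \sw_(y, z <- Δ t)
    (yd_act v0 x *t yd_act w0 y) *t (S p * v1 * r * (S s * w1 * z))).
    apply: eq_tlift => a1 a2; rewrite tens_coactE !yd_compat.
    rewrite tlift_tlift; last by lin.
    apply: eq_tlift => v0 v1.
    rewrite tlift_tlift; last by lin.
    rewrite [RHS]tlift_exch; apply: eq_tlift => p q.
    rewrite tlift_tlift; last by lin.
    rewrite [RHS]tlift_exch; apply: eq_tlift => y r.
    rewrite tliftE; last by lin.
    rewrite tlift_tlift; last by lin.
    apply: eq_tlift => w0 w1.
    rewrite tlift_tlift; last by lin.
    apply: eq_tlift => s t.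
    rewrite tlift_tlift; last by lin.
    by apply: eq_tlift => z u; rewrite tliftE //; lin.
  rewrite tlift_exch; apply: eq_tlift => v0 v1.
  by rewrite tlift_exch.
apply: eq_tlift => v0 v1; apply: eq_tlift => w0 w1.
rewrite (coassoc (f := fun p q a2 => \sw_(x, r <- Δ q)
  \sw_(s, t <- Δ a2) \sw_(y, z <- Δ t)
    (yd_act v0 x *t yd_act w0 y) *t (S p * v1 * r * (S s * w1 * z)))); try by lin.
apply: eq_tlift => p b.
transitivity (\sw_(x, c <- Δ b) \sw_(y, z <- Δ c)
  (yd_act v0 x *t yd_act w0 y) *t (S p * (v1 * w1) * z)).
  rewrite (coassoc (f := fun x r a2 =>
    \sw_(s, t <- Δ a2) \sw_(y, z <- Δ t)
      (yd_act v0 x *t yd_act w0 y) *t (S p * v1 * r * (S s * w1 * z)))); try by lin.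
  apply: eq_tlift => x c.
  rewrite -(coassoc (f := fun r s t => \sw_(y, z <- Δ t)
      (yd_act v0 x *t yd_act w0 y) *t (S p * v1 * r * (S s * w1 * z)))); try by lin.
  rewrite -[RHS](sw_counitl (f := fun c => \sw_(y, z <- Δ c)
      (yd_act v0 x *t yd_act w0 y) *t (S p * (v1 * w1) * z))); last by lin.
  apply: eq_tlift => d t.
  rewrite tlift_exch tliftZr; apply: eq_tlift => y z.
  transitivity (\sw_(r, s <- Δ d)
      (yd_act v0 x *t yd_act w0 y) *t (S p * v1 * (r * S s) * (w1 * z))).
    by apply: eq_tlift => r s; rewrite !mulrA.
  rewrite (sw_antipoder (f := fun m => (yd_act v0 x *t yd_act w0 y)
      *t (S p * v1 * m * (w1 * z)))); last by lin.
  by rewrite mulr1 !mulrA.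
rewrite -(coassoc (f := fun x y z =>
  (yd_act v0 x *t yd_act w0 y) *t (S p * (v1 * w1) * z))); try by lin.
apply: eq_tlift => t z.
rewrite tens_actE; symmetry.
by apply: (lin_tlift (f := fun m : V \ox W => m *t (S p * (v1 * w1) * z))); lin.
Qed.

Definition yd_tens V W : ydModule A :=
  @YDModule K A (comod_tens V W) (@tens_act V W) (@tens_act_bilin V W)
    (@tens_act1 V W) (@tens_actM V W) (@tens_yd_compat V W).

Definition triv_act (x : comod_unit A) (a : A) : comod_unit A :=
  (ε a : K) *: x.

Lemma triv_act_bilin : bilin triv_act.
Proof. by rewrite /triv_act; lin. Qed.
Lemma triv_act1 x : triv_act x 1 = x.
Proof. by rewrite /triv_act counit1 scale1r. Qed.
Lemma triv_actM x a b : triv_act x (a * b) = triv_act (triv_act x a) b.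
Proof. by rewrite /triv_act counitM scalerA mulrC. Qed.
Lemma triv_yd_compat x a : coact (triv_act x a) =
  \sw_(v0, v1 <- coact x) \sw_(a1, a23 <- Δ a) \sw_(a2, a3 <- Δ a23)
    triv_act v0 a2 *t (S a1 * v1 * a3).
Proof.
rewrite /= /triv_coact_fun /triv_act tliftE; last by lin.
rewrite tensZl -(sw_antipodel (f := fun z => (x : K^o) *t z)); last by lin.
apply: eq_tlift => a1 a2.
rewrite -(sw_counitl (f := fun z => (x : K^o) *t (S a1 * z))); last by lin.
by apply: eq_tlift => y z; rewrite mulr1 tensZl.
Qed.

Definition yd_unit : ydModule A :=
  @YDModule K A (comod_unit A) triv_act triv_act_bilin triv_act1 triv_actM
    triv_yd_compat.

End YD.

Arguments yd_morph {K A} V W _.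

Ltac lin_ext ::=
  lazymatch goal with
  | |- GRing.linear_for _ (fun x => comodHom_fun ?f _) =>
    apply: (lin_comp (comodHom_linear f))
  | |- GRing.linear_for _ (fun x => ydHom_fun ?f _) =>
    apply: (lin_comp (ydHom_linear f))
  | |- GRing.linear_for _ (fun x => @yd_act _ _ ?V _ _) =>
    first [apply: (lin_bill _ (yd_act_bilin V))
          |apply: (lin_bilr _ (yd_act_bilin V))]
  end.

Section Free.
Variables (K : fieldType) (A : hopfAlgebra K).
Implicit Types (V W : comodule A) (U : lmodType K).
Local Notation S := (@antipode K A).
Local Notation Δ := (@comul K A).
Local Notation ε := (@counit K A).

Definition free_coact_fun V (x : V \ox A) : (V \ox A) \ox A :=
  \sw_(v, a <- x) \sw_(v0, v1 <- coact v)
    \sw_(a1, a23 <- Δ a) \sw_(a2, a3 <- Δ a23) (v0 *t a2) *t (S a1 * v1 * a3).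

Lemma free_coact_linear V : linear (@free_coact_fun V).
Proof. by rewrite /free_coact_fun; lin. Qed.

Lemma free_coactE V (v : V) (a : A) : free_coact_fun (v *t a) =
  \sw_(v0, v1 <- coact v) \sw_(a1, a23 <- Δ a) \sw_(a2, a3 <- Δ a23)
    (v0 *t a2) *t (S a1 * v1 * a3).
Proof. by rewrite /free_coact_fun tliftE //; lin. Qed.

Lemma free_coact_sw V U (b : V \ox A -> A -> U) v a : bilin b ->
  \sw_(x, y <- free_coact_fun (v *t a)) b x y =
  \sw_(v0, v1 <- coact v) \sw_(a1, a23 <- Δ a) \sw_(a2, a3 <- Δ a23)
    b (v0 *t a2) (S a1 * v1 * a3).
Proof.
move=> bb; rewrite free_coactE tlift_tlift //; apply: eq_tlift => v0 v1.
rewrite tlift_tlift //; apply: eq_tlift => a1 a23.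
by rewrite tlift_tlift //; apply: eq_tlift => a2 a3; rewrite tliftE.
Qed.

Definition free_coact V := mklin (@free_coact_linear V).

Lemma sw5 U (f : A -> A -> A -> A -> A -> U) (a : A) :
  (forall b c d e, linear (fun x => f x b c d e)) ->
  (forall b c d e, linear (fun x => f b x c d e)) ->
  (forall b c d e, linear (fun x => f b c x d e)) ->
  (forall b c d e, linear (fun x => f b c d x e)) ->
  (forall b c d e, linear (fun x => f b c d e x)) ->
  \sw_(a1, a23 <- Δ a) \sw_(a2, a3 <- Δ a23) \sw_(b1, b23 <- Δ a2)
    \sw_(b2, b3 <- Δ b23) f a1 b1 b2 b3 a3 =
  \sw_(a1, a23 <- Δ a) \sw_(a2, a3 <- Δ a23) \sw_(c1, c2 <- Δ a1)
    \sw_(d1, d2 <- Δ a3) f c1 c2 a2 d1 d2.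
Proof.
move=> f1 f2 f3 f4 f5.
transitivity (\sw_(a1, r <- Δ a) \sw_(b1, t <- Δ r) \sw_(b2, s <- Δ t)
   \sw_(b3, a3 <- Δ s) f a1 b1 b2 b3 a3).
  apply: eq_tlift => a1 r.
  rewrite (coassoc (f := fun b1 b23 a3 => \sw_(b2, b3 <- Δ b23) f a1 b1 b2 b3 a3)).
  - apply: eq_tlift => b1 t.
    by rewrite (coassoc (f := f a1 b1)).
  - by move=> y z; apply: lin_tlift_body => *; apply: f2.
  - by move=> x z; apply: lin_tlift_arg; [apply: bilinI => *; [apply: f3|apply: f4]|lin].
  - by move=> x y; apply: lin_tlift_body => *; apply: f5.
symmetry.
transitivity (\sw_(a1, r <- Δ a) \sw_(c1, c2 <- Δ a1) \sw_(a2, a3 <- Δ r)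
    \sw_(d1, d2 <- Δ a3) f c1 c2 a2 d1 d2).
  by apply: eq_tlift => a1 r; rewrite tlift_exch.
rewrite (coassoc (f := fun c1 c2 r => \sw_(a2, a3 <- Δ r)
    \sw_(d1, d2 <- Δ a3) f c1 c2 a2 d1 d2)) //.
- by move=> y z; do 2!apply: lin_tlift_body => * ; apply: f1.
- by move=> y z; do 2!apply: lin_tlift_body => * ; apply: f2.
- move=> x y; apply: lin_tlift_arg; last by lin.
  apply: bilinI => [v|u]; first by apply: lin_tlift_body => *; apply: f3.
  apply: lin_tlift_arg; last by lin.
  by apply: bilinI => *; [apply: f4|apply: f5].
Qed.

Lemma free_coactA V (x : V \ox A) :
  \sw_(v0, v1 <- free_coact V x) \sw_(v00, v01 <- free_coact V v0)
     v00 *t (v01 *t v1) =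
  \sw_(v0, v1 <- free_coact V x) v0 *t Δ v1.
Proof.
move: x; apply: tens_ext => [||v a]; [by lin|by lin|].
have lf := @free_coact_linear V.
rewrite /= !free_coact_sw; [|by lin|].
- pose f v0 u u' a1 a2 a3 a4 a5 := (v0 *t a3 : V \ox A) *t
    ((S a2 * u * a4) *t (S a1 * u' * a5)).
  transitivity (\sw_(v0, v1 <- coact v) \sw_(u, u' <- Δ v1)
    \sw_(a1, a23 <- Δ a) \sw_(a2, a3 <- Δ a23) \sw_(b1, b23 <- Δ a2)
    \sw_(b2, b3 <- Δ b23) f v0 u u' a1 b1 b2 b3 a3).
    rewrite -(coactA_sw (f := fun v0 u u' =>
      \sw_(a1, a23 <- Δ a) \sw_(a2, a3 <- Δ a23) \sw_(b1, b23 <- Δ a2)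
      \sw_(b2, b3 <- Δ b23) f v0 u u' a1 b1 b2 b3 a3)); try by rewrite /f; lin.
    apply: eq_tlift => v0 v1.
    transitivity (\sw_(a1, a23 <- Δ a) \sw_(v00, v01 <- coact v0)
      \sw_(a2, a3 <- Δ a23) \sw_(b1, b23 <- Δ a2)
      \sw_(b2, b3 <- Δ b23) f v00 v01 v1 a1 b1 b2 b3 a3); last by rewrite tlift_exch.
    apply: eq_tlift => a1 a23; rewrite [RHS]tlift_exch.
    by apply: eq_tlift => a2 a3; rewrite free_coact_sw //; lin.
  apply: eq_tlift => v0 v1.
  transitivity (\sw_(u, u' <- Δ v1) \sw_(a1, a23 <- Δ a) \sw_(a2, a3 <- Δ a23)
    \sw_(c1, c2 <- Δ a1) \sw_(d1, d2 <- Δ a3) f v0 u u' c1 c2 a2 d1 d2).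
    by apply: eq_tlift => u u'; apply: sw5; rewrite /f; lin.
  rewrite tlift_exch; apply: eq_tlift => a1 a23.
  rewrite tlift_exch; apply: eq_tlift => a2 a3.
  transitivity ((v0 *t a2 : V \ox A) *t (\sw_(c1, c2 <- Δ a1) \sw_(u, u' <- Δ v1)
     \sw_(d1, d2 <- Δ a3) (S c2 * u * d1) *t (S c1 * u' * d2))).
    have lt := lin_tensr (v0 *t a2 : V \ox A) (@lin_id _ (A \ox A)).
    rewrite [RHS](lin_tlift _ _ lt) tlift_exch; apply: eq_tlift => c1 c2.
    rewrite [RHS](lin_tlift _ _ lt); apply: eq_tlift => u u'.
    by rewrite [RHS](lin_tlift _ _ lt).
  congr (_ *t _); rewrite comulM.
  rewrite (sw_comulM (f := fun x y => \sw_(b1, b2 <- Δ a3) (x * b1) *t (y * b2)));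
    last by lin.
  rewrite comul_antipode tlift_tlift; last by lin.
  by apply: eq_tlift => c1 c2; rewrite tliftE //; lin.
- apply: bilinI => [y|y]; last by lin.
  apply: lin_tlift_arg; last exact: lf.
  by lin.
Qed.

Lemma free_coact_counit V (x : V \ox A) :
  \sw_(v0, v1 <- free_coact V x) (ε v1 : K) *: v0 = x.
Proof.
move: x; apply: tens_ext => [||v a]; [by lin|by lin|].
rewrite /= free_coact_sw; last by lin.
rewrite -[RHS](coact_counit_sw (f := fun x => x *t a)); last by lin.
apply: eq_tlift => v0 v1.
rewrite -[X in _ = _ *: X](sw_counitl (f := fun x => v0 *t x)); last by lin.
rewrite tliftZr; apply: eq_tlift => a1 a23.
rewrite -[X in _ = _ *: (_ *: X)](sw_counitr (f := fun x => v0 *t x)); last by lin.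
rewrite !tliftZr; apply: eq_tlift => a2 a3.
rewrite !counitM counit_antipode !scalerA; congr (_ *: _).
by rewrite [(ε v1 : K) * _]mulrC.
Qed.

Definition free_comod V : comodule A :=
  @Comodule K A (V \ox A) (free_coact V) (@free_coactA V) (@free_coact_counit V).

Definition free_act V (x : free_comod V) (b : A) : free_comod V :=
  tmap (fun v : V => v) (fun a : A => a * b) x.

Lemma free_act_subproof (b : A) : linear (fun a : A => a * b).
Proof. by lin. Qed.

Lemma free_actE V (v : V) (a b : A) :
  @free_act V (v *t a) b = v *t (a * b) :> V \ox A.
Proof. by rewrite /free_act tmapE //; exact: free_act_subproof. Qed.

Lemma free_act_bilin V : bilin (@free_act V).
Proof.
apply: bilinI => [b|x].
  exact: (tmap_linear (@lin_id _ _) (free_act_subproof b)).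
by rewrite /free_act /tmap; apply: lin_tlift_body => y z; lin.
Qed.

Lemma free_act1 V (x : free_comod V) : free_act x 1 = x.
Proof.
move: x; apply: tens_ext => [||v a]; first exact: (@free_act_bilin V).1.
  exact: lin_id.
by rewrite free_actE mulr1.
Qed.

Lemma free_actM V (x : free_comod V) a b :
  free_act x (a * b) = free_act (free_act x a) b.
Proof.
have lt c := (@free_act_bilin V).1 c.
move: x; apply: tens_ext => [||v c]; first exact: lt.
  exact: (lin_comp (lt b) (lt a)).
by rewrite !free_actE mulrA.
Qed.

Lemma free_yd_compat V (x : free_comod V) b : coact (free_act x b) =
  \sw_(v0, v1 <- coact x) \sw_(b1, b23 <- Δ b) \sw_(b2, b3 <- Δ b23)
    free_act v0 b2 *t (S b1 * v1 * b3).
Proof.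
have lt c := (@free_act_bilin V).1 c.
have rt c := (@free_act_bilin V).2 c.
have bt : bilin (fun (y : V \ox A) z => \sw_(b1, b23 <- Δ b) \sw_(b2, b3 <- Δ b23)
    @free_act V y b2 *t (S b1 * z * b3)).
  apply: bilinI => [z|y]; last by lin.
  apply: lin_tlift_body => p q; apply: lin_tlift_body => r s.
  exact: lin_tensl.
move: x; apply: tens_ext => [||v a].
- exact: (lin_app _ (lt b)).
- by apply: lin_tlift_arg bt _; exact: linearP.
rewrite /= (free_coact_sw _ _ bt) free_actE free_coactE.
apply: eq_tlift => v0 v1.
rewrite (sw_comulM (f := fun a1 a23 => \sw_(a2, a3 <- Δ a23)
   (v0 *t a2) *t (S a1 * v1 * a3))); last by lin.
apply: eq_tlift => a1 a23; rewrite [RHS]tlift_exch.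
apply: eq_tlift => b1 b23.
rewrite (sw_comulM (f := fun a2 a3 => (v0 *t a2) *t (S (a1 * b1) * v1 * a3)));
  last by lin.
apply: eq_tlift => a2 a3; apply: eq_tlift => b2 b3.
by rewrite free_actE antipodeM !mulrA.
Qed.

Definition free_yd V : ydModule A :=
  @YDModule K A (free_comod V) (@free_act V) (@free_act_bilin V)
    (@free_act1 V) (@free_actM V) (@free_yd_compat V).

Lemma free_map_colinear V W (f : comodHom V W) :
  @colinear K A (free_comod V) (free_comod W) (tmap f (fun a => a)).
Proof.
have lf := comodHom_linear f.
have lt := tmap_linear lf (@lin_id _ A).
have bt : bilin (fun x (y : A) => tmap f (fun a : A => a) x *t y).
  by apply: bilinI => [y|x]; [apply: lin_tensl|lin].
apply: tens_ext => [||v a].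
- exact: (lin_comp (@free_coact_linear W) lt).
- by apply: lin_tlift_arg bt _; exact: linearP.
rewrite /= (free_coact_sw _ _ bt) tmapE // free_coactE.
rewrite (colinear_sw (b := fun v0 v1 => \sw_(a1, a23 <- Δ a)
  \sw_(a2, a3 <- Δ a23) (v0 *t a2) *t (S a1 * v1 * a3))); [|by lin|].
- apply: eq_tlift => v0 v1; apply: eq_tlift => a1 a23; apply: eq_tlift => a2 a3.
  by rewrite tmapE.
- exact: comodHom_colinear.
Qed.

Lemma free_map_act V W (f : comodHom V W) :
  @act_linear K A (free_yd V) (free_yd W) (tmap f (fun a => a)).
Proof.
have lf := comodHom_linear f.
have lt := tmap_linear lf (@lin_id _ A).
move=> x b; move: x; apply: tens_ext => [||v a].
- exact: (lin_comp lt ((@free_act_bilin V).1 b)).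
- exact: (lin_comp ((@free_act_bilin W).1 b) lt).
by rewrite /= free_actE !tmapE // free_actE.
Qed.

Definition free_map V W (f : comodHom V W) : ydHom (free_yd V) (free_yd W) :=
  @mkYDHom K A (free_yd V) (free_yd W) (tmap f (fun a => a))
    (tmap_linear (comodHom_linear f) (@lin_id _ A)) (free_map_colinear f)
    (free_map_act f).

End Free.

Section YDCat.
Variables (K : fieldType) (A : hopfAlgebra K).
Implicit Types (V W X Y : ydModule A) (U : lmodType K).

Lemma act_linear_comp V W X (g : W -> X) (f : V -> W) :
  act_linear g -> act_linear f -> act_linear (fun x => g (f x)).
Proof. by move=> ag af v a; rewrite af ag. Qed.

Lemma act_linear_inv V W (f : V -> W) (g : W -> V) :
  cancel f g -> cancel g f -> act_linear f -> act_linear g.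
Proof. by move=> fK gK af w a; rewrite -{1}(gK w) -af fK. Qed.

Lemma act_linear_tmap V V' W W' (f : V -> V') (g : W -> W') :
  linear f -> linear g -> act_linear f -> act_linear g ->
  @act_linear K A (yd_tens V W) (yd_tens V' W') (tmap f g).
Proof.
move=> lf lg af ag x a; have lt := tmap_linear lf lg.
move: x; apply: tens_ext => [||v w].
- exact: (lin_comp lt ((@tens_act_bilin _ _ V W).1 a)).
- exact: (lin_comp ((@tens_act_bilin _ _ V' W').1 a) lt).
rewrite /= tmapE // !tens_actE (lin_tlift _ _ lt).
by apply: eq_tlift => a1 a2; rewrite tmapE // af ag.
Qed.

Lemma act_linear_tassoc V W X :
  @act_linear K A (yd_tens (yd_tens V W) X) (yd_tens V (yd_tens W X))
    (@tassoc_fun K V W X).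
Proof.
have la := @tassoc_linear K V W X.
have l1 a := (@tens_act_bilin _ _ (yd_tens V W) X).1 a.
have l2 a := (@tens_act_bilin _ _ V (yd_tens W X)).1 a.
move=> x a; move: x; apply: tens_ext => [||x z].
- exact: (lin_comp la (l1 a)).
- exact: (lin_comp (l2 a) la).
move: x; apply: tens_ext => [||v w].
- by apply: (lin_comp la); apply: (lin_comp (l1 a)); lin.
- by apply: (lin_comp (l2 a)); apply: (lin_comp la); lin.
rewrite tassocE /= (@tens_actE _ _ (yd_tens V W) X).
rewrite (@tens_actE _ _ V (yd_tens W X)) (lin_tlift _ _ la) /=.
transitivity (\sw_(a1, a2 <- comul a) \sw_(a11, a12 <- comul a1)
  yd_act v a11 *t (yd_act w a12 *t yd_act z a2)).
  apply: eq_tlift => a1 a2; rewrite tens_actE.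
  transitivity (tassoc_fun (\sw_(x, y <- comul a1)
      ((yd_act v x *t yd_act w y) *t yd_act z a2))).
    congr tassoc_fun.
    by apply: (lin_tlift (f := fun m : V \ox W => m *t yd_act z a2)); lin.
  by rewrite (lin_tlift _ _ la); apply: eq_tlift => x y; rewrite tassocE.
rewrite (coassoc (f := fun x y t => yd_act v x *t (yd_act w y *t yd_act z t)));
  try by lin.
apply: eq_tlift => a1 a2; rewrite tens_actE; symmetry.
by apply: (lin_tlift (f := fun m : W \ox X => yd_act v a1 *t m)); lin.
Qed.

Lemma act_linear_tlunit V :
  @act_linear K A (yd_tens (yd_unit A) V) V (@tlunit_fun K V).
Proof.
have ll := @tlunit_linear K V.
move=> x a; move: x; apply: tens_ext => [||k v].
- exact: (lin_comp ll ((@tens_act_bilin _ _ (yd_unit A) V).1 a)).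
- exact: (lin_comp ((yd_act_bilin V).1 a) ll).
rewrite tlunitE /= (@tens_actE _ _ (yd_unit A) V) (lin_tlift _ _ ll).
rewrite (linZ ((yd_act_bilin V).1 a)).
rewrite -[in RHS](sw_counitl (f := fun a => yd_act v a)); last by lin.
rewrite tliftZr; apply: eq_tlift => a1 a2.
by rewrite tlunitE scalerA mulrC.
Qed.

Lemma act_linear_trunit V :
  @act_linear K A (yd_tens V (yd_unit A)) V (@trunit_fun K V).
Proof.
have ll := @trunit_linear K V.
move=> x a; move: x; apply: tens_ext => [||v k].
- exact: (lin_comp ll ((@tens_act_bilin _ _ V (yd_unit A)).1 a)).
- exact: (lin_comp ((yd_act_bilin V).1 a) ll).
rewrite trunitE /= (@tens_actE _ _ V (yd_unit A)) (lin_tlift _ _ ll).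
rewrite (linZ ((yd_act_bilin V).1 a)).
rewrite -[in RHS](sw_counitr (f := fun a => yd_act v a)); last by lin.
rewrite tliftZr; apply: eq_tlift => a1 a2.
by rewrite trunitE scalerA mulrC.
Qed.

Definition yd_id V : ydHom V V :=
  @mkYDHom K A V V _ (@lin_id K V) (@colinear_id _ _ V) (fun _ _ => erefl).

Definition yd_comp V W X (g : ydHom W X) (f : ydHom V W) : ydHom V X :=
  mkYDHom (lin_comp (ydHom_linear g) (ydHom_linear f))
    (colinear_comp (ydHom_linear g) (ydHom_colinear g) (ydHom_colinear f))
    (act_linear_comp (ydHom_act g) (ydHom_act f)).

Lemma yd_compA V W X Y (h : ydHom X Y) (g : ydHom W X) (f : ydHom V W) :
  yd_comp h (yd_comp g f) = yd_comp (yd_comp h g) f.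
Proof. exact: ydHomP. Qed.
Lemma yd_comp1f V W (f : ydHom V W) : yd_comp (yd_id W) f = f.
Proof. exact: ydHomP. Qed.
Lemma yd_compf1 V W (f : ydHom V W) : yd_comp f (yd_id V) = f.
Proof. exact: ydHomP. Qed.
Lemma yd_comp_bilin V W X : bilin (@yd_comp V W X).
Proof.
split=> [f a g h|g a f h]; apply: ydHomP => v //=.
exact: (ydHom_linear g).
Qed.

Definition ydLinCat : linCat K :=
  @LinCat K (ydModule A) (fun V W => ydHom V W : lmodType K) yd_id yd_comp
    yd_compA yd_comp1f yd_compf1 yd_comp_bilin.

Definition yd_thom V V' W W' (f : ydHom V V') (g : ydHom W W') :
    ydHom (yd_tens V W) (yd_tens V' W') :=
  @mkYDHom K A (yd_tens V W) (yd_tens V' W') (tmap f g)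
    (tmap_linear (ydHom_linear f) (ydHom_linear g))
    (colinear_tmap (ydHom_linear f) (ydHom_linear g)
       (ydHom_colinear f) (ydHom_colinear g))
    (act_linear_tmap (ydHom_linear f) (ydHom_linear g)
       (ydHom_act f) (ydHom_act g)).

Lemma yd_thomE V V' W W' (f : ydHom V V') (g : ydHom W W') v w :
  yd_thom f g (v *t w) = f v *t g w.
Proof. by rewrite /= tmapE //; exact: ydHom_linear. Qed.

Lemma yd_tens_ext V W X (f g : ydHom (yd_tens V W) X) :
  (forall v w, f (v *t w) = g (v *t w)) -> f = g.
Proof.
move=> fg; apply: ydHomP; apply: tens_ext => //.
- exact: (ydHom_linear f).
- exact: (ydHom_linear g).
Qed.

Definition mkYDIso V W (f : V -> W) (g : W -> V) (lf : linear f)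
    (lg : linear g) (fK : cancel f g) (gK : cancel g f) (cf : colinear f)
    (af : act_linear f) : @ciso K ydLinCat V W :=
  let F := mkYDHom lf cf af in
  let G := mkYDHom lg (colinear_inv lf lg fK gK cf)
    (act_linear_inv fK gK af) in
  @CIso K ydLinCat V W F G
    (@ydHomP _ _ _ _ (yd_comp G F) (yd_id V) fK)
    (@ydHomP _ _ _ _ (yd_comp F G) (yd_id W) gK).

Definition yd_tassoc V W X :
    @ciso K ydLinCat (yd_tens (yd_tens V W) X) (yd_tens V (yd_tens W X)) :=
  @mkYDIso (yd_tens (yd_tens V W) X) (yd_tens V (yd_tens W X))
    _ _ (@tassoc_linear K V W X) (@tassocV_linear K V W X)
    (@tassocK _ _ _ _) (@tassocVK _ _ _ _) (@colinear_tassoc _ _ V W X)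
    (@act_linear_tassoc V W X).

Definition yd_tlunit V : @ciso K ydLinCat (yd_tens (yd_unit A) V) V :=
  @mkYDIso (yd_tens (yd_unit A) V) V
    _ _ (@tlunit_linear K V) (@tlunitV_linear K V)
    (@tlunitK _ _) (@tlunitVK _ _) (@colinear_tlunit _ _ V)
    (@act_linear_tlunit V).

Definition yd_trunit V : @ciso K ydLinCat (yd_tens V (yd_unit A)) V :=
  @mkYDIso (yd_tens V (yd_unit A)) V
    _ _ (@trunit_linear K V) (@trunitV_linear K V)
    (@trunitK _ _) (@trunitVK _ _) (@colinear_trunit _ _ V)
    (@act_linear_trunit V).

Local Notation YD := ydLinCat.

Lemma yd_thom1 (V W : YD) :
  yd_thom (idm YD V) (idm YD W) = idm YD (yd_tens V W).
Proof. by apply: ydHomP => x; apply: tmap_id. Qed.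

Lemma yd_thom_comp (V V' V'' W W' W'' : YD) (f' : chom V' V'')
    (f : chom V V') (g' : chom W' W'') (g : chom W W') :
  yd_thom (f' \oc f) (g' \oc g) =
  (yd_thom f' g' : @chom K YD (yd_tens V' W') (yd_tens V'' W''))
    \oc (yd_thom f g : @chom K YD (yd_tens V W) (yd_tens V' W')).
Proof. by apply: ydHomP; apply: tmap_comp; apply: ydHom_linear. Qed.

Lemma yd_thom_bilin (V V' W W' : YD) : bilin (@yd_thom V V' W W').
Proof.
split=> [g a f f'|f a g g']; apply: yd_tens_ext => v w.
  rewrite -[RHS]/(a *: (yd_thom f g (v *t w)) + yd_thom f' g (v *t w)).
  by rewrite !yd_thomE -[in LHS]/(a *: f v + f' v) (linP (lin_tensl _ (@lin_id _ _))).
rewrite -[RHS]/(a *: (yd_thom f g (v *t w)) + yd_thom f g' (v *t w)).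
by rewrite !yd_thomE -[in LHS]/(a *: g w + g' w) (linP (lin_tensr _ (@lin_id _ _))).
Qed.

Lemma yd_tassoc_nat (V V' W W' X X' : YD) (f : chom V V')
    (g : chom W W') (h : chom X X') :
  (yd_thom f (yd_thom g h) :
     @chom K YD (yd_tens V (yd_tens W X)) (yd_tens V' (yd_tens W' X')))
    \oc yd_tassoc V W X =
  yd_tassoc V' W' X' \oc
    (yd_thom (yd_thom f g) h :
     @chom K YD (yd_tens (yd_tens V W) X) (yd_tens (yd_tens V' W') X')).
Proof. by apply: ydHomP; apply: tassoc_natE; apply: ydHom_linear. Qed.

Lemma yd_tlunit_nat (V V' : YD) (f : chom V V') :
  f \oc yd_tlunit V = yd_tlunit V' \oc
    (yd_thom (idm YD (yd_unit A)) f :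
     @chom K YD (yd_tens (yd_unit A) V) (yd_tens (yd_unit A) V')).
Proof. by apply: ydHomP; apply: tlunit_natE; apply: ydHom_linear. Qed.

Lemma yd_trunit_nat (V V' : YD) (f : chom V V') :
  f \oc yd_trunit V = yd_trunit V' \oc
    (yd_thom f (idm YD (yd_unit A)) :
     @chom K YD (yd_tens V (yd_unit A)) (yd_tens V' (yd_unit A))).
Proof. by apply: ydHomP; apply: trunit_natE; apply: ydHom_linear. Qed.

Lemma yd_tpentagon (V W X Y : YD) :
  yd_tassoc V W (yd_tens X Y) \oc yd_tassoc (yd_tens V W) X Y =
  (yd_thom (idm YD V) (iso_fw (yd_tassoc W X Y)) :
     @chom K YD (yd_tens V (yd_tens (yd_tens W X) Y))
       (yd_tens V (yd_tens W (yd_tens X Y))))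
    \oc yd_tassoc V (yd_tens W X) Y
    \oc (yd_thom (iso_fw (yd_tassoc V W X)) (idm YD Y) :
     @chom K YD (yd_tens (yd_tens (yd_tens V W) X) Y)
       (yd_tens (yd_tens V (yd_tens W X)) Y)).
Proof. by apply: ydHomP; apply: tpentagonE. Qed.

Lemma yd_ttriangle (V W : YD) :
  (yd_thom (idm YD V) (iso_fw (yd_tlunit W)) :
     @chom K YD (yd_tens V (yd_tens (yd_unit A) W)) (yd_tens V W))
    \oc yd_tassoc V (yd_unit A) W =
  yd_thom (iso_fw (yd_trunit V)) (idm YD W).
Proof. by apply: ydHomP; apply: ttriangleE. Qed.

Definition ydCat : tensorCat K :=
  @TensorCat K YD (@yd_tens K A) yd_thom yd_thom1 yd_thom_comp
    yd_thom_bilin (yd_unit A) yd_tassoc yd_tassoc_nat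
    yd_tlunit yd_tlunit_nat yd_trunit yd_trunit_nat
    yd_tpentagon yd_ttriangle.

Definition yd_forget_map V W (f : ydHom V W) : comodHom V W :=
  mkComodHom (ydHom_linear f) (ydHom_colinear f).

Lemma yd_forget1 (V : ydCat) :
  yd_forget_map (idm ydCat V) = idm (comodCat A) (yd_comod V).
Proof. exact: comodHomP. Qed.

Lemma yd_forget_comp (V W X : ydCat) (g : chom W X) (f : chom V W) :
  yd_forget_map (g \oc f) =
  (yd_forget_map g : @chom K (comodCat A) (yd_comod W) (yd_comod X))
    \oc (yd_forget_map f : @chom K (comodCat A) (yd_comod V) (yd_comod W)).
Proof. exact: comodHomP. Qed.

Lemma yd_forget_linear (V W : ydCat) : linear (@yd_forget_map V W).
Proof. by move=> a f g; apply: comodHomP. Qed.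

Definition yd_forget : linFunctor ydCat (comodCat A) :=
  @LinFunctor K ydCat (comodCat A) (@yd_comod K A) yd_forget_map yd_forget1
    yd_forget_comp yd_forget_linear.

Lemma free_map1 (V : comodCat A) :
  free_map (idm (comodCat A) V) = idm ydCat (free_yd V).
Proof. by apply: ydHomP => x; apply: tmap_id. Qed.

Lemma free_map_comp (V W X : comodCat A) (g : chom W X) (f : chom V W) :
  free_map (g \oc f) =
  (free_map g : @chom K ydCat (free_yd W) (free_yd X))
    \oc (free_map f : @chom K ydCat (free_yd V) (free_yd W)).
Proof.
apply: ydHomP => x.
exact: (@tmap_comp K V W X A A A f g id id (comodHom_linear f)
  (comodHom_linear g) (@lin_id _ _) (@lin_id _ _) x).
Qed.

Lemma free_map_linear (V W : comodCat A) : linear (@free_map K A V W).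
Proof.
move=> a f g; apply: ydHomP; apply: tens_ext => [||v b].
- exact: (ydHom_linear (free_map (a *: f + g))).
- exact: (ydHom_linear (a *: free_map f + free_map g)).
rewrite -[RHS]/(a *: (free_map f (v *t b)) + free_map g (v *t b)) /=.
have lh (h : comodHom V W) := comodHom_linear h.
rewrite !tmapE; try exact: lh; try exact: lin_id.
  exact: (linP (lin_tensl b (@lin_id _ _))).
exact: (lh (a *: (f : comodHom V W) + g)).
Qed.

Definition free_functor : linFunctor (comodCat A) ydCat :=
  @LinFunctor K (comodCat A) ydCat (@free_yd K A) (@free_map K A) free_map1
    free_map_comp free_map_linear.

Definition is_free_yd (P : ydCat) : Prop :=
  exists V : comodCat A, inhabited (ciso P (free_functor V)).

Definition yd_exact (X Y Z : ydCat) (f : chom X Y) (g : chom Y Z) : Prop :=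
  forall y : (Y : ydModule A),
    (g : ydHom Y Z) y = 0 <-> exists x, (f : ydHom X Y) x = y.

Definition yd_surjective (X Y : ydCat) (f : chom X Y) : Prop :=
  forall y, exists x, (f : ydHom X Y) x = y.

(* d n is the map from degree n.+1 to degree n. Exactness at every degree
   entails that consecutive maps compose to 0. *)
Definition augments (M : ydCat) (P : nat -> ydCat)
    (d : forall n, chom (P n.+1) (P n)) (eps : chom (P 0%N) M) : Prop :=
  [/\ yd_surjective eps, yd_exact (d 0%N) eps &
      forall n, yd_exact (d n.+1) (d n)].

Definition free_yd_resolution (M : ydCat) (P : nat -> ydCat)
    (d : forall n, chom (P n.+1) (P n)) : Prop :=
  [/\ forall n, is_free_yd (P n),
      forall n, d n \oc d n.+1 = 0 &
      exists eps : chom (P 0%N) M, augments d eps].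

End YDCat.

Arguments yd_forget {K} A.
Arguments free_functor {K} A.
Arguments free_yd_resolution {K A} M {P} d.

Section Transport.
Variables (K : fieldType) (A H : hopfAlgebra K).
Variables (Theta : tensorFunctor (comodCat A) (comodCat H)).
Variables (That : tensorFunctor (ydCat A) (ydCat H)).
Variable phi : natIso (compFunctor That (free_functor A))
  (compFunctor (free_functor H) Theta).

(* The maps of the image complex, written on the Theta (V n) \ox H through the
   identifications phi and (for the augmentation) the unit constraint. *)
Definition transport_map (V W : comodCat A)
    (f : chom (free_functor A V) (free_functor A W)) :
    chom (free_functor H (Theta V)) (free_functor H (Theta W)) :=
  phi W \oc fhom That f \oc iso_bw (phi V).

Definition transport_aug (V : comodCat A)
    (eps : chom (free_functor A V) (tunit (ydCat A))) :
    chom (free_functor H (Theta V)) (tunit (ydCat H)) :=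
  iso_bw (tf_unit That) \oc fhom That eps \oc iso_bw (phi V).

End Transport.

(* Main.v *)
From HB Require Import structures.
Require Import Defs.
From mathcomp Require Import all_boot all_order all_algebra.
From mathcomp Require Import boolp classical_sets.
From mathcomp Require Import complex reals.

Set Implicit Arguments.
Unset Strict Implicit.
Unset Printing Implicit Defensive.

Import GRing.Theory.
Local Open Scope ring_scope.
Local Open Scope complex_scope.

(** The action of a Yetter-Drinfeld module cannot be moved along the functor
    Theta directly, because Theta knows nothing of elements. The proof encodes
    it by morphisms. If [V] is a Yetter-Drinfeld module and [X] any comodule,
    then [v *t x |-> x0 *t (v . x1)] is a colinear map from [V \ox X] to
    [X \ox V], natural in [X] and compatible with tensor products and with
    the unit: a half braiding of [V]. Conversely a half braiding [p] of a
    comodule [V] comes from exactly one Yetter-Drinfeld structure, namely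
    [v . a = (counit \ox id) (p A (v *t a))]: each comodule maps by its
    coaction into a cofree one, and naturality then determines [p] by its value
    at the regular comodule ([hbE]); the Yetter-Drinfeld condition is the
    colinearity of [p A] ([hb_yd_compat]). The half braidings need not be
    invertible, as the antipode need not be bijective. Under this dictionary
    action-linear maps are those that commute with the half braidings
    ([act_linear_brdP]), and tensor products correspond ([brd_tens]).

    Half braidings are made of morphisms, tensor products and coherence
    isomorphisms, so a fully faithful and essentially surjective tensor functor
    carries them forth ([push_hb]) and back ([pull_hb]). The coherence diagrams
    are handled by commutative squares [fsq m n f g] that relate a morphism
    [f] of the source category to a morphism [g] of the target along comparison
    maps [m] and [n]: such squares are stable under composition, tensor product
    and coherence isomorphisms, so that each axiom is transported by pasting.
    The induced functor [that_equiv] has Theta as its effect on the underlying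
    comodules; hence its coherence axioms are those of Theta. Its fullness is
    that of Theta, restricted to action-linear maps, and its essential
    surjectivity follows from pulling back.

    The free module [free_yd V] with [v |-> v *t 1] is a universal arrow from
    [V] to the forgetful functor. As [that_equiv] and Theta are equivalences that
    commute with the forgetful functors, Theta sends this to a universal arrow
    from [Theta V], and two universal arrows from the same object are uniquely
    isomorphic; this yields the natural isomorphism between the image of
    [free_yd V] and [free_yd (Theta V)].

    Finally, exactness of [f] and [g] at the level of elements means that
    [g f = 0] and that [h u = 0] whenever [g u = 0] and [h f = 0], for all
    colinear [u] and [h] ([comod_exactP]). One takes for [u] the inclusion of
    the kernel, a subcomodule because tensoring over a field is exact, and for
    [h] a colinear map into a cofree comodule induced by a linear projection
    with kernel the image of [f]. The condition on the right involves morphisms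
    only, hence passes through the equivalence Theta. *)

(** * Isomorphisms and equivalences of linear categories *)

Section LinearCategories.
Variable K : fieldType.

Section Isos.
Variable C : linCat K.
Implicit Types X Y Z : C.

Lemma iso_fwKf X Y Z (i : ciso Y Z) (f : chom X Y) :
  iso_bw i \oc (i \oc f) = f.
Proof. by rewrite ccompA iso_fwK ccomp1f. Qed.

Lemma iso_bwKf X Y Z (i : ciso Y Z) (f : chom X Z) :
  i \oc (iso_bw i \oc f) = f.
Proof. by rewrite ccompA iso_bwK ccomp1f. Qed.

Lemma iso_fwfK X Y Z (i : ciso X Y) (f : chom Y Z) :
  f \oc i \oc iso_bw i = f.
Proof. by rewrite -ccompA iso_bwK ccompf1. Qed.

Lemma iso_bwfK X Y Z (i : ciso X Y) (f : chom X Z) :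
  f \oc iso_bw i \oc i = f.
Proof. by rewrite -ccompA iso_fwK ccompf1. Qed.

Lemma iso_mono X Y Z (i : ciso Y Z) (f g : chom X Y) :
  i \oc f = i \oc g -> f = g.
Proof. by move/(congr1 (fun h => iso_bw i \oc h)); rewrite !iso_fwKf. Qed.

Lemma iso_epi X Y Z (i : ciso X Y) (f g : chom Y Z) :
  f \oc i = g \oc i -> f = g.
Proof. by move/(congr1 (fun h => h \oc iso_bw i)); rewrite !iso_fwfK. Qed.

Definition iso_id X : ciso X X :=
  CIso (ccomp1f (idm C X)) (ccomp1f (idm C X)).

Definition iso_sym X Y (i : ciso X Y) : ciso Y X :=
  CIso (iso_bwK i) (iso_fwK i).

Lemma iso_trans_fwK X Y Z (j : ciso Y Z) (i : ciso X Y) :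
  iso_bw i \oc iso_bw j \oc (j \oc i) = idm C X.
Proof. by rewrite -ccompA iso_fwKf iso_fwK. Qed.

Lemma iso_trans_bwK X Y Z (j : ciso Y Z) (i : ciso X Y) :
  j \oc i \oc (iso_bw i \oc iso_bw j) = idm C Z.
Proof. by rewrite -ccompA iso_bwKf iso_bwK. Qed.

Definition iso_trans X Y Z (j : ciso Y Z) (i : ciso X Y) : ciso X Z :=
  CIso (iso_trans_fwK j i) (iso_trans_bwK j i).

Lemma comp0 X Y Z (f : chom X Y) : (0 : chom Y Z) \oc f = 0.
Proof. exact: (lin0 ((ccomp_bilin X Y Z).1 f)). Qed.

Lemma compf0 X Y Z (g : chom Y Z) : g \oc (0 : chom X Y) = 0.
Proof. exact: (lin0 ((ccomp_bilin X Y Z).2 g)). Qed.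

End Isos.

Lemma fiso_fwK (C D : linCat K) (F : linFunctor C D) (X Y : C) (i : ciso X Y) :
  fhom F (iso_bw i) \oc fhom F i = idm D (F X).
Proof. by rewrite -fhom_comp iso_fwK fhom1. Qed.

Lemma fiso_bwK (C D : linCat K) (F : linFunctor C D) (X Y : C) (i : ciso X Y) :
  fhom F i \oc fhom F (iso_bw i) = idm D (F Y).
Proof. by rewrite -fhom_comp iso_bwK fhom1. Qed.

Definition fiso (C D : linCat K) (F : linFunctor C D) (X Y : C) (i : ciso X Y) :
    ciso (F X) (F Y) :=
  CIso (fiso_fwK F i) (fiso_bwK F i).

Lemma fhom0 (C D : linCat K) (F : linFunctor C D) (X Y : C) :
  fhom F (0 : chom X Y) = 0.
Proof. exact: (lin0 (fhom_linear F (X := X) (Y := Y))). Qed.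

Definition faithful (C D : linCat K) (F : linFunctor C D) : Prop :=
  forall (X Y : C) (f g : chom X Y), fhom F f = fhom F g -> f = g.

Definition full (C D : linCat K) (F : linFunctor C D) : Prop :=
  forall (X Y : C) (h : chom (F X) (F Y)), exists f, fhom F f = h.

Definition ess_surj (C D : linCat K) (F : linFunctor C D) : Prop :=
  forall Y : D, exists X : C, inhabited (ciso Y (F X)).

Lemma equivalence_faithful (C D : linCat K) (F : linFunctor C D) :
  is_equivalence F -> faithful F.
Proof.
move=> [G [[t] _]] X Y f g fg.
apply: (iso_epi (i := t X)).
rewrite -[f]/(fhom (idFunctor C) f) -[g]/(fhom (idFunctor C) g).
by rewrite -!ni_nat /= fg.
Qed.

Lemma equivalence_ess_surj (C D : linCat K) (F : linFunctor C D) :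
  is_equivalence F -> ess_surj F.
Proof.
move=> [G [_ [e]]] Y; exists (G Y); constructor.
exact: (iso_sym (e Y : ciso (F (G Y)) Y)).
Qed.

(** The preimage of [h] is [G h] transported along the isomorphism of [G F]
    with the identity; its image under [F] is [h] because [G], being itself an
    equivalence, is faithful. *)
Lemma equivalence_full (C D : linCat K) (F : linFunctor C D) :
  is_equivalence F -> full F.
Proof.
move=> [G [[t] [e]]] X Y h.
have faithG : faithful G.
  by apply: equivalence_faithful; exists F; split; constructor.
exists (t Y \oc fhom G h \oc iso_bw (t X)); apply: faithG.
have E := ni_nat t (t Y \oc fhom G h \oc iso_bw (t X)).
apply: (iso_mono (i := t Y)); rewrite [LHS]E /=.
by rewrite (iso_bwfK (t X)).
Qed.

Section FullyFaithful.
Variables (C D : linCat K) (F : linFunctor C D).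
Hypotheses (faithF : faithful F) (fullF : full F) (surjF : ess_surj F).

Definition flift X Y (h : chom (F X) (F Y)) : chom X Y := sval (cid (fullF h)).

Lemma fliftK X Y (h : chom (F X) (F Y)) : fhom F (flift h) = h.
Proof. exact: svalP (cid (fullF h)). Qed.

Definition qinv_ob (Y : D) : C := sval (cid (surjF Y)).

Definition qinv_iso (Y : D) : ciso Y (F (qinv_ob Y)).
Proof.
suff /cid[j _] : exists j : ciso Y (F (qinv_ob Y)), True by exact: j.
by have [j] := svalP (cid (surjF Y)); exists j.
Defined.

Definition qinv_hom (Y Y' : D) (h : chom Y Y') :
    chom (qinv_ob Y) (qinv_ob Y') :=
  flift (qinv_iso Y' \oc h \oc iso_bw (qinv_iso Y)).

Lemma qinv_hom1 Y : qinv_hom (idm D Y) = idm C (qinv_ob Y).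
Proof. by apply: faithF; rewrite fliftK fhom1 ccompf1 iso_bwK. Qed.

Lemma qinv_hom_comp Y Y' Y'' (g : chom Y' Y'') (f : chom Y Y') :
  qinv_hom (g \oc f) = qinv_hom g \oc qinv_hom f.
Proof.
apply: faithF; rewrite fhom_comp !fliftK -!ccompA.
by rewrite iso_fwKf.
Qed.

Lemma qinv_hom_linear Y Y' : linear (@qinv_hom Y Y').
Proof.
move=> a f g; apply: faithF; rewrite (linP (fhom_linear F (Y:=_))) !fliftK.
rewrite (linP ((ccomp_bilin _ _ _).2 _)).
exact: (linP ((ccomp_bilin _ _ _).1 _)).
Qed.

Definition qinv : linFunctor D C :=
  LinFunctor qinv_hom1 qinv_hom_comp qinv_hom_linear.

Definition qinv_counit (X : C) : ciso (qinv (F X)) X.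
Proof.
pose i := qinv_iso (F X).
by exists (flift (iso_bw i)) (flift i); apply: faithF;
  rewrite fhom_comp !fliftK fhom1 ?iso_bwK ?iso_fwK.
Defined.

Lemma qinv_counit_nat (X Y : C) (f : chom X Y) :
  qinv_counit Y \oc fhom (compFunctor qinv F) f =
  fhom (idFunctor C) f \oc qinv_counit X.
Proof.
by apply: faithF; rewrite !fhom_comp !fliftK -ccompA iso_fwKf.
Qed.

Lemma qinv_unit_nat (X Y : D) (f : chom X Y) :
  iso_sym (qinv_iso Y) \oc fhom (compFunctor F qinv) f =
  fhom (idFunctor D) f \oc iso_sym (qinv_iso X).
Proof. by rewrite /= fliftK -ccompA iso_fwKf. Qed.

Lemma ff_ess_surj_equivalence : is_equivalence F.
Proof.
exists qinv; split; constructor.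
- exact: (NatIso (G := idFunctor C) qinv_counit_nat).
- exact: (NatIso (G := idFunctor D) qinv_unit_nat).
Qed.

End FullyFaithful.
End LinearCategories.

(** * Half braidings and their transport along a tensor functor *)

Section HalfBraidings.
Variables (K : fieldType) (C : tensorCat K).

Lemma tiso_fwK (X X' Y Y' : C) (i : ciso X X') (j : ciso Y Y') :
  thom (iso_bw i) (iso_bw j) \oc thom i j = idm C (tob X Y).
Proof. by rewrite -thom_comp !iso_fwK thom1. Qed.

Lemma tiso_bwK (X X' Y Y' : C) (i : ciso X X') (j : ciso Y Y') :
  thom i j \oc thom (iso_bw i) (iso_bw j) = idm C (tob X' Y').
Proof. by rewrite -thom_comp !iso_bwK thom1. Qed.

Definition tiso (X X' Y Y' : C) (i : ciso X X') (j : ciso Y Y') :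
    ciso (tob X Y) (tob X' Y') :=
  CIso (tiso_fwK i j) (tiso_bwK i j).

(** The composite [V X Y -> X V Y -> X Y V], the value that multiplicativity
    prescribes at [X Y]. *)
Definition hb_step (V X Y : C) (p : chom (tob V X) (tob X V))
    (q : chom (tob V Y) (tob Y V)) :
    chom (tob (tob V X) Y) (tob X (tob Y V)) :=
  thom (idm C X) q \oc tassoc X V Y \oc thom p (idm C Y).

(** The components need not be invertible, hence the unit axiom is not a
    consequence of the other two: it corresponds to [v . 1 = v], as
    multiplicativity corresponds to [v . (a b) = (v . a) . b]. *)
Record half_braiding (V : C) := HalfBraiding {
  hb :> forall X, chom (tob V X) (tob X V);
  hb_nat : forall X Y (f : chom X Y),
    thom f (idm C V) \oc hb X = hb Y \oc thom (idm C V) f;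
  hb_mul : forall X Y,
    tassoc X Y V \oc hb (tob X Y) \oc tassoc V X Y = hb_step (hb X) (hb Y);
  hb_unit : tlunit V \oc hb (tunit C) = trunit V }.

(** The composite [V W X -> V X W -> X V W], which is the half braiding of the
    tensor product [V W]. *)
Definition hb_tens_step (V W X : C) (p : chom (tob V X) (tob X V))
    (q : chom (tob W X) (tob X W)) :
    chom (tob (tob V W) X) (tob X (tob V W)) :=
  tassoc X V W \oc thom p (idm C W) \oc iso_bw (tassoc V X W)
    \oc thom (idm C V) q \oc tassoc V W X.

End HalfBraidings.

Section Squares.
Variables (K : fieldType) (C D : tensorCat K) (F : tensorFunctor C D).
Implicit Types (X Y Z V W : C).

(** Morphisms of the comma category of [F]: the objects are the maps
    [m : X' -> F X], and [fbox] is their tensor product. *)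
Definition fsq X Y (X' Y' : D) (m : chom X' (F X)) (n : chom Y' (F Y))
    (f : chom X Y) (g : chom X' Y') : Prop :=
  fhom F f \oc m = n \oc g.

Definition fbox X Y (X' Y' : D) (m : chom X' (F X)) (n : chom Y' (F Y)) :
    chom (tob X' Y') (F (tob X Y)) :=
  tf_mul F X Y \oc thom m n.

Lemma fsq_comp X Y Z (X' Y' Z' : D) (m : chom X' (F X)) (n : chom Y' (F Y))
    (p : chom Z' (F Z)) f g f' g' :
  fsq n p f' g' -> fsq m n f g -> fsq m p (f' \oc f) (g' \oc g).
Proof.
rewrite /fsq => sq' sq.
by rewrite fhom_comp -ccompA sq ccompA sq' ccompA.
Qed.

Lemma fsq_id X (X' : D) (m : chom X' (F X)) :
  fsq m m (idm C X) (idm D X').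
Proof. by rewrite /fsq fhom1 ccomp1f ccompf1. Qed.

Lemma fsq_inv X Y (X' Y' : D) (m : chom X' (F X)) (n : chom Y' (F Y))
    (f : ciso X Y) (g : ciso X' Y') :
  fsq m n f g -> fsq n m (iso_bw f) (iso_bw g).
Proof.
rewrite /fsq => sq; apply: (iso_mono (i := fiso F f)); rewrite /=.
by rewrite !ccompA fiso_bwK ccomp1f sq iso_fwfK.
Qed.

Lemma fsq_tens X X1 Y Y1 (X' X1' Y' Y1' : D)
    (m : chom X' (F X)) (n : chom Y' (F Y)) (m1 : chom X1' (F X1))
    (n1 : chom Y1' (F Y1)) f g f1 g1 :
  fsq m n f g -> fsq m1 n1 f1 g1 ->
  fsq (fbox m m1) (fbox n n1) (thom f f1) (thom g g1).
Proof.
rewrite /fsq /fbox => sq sq1.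
by rewrite ccompA tf_mul_nat -!ccompA -!thom_comp sq sq1.
Qed.

Lemma fsq_assoc X Y Z (X' Y' Z' : D) (m : chom X' (F X)) (n : chom Y' (F Y))
    (p : chom Z' (F Z)) :
  fsq (fbox (fbox m n) p) (fbox m (fbox n p)) (tassoc X Y Z)
    (tassoc X' Y' Z').
Proof.
rewrite /fsq /fbox.
rewrite -[p in X in X = _]ccomp1f thom_comp !ccompA tf_assoc.
rewrite -ccompA -tassoc_nat -[m in X in _ = X]ccomp1f thom_comp.
by rewrite !ccompA.
Qed.

Lemma fsq_lunit X (X' : D) (m : chom X' (F X)) :
  fsq (fbox (iso_fw (tf_unit F)) m) m (tlunit X) (tlunit X').
Proof.
rewrite /fsq /fbox -[m in LHS]ccomp1f -[iso_fw (tf_unit F)]ccompf1 thom_comp.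
by rewrite !ccompA tf_lunit -tlunit_nat.
Qed.

Lemma fsq_runit X (X' : D) (m : chom X' (F X)) :
  fsq (fbox m (iso_fw (tf_unit F))) m (trunit X) (trunit X').
Proof.
rewrite /fsq /fbox -[m in LHS]ccomp1f -[iso_fw (tf_unit F)]ccompf1 thom_comp.
by rewrite !ccompA tf_runit -trunit_nat.
Qed.

Lemma fbox1 X Y : fbox (idm D (F X)) (idm D (F Y)) = tf_mul F X Y.
Proof. by rewrite /fbox thom1 ccompf1. Qed.

Definition fbox_iso X Y (X' Y' : D) (i : ciso X' (F X)) (j : ciso Y' (F Y)) :
    ciso (tob X' Y') (F (tob X Y)) :=
  iso_trans (tf_mul F X Y) (tiso i j).

Lemma fsq_injr X Y (X' Y' : D) (m : chom X' (F X)) (n : ciso Y' (F Y)) f g g' :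
  fsq m n f g -> fsq m n f g' -> g = g'.
Proof. by rewrite /fsq => -> /iso_mono. Qed.

Lemma fsq_injl X Y (X' Y' : D) (m : ciso X' (F X)) (n : chom Y' (F Y)) f f' g :
  faithful F -> fsq m n f g -> fsq m n f' g -> f = f'.
Proof. by move=> faithF; rewrite /fsq => <- /iso_epi/faithF. Qed.

Section Compatible.
Variables (V : C) (V' : D) (s : ciso V' (F V)).

(** Quantifying over all [m], and not over a chosen one for each [X'], builds
    naturality into the relation: it is what makes squares at [fbox m n]
    available for the multiplicativity axiom. *)
Definition hb_compat (p : forall X, chom (tob V X) (tob X V))
    (p' : forall X' : D, chom (tob V' X') (tob X' V')) : Prop :=
  forall X (X' : D) (m : chom X' (F X)),
    fsq (fbox s m) (fbox m s) (p X) (p' X').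

Lemma fsq_hb_mul p p' X Y (X' Y' : D) (m : chom X' (F X)) (n : chom Y' (F Y)) :
  hb_compat p p' ->
  fsq (fbox (fbox s m) n) (fbox m (fbox n s))
    (tassoc X Y V \oc p (tob X Y) \oc tassoc V X Y)
    (tassoc X' Y' V' \oc p' (tob X' Y') \oc tassoc V' X' Y').
Proof.
move=> pp'; apply: fsq_comp; last exact: fsq_assoc.
by apply: fsq_comp; [exact: fsq_assoc|exact: pp'].
Qed.

Lemma fsq_hb_step p p' X Y (X' Y' : D) (m : chom X' (F X)) (n : chom Y' (F Y)) :
  hb_compat p p' ->
  fsq (fbox (fbox s m) n) (fbox m (fbox n s))
    (hb_step (p X) (p Y)) (hb_step (p' X') (p' Y')).
Proof.
move=> pp'; apply: fsq_comp; last by apply: fsq_tens (fsq_id _).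
by apply: fsq_comp (fsq_assoc _ _ _); apply: fsq_tens => //; apply: fsq_id.
Qed.

Lemma fsq_hb_unit p p' : hb_compat p p' ->
  fsq (fbox s (iso_fw (tf_unit F))) s (tlunit V \oc p (tunit C))
    (tlunit V' \oc p' (tunit D)).
Proof. by move=> pp'; apply: fsq_comp (pp' _ _ _); apply: fsq_lunit. Qed.

Hypotheses (faithF : faithful F) (fullF : full F) (surjF : ess_surj F).

Section Push.
Variable p : half_braiding V.

(** Every object [X'] of [D] is isomorphic to some [F X], and [F (p X)] is
    carried to [X'] along this isomorphism. *)
Definition push_hb_fun (X' : D) : chom (tob V' X') (tob X' V') :=
  let m := qinv_iso surjF X' in
  iso_bw (fbox_iso m s) \oc fhom F (p (qinv_ob surjF X')) \oc fbox_iso s m.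

(** Any [m : X' -> F X] differs from the chosen isomorphism of [X'] with the
    image of [qinv_ob surjF X'] by a morphism [F k], since [F] is full; the
    naturality of [p] with respect to [k] does the rest. *)
Lemma push_hb_compat : hb_compat p push_hb_fun.
Proof.
move=> X X' m; pose m0 := qinv_iso surjF X'.
pose k := flift fullF (m \oc iso_bw m0).
have sqk : fsq m0 m k (idm D X').
  by rewrite /fsq fliftK iso_bwfK ccompf1.
have sq0 : fsq (fbox s m0) (fbox m0 s) (p _) (push_hb_fun X').
  rewrite /fsq /push_hb_fun -/m0 -[fbox m0 s]/(iso_fw (fbox_iso m0 s)).
  by rewrite -[in RHS]ccompA iso_bwKf.
have := fsq_comp (fsq_tens sqk (fsq_id s)) sq0.
rewrite hb_nat thom1 ccomp1f => sq.
have := fsq_tens (fsq_id s) sqk; rewrite thom1 /fsq ccompf1 => E.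
by rewrite /fsq -E ccompA -fhom_comp.
Qed.

Lemma push_hb_nat (X Y : D) (f : chom X Y) :
  thom f (idm D V') \oc push_hb_fun X = push_hb_fun Y \oc thom (idm D V') f.
Proof.
pose m := qinv_iso surjF Y.
apply: (iso_mono (i := fbox_iso m s)).
have E : fbox_iso m s \oc thom f (idm D V') = fbox (m \oc f) s.
  by rewrite /= /fbox -ccompA -thom_comp ccompf1.
rewrite ccompA E -[LHS]push_hb_compat ccompA.
rewrite -[X in _ = X \oc _]push_hb_compat -ccompA; congr (_ \oc _).
by rewrite /fbox -ccompA -thom_comp ccompf1.
Qed.

Lemma push_hb_mul (X Y : D) :
  tassoc X Y V' \oc push_hb_fun (tob X Y) \oc tassoc V' X Y =
  hb_step (push_hb_fun X) (push_hb_fun Y).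
Proof.
pose m := qinv_iso surjF X; pose n := qinv_iso surjF Y.
have := fsq_hb_mul m n push_hb_compat.
rewrite hb_mul => /(fsq_injr (n := fbox_iso m (fbox_iso n s))); apply.
exact: fsq_hb_step push_hb_compat.
Qed.

Lemma push_hb_unit : tlunit V' \oc push_hb_fun (tunit D) = trunit V'.
Proof.
have := fsq_hb_unit push_hb_compat.
by rewrite hb_unit => /fsq_injr; apply; apply: fsq_runit.
Qed.

Definition push_hb : half_braiding V' :=
  HalfBraiding push_hb_nat push_hb_mul push_hb_unit.

End Push.

Section Pull.
Variable p' : half_braiding V'.

Definition pull_hb_fun X : chom (tob V X) (tob X V) :=
  let m := iso_id (F X) in
  flift fullF (fbox_iso m s \oc p' (F X) \oc iso_bw (fbox_iso s m)).

Lemma pull_hb_compat : hb_compat pull_hb_fun p'.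
Proof.
move=> X X' m; rewrite /fsq fliftK.
have E : fbox s m = fbox_iso s (iso_id (F X)) \oc thom (idm D V') m.
  by rewrite /= /fbox -ccompA -thom_comp ccompf1 ccomp1f.
rewrite E ccompA (iso_bwfK (fbox_iso s _)) -ccompA -hb_nat ccompA.
by rewrite /= /fbox -[X in X \oc _]ccompA -thom_comp ccompf1 ccomp1f.
Qed.

Lemma pull_hb_nat X Y (f : chom X Y) :
  thom f (idm C V) \oc pull_hb_fun X = pull_hb_fun Y \oc thom (idm C V) f.
Proof.
pose mX := iso_id (F X); pose mY := iso_id (F Y).
have sqf : fsq mX mY f (fhom F f) by rewrite /fsq ccompf1 ccomp1f.
have := fsq_comp (fsq_tens sqf (fsq_id s)) (pull_hb_compat mX).
rewrite hb_nat => /(fsq_injl (m := fbox_iso s mX)); apply => //.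
exact: fsq_comp (pull_hb_compat mY) (fsq_tens (fsq_id s) sqf).
Qed.

Lemma pull_hb_mul X Y :
  tassoc X Y V \oc pull_hb_fun (tob X Y) \oc tassoc V X Y =
  hb_step (pull_hb_fun X) (pull_hb_fun Y).
Proof.
pose m := iso_id (F X); pose n := iso_id (F Y).
have := fsq_hb_mul m n pull_hb_compat.
rewrite hb_mul => /(fsq_injl (m := fbox_iso (fbox_iso s m) n)); apply => //.
exact: fsq_hb_step pull_hb_compat.
Qed.

Lemma pull_hb_unit : tlunit V \oc pull_hb_fun (tunit C) = trunit V.
Proof.
have := fsq_hb_unit pull_hb_compat.
rewrite hb_unit => /(fsq_injl (m := fbox_iso s (tf_unit F))); apply => //.
exact: fsq_runit.
Qed.

Definition pull_hb : half_braiding V :=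
  HalfBraiding pull_hb_nat pull_hb_mul pull_hb_unit.

End Pull.
End Compatible.

Lemma hb_compat_tens V W (V' W' : D) (s : ciso V' (F V)) (t : ciso W' (F W))
    p p' q q' :
  hb_compat s p p' -> hb_compat t q q' ->
  hb_compat (fbox_iso s t) (fun X => hb_tens_step (p X) (q X))
    (fun X' : D => hb_tens_step (p' X') (q' X')).
Proof.
move=> pp' qq' X X' m; rewrite /hb_tens_step.
apply: fsq_comp; last exact: fsq_assoc.
apply: fsq_comp; last by apply: fsq_tens (fsq_id _) (qq' _ _ _).
apply: fsq_comp; last by apply: fsq_inv (fsq_assoc _ _ _).
by apply: fsq_comp (fsq_assoc _ _ _) _; apply: fsq_tens (fsq_id _).
Qed.

(** For the unit object the half braiding consists of unit constraints. *)
Lemma hb_compat_unit :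
  hb_compat (tf_unit F) (fun X => iso_bw (trunit X) \oc tlunit X)
    (fun X' : D => iso_bw (trunit X') \oc tlunit X').
Proof.
move=> X X' m; apply: fsq_comp (fsq_lunit _).
exact: fsq_inv (fsq_runit _).
Qed.

(** The two sides of the first equation correspond to the two sides of the
    second under squares with the same comparison maps. Essential surjectivity
    supplies a comparison map for each [X'], faithfulness the way back. *)
Lemma hb_morph_compat V W (V' W' : D) (s : ciso V' (F V)) (t : ciso W' (F W))
    p p' q q' (f : chom V W) (g : chom V' W') :
  faithful F -> ess_surj F -> hb_compat s p p' -> hb_compat t q q' ->
  fsq s t f g ->
  (forall X, thom (idm C X) f \oc p X = q X \oc thom f (idm C X)) <->
  (forall X' : D, thom (idm D X') g \oc p' X' = q' X' \oc thom g (idm D X')).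
Proof.
move=> faithF surjF pp' qq' sq.
have sql X (X' : D) (m : chom X' (F X)) : fsq (fbox s m) (fbox m t)
    (thom (idm C X) f \oc p X) (thom (idm D X') g \oc p' X').
  by apply: fsq_comp (pp' _ _ _); apply: fsq_tens (fsq_id _) _.
have sqr X (X' : D) (m : chom X' (F X)) : fsq (fbox s m) (fbox m t)
    (q X \oc thom f (idm C X)) (q' X' \oc thom g (idm D X')).
  by apply: fsq_comp (qq' _ _ _) _; apply: fsq_tens (fsq_id _).
split=> h X.
  pose m := qinv_iso surjF X; have := sql _ _ m; rewrite h.
  by move/(fsq_injr (n := fbox_iso m t)); apply; apply: sqr.
pose m := iso_id (F X); have := sql _ _ m; rewrite h.
by move/(fsq_injl (m := fbox_iso s m)); apply => //; apply: sqr.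
Qed.

End Squares.

(** * The braiding of a Yetter-Drinfeld module with a comodule *)

Lemma comod_tens3_ext (K : fieldType) (A : hopfAlgebra K)
    (V W X Y : comodule A)
    (f g : comodHom (comod_tens (comod_tens V W) X) Y) :
  (forall v w x, f ((v *t w) *t x) = g ((v *t w) *t x)) -> f = g.
Proof.
have lf := comodHom_linear f; have lg := comodHom_linear g.
move=> fg; apply: comod_tens_ext => t x.
move: t; apply: tens_ext => [||v w]; last exact: fg.
- by apply: (lin_comp lf); lin.
- by apply: (lin_comp lg); lin.
Qed.

Section Braiding.
Variables (K : fieldType) (A : hopfAlgebra K).
Implicit Types (V W : ydModule A) (X Y : comodule A) (U : lmodType K).
Local Notation S := (@antipode K A).
Local Notation Δ := (@comul K A).
Local Notation ε := (@counit K A).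

Definition brd_fun V X (t : V \ox X) : X \ox V :=
  \sw_(v, x <- t) \sw_(x0, x1 <- coact x) x0 *t yd_act v x1.

Lemma brd_linear V X : linear (@brd_fun V X).
Proof. by rewrite /brd_fun; lin. Qed.

Lemma brd_funE V X (v : V) (x : X) :
  brd_fun (v *t x) = \sw_(x0, x1 <- coact x) x0 *t yd_act v x1.
Proof. by rewrite /brd_fun tliftE //; lin. Qed.

(** The leg [x1] of the coaction of [X] meets the factor [antipode a1] of the
    Yetter-Drinfeld condition, and both cancel. *)
Lemma colinear_brd V X :
  @colinear K A (comod_tens V X) (comod_tens X V) (@brd_fun V X).
Proof.
have lb := @brd_linear V X; have lt := @tens_coact_linear _ _ X V.
have bt : bilin (fun (t : V \ox X) (y : A) => brd_fun t *t y).
  by apply: bilinI => [y|x]; [apply: lin_tensl|lin].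
apply: tens_ext => [||v x].
- exact: (lin_comp lt lb).
- by apply: lin_tlift_arg bt _; exact: linearP.
rewrite /= (tens_coact_sw _ _ bt).
rewrite brd_funE (lin_tlift _ _ lt).
transitivity (\sw_(v0, v1 <- coact v) \sw_(x0, x1 <- coact x)
  \sw_(a2, a3 <- Δ x1) (x0 *t yd_act v0 a2) *t (v1 * a3)); last first.
  apply: eq_tlift => v0 v1; symmetry.
  transitivity (\sw_(x0, x1 <- coact x) \sw_(x00, x01 <- coact x0)
      (x00 *t yd_act v0 x01) *t (v1 * x1)).
    apply: eq_tlift => x0 x1; rewrite brd_funE.
    by apply: (lin_tlift (f := fun m : X \ox V => m *t (v1 * x1))); lin.
  by rewrite (coactA_sw (f := fun x a b => (x *t yd_act v0 a) *t (v1 * b)));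
    try by lin.
transitivity (\sw_(v0, v1 <- coact v) \sw_(x0, x1 <- coact x)
  \sw_(x00, x01 <- coact x0) \sw_(a1, a23 <- Δ x1) \sw_(a2, a3 <- Δ a23)
    (x00 *t yd_act v0 a2) *t (x01 * (S a1 * v1 * a3))).
  rewrite [RHS]tlift_exch; apply: eq_tlift => x0 x1.
  rewrite tens_coactE [RHS]tlift_exch; apply: eq_tlift => x00 x01.
  rewrite yd_compat tlift_tlift; last by lin.
  apply: eq_tlift => v0 v1; rewrite tlift_tlift; last by lin.
  apply: eq_tlift => a1 a23; rewrite tlift_tlift; last by lin.
  by apply: eq_tlift => a2 a3; rewrite tliftE //; lin.
apply: eq_tlift => v0 v1.
rewrite (coactA_sw (f := fun x a b => \sw_(a1, a23 <- Δ b)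
    \sw_(a2, a3 <- Δ a23) (x *t yd_act v0 a2) *t (a * (S a1 * v1 * a3))));
  try by lin.
apply: eq_tlift => x0 b.
rewrite -(coassoc (f := fun p a1 a23 => \sw_(a2, a3 <- Δ a23)
  (x0 *t yd_act v0 a2) *t (p * (S a1 * v1 * a3)))); try by lin.
rewrite -[RHS](sw_counitl (f := fun c => \sw_(a2, a3 <- Δ c)
  (x0 *t yd_act v0 a2) *t (v1 * a3))); last by lin.
apply: eq_tlift => r a23; rewrite tlift_exch tliftZr.
apply: eq_tlift => a2 a3.
transitivity (\sw_(p, a1 <- Δ r)
    (x0 *t yd_act v0 a2) *t (p * S a1 * (v1 * a3))).
  by apply: eq_tlift => p a1; rewrite !mulrA.
rewrite (sw_antipoder (f := fun m => (x0 *t yd_act v0 a2) *t (m * (v1 * a3))));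
  last by lin.
by rewrite mul1r.
Qed.

Definition brd V X : comodHom (comod_tens V X) (comod_tens X V) :=
  @mkComodHom K A (comod_tens V X) (comod_tens X V) _ (@brd_linear V X)
    (@colinear_brd V X).

Local Notation MA := (comodCat A).

Lemma brd_nat V (X Y : MA) (f : chom X Y) :
  thom f (idm MA (yd_comod V)) \oc (brd V X : @chom _ MA _ _) =
  (brd V Y : @chom _ MA _ _) \oc thom (idm MA (yd_comod V)) f.
Proof.
apply: comod_tens_ext => v x.
have lf := comodHom_linear f; have cf := comodHom_colinear f.
rewrite /= brd_funE tmapE // brd_funE colinear_sw //; last by lin.
rewrite (lin_tlift _ _ (tmap_linear lf (@lin_id _ V))).
by apply: eq_tlift => x0 x1; rewrite tmapE.
Qed.

(** Multiplicativity of the braiding is associativity of the action. *)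
Lemma brd_mul V (X Y : MA) :
  tassoc X Y (yd_comod V : MA) \oc (brd V (tob X Y) : @chom _ MA _ _)
    \oc tassoc (yd_comod V : MA) X Y =
  hb_step (brd V X : @chom _ MA _ _) (brd V Y : @chom _ MA _ _).
Proof.
have la := @tassoc_linear K X Y V; have la' := @tassoc_linear K X V Y.
have lb := @brd_linear V Y.
have lt := tmap_linear (@lin_id _ X) lb.
have lta := lin_comp lt la'.
apply: comod_tens3_ext => v x y.
rewrite /= tassocE brd_funE /= (lin_tlift _ _ la).
rewrite tmapE //; last exact: brd_linear.
rewrite brd_funE.
have ly : linear (fun t : X \ox V => t *t y) by lin.
rewrite (lin_tlift _ _ (lin_comp lta ly)).
rewrite (tens_coact_sw (b := fun t a => tassoc_fun (t *t yd_act v a)));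
  last first.
  by apply: bilinI => *; apply: (lin_comp la); lin.
apply: eq_tlift => x0 x1; rewrite tassocE tmapE // brd_funE.
rewrite (lin_tlift (f := fun t => x0 *t t)); last by lin.
by apply: eq_tlift => y0 y1; rewrite tassocE yd_actM.
Qed.

Lemma brd_unit V :
  tlunit (yd_comod V : MA) \oc (brd V (tunit MA) : @chom _ MA _ _) =
  trunit (yd_comod V : MA).
Proof.
apply: comod_tens_ext => v x; rewrite /= brd_funE /triv_coact_fun.
rewrite tliftE; last by lin.
by rewrite tlunitE trunitE yd_act1.
Qed.

Definition yd_hb V : half_braiding (yd_comod V : MA) :=
  @HalfBraiding _ MA (yd_comod V) (brd V) (@brd_nat V) (@brd_mul V)
    (@brd_unit V).

(** The diagonal action on a tensor product makes the braiding of [V \ox W] the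
    composite of the two braidings. *)
Lemma brd_tens V W (X : MA) :
  (brd (yd_tens V W) X :
     @chom _ MA (tob (tob (yd_comod V : MA) (yd_comod W)) X)
       (tob X (tob (yd_comod V : MA) (yd_comod W)))) =
  hb_tens_step (brd V X : @chom _ MA _ _) (brd W X : @chom _ MA _ _).
Proof.
have la := @tassoc_linear K X V W.
have lb := tmap_linear (@brd_linear V X) (@lin_id _ W).
have la' := @tassocV_linear K V X W.
have lc := lin_comp la (lin_comp lb la').
apply: comod_tens3_ext => v w x.
rewrite /= brd_funE tassocE tmapE //; last exact: brd_linear.
rewrite brd_funE.
have lv : linear (fun t : X \ox W => v *t t) by lin.
rewrite [RHS](lin_tlift _ _ (lin_comp lc lv)).
transitivity (\sw_(x0, x1 <- coact x) \sw_(x00, x01 <- coact x0)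
  x00 *t (yd_act v x01 *t yd_act w x1)).
  rewrite (coactA_sw (f := fun x a b => x *t (yd_act v a *t yd_act w b)));
    try by lin.
  apply: eq_tlift => x0 x1; rewrite /= tens_actE.
  by apply: (lin_tlift (f := fun t => x0 *t t)); lin.
apply: eq_tlift => x0 x1; rewrite tassocVE tmapE //; last exact: brd_linear.
have lw : linear (fun t : X \ox V => t *t yd_act w x1) by lin.
rewrite brd_funE [RHS](lin_tlift _ _ (lin_comp la lw)).
by apply: eq_tlift => x00 x01; rewrite tassocE.
Qed.

Lemma brd_yd_unit (X : MA) :
  (brd (yd_unit A) X : @chom _ MA (tob (tunit MA) X) (tob X (tunit MA))) =
  iso_bw (trunit X) \oc tlunit X.
Proof.
apply: comod_tens_ext => k x; rewrite /= brd_funE tlunitE /trunitV_fun.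
rewrite -[in RHS](coact_counit x).
have lk : linear (fun x : X => (k : K) *: x) by lin.
rewrite (lin_tlift _ _ (lin_comp (@lin_tensl K X K^o X id 1 (@lin_id _ _)) lk)).
apply: eq_tlift => x0 x1 /=; rewrite /triv_act.
by rewrite !tensZl -!tensZr scalerA mulrC -[in RHS]scalerA [k *: 1]mulr1.
Qed.

End Braiding.

(** * Yetter-Drinfeld modules from half braidings *)

Section Cofree.
Variables (K : fieldType) (A : hopfAlgebra K).
Implicit Types (U W : lmodType K) (V X Y : comodule A).
Local Notation Δ := (@comul K A).
Local Notation ε := (@counit K A).

(** The counit on one leg is linear but not colinear: it is the means by which
    an action is read off from colinear maps. *)
Definition epsl U (t : A \ox U) : U := \sw_(a, u <- t) (ε a : K) *: u.
Definition epsr U (t : U \ox A) : U := \sw_(u, a <- t) (ε a : K) *: u.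

Lemma epsl_linear U : linear (@epsl U).
Proof. by rewrite /epsl; lin. Qed.
Lemma epsr_linear U : linear (@epsr U).
Proof. by rewrite /epsr; lin. Qed.
Lemma epslE U (a : A) (u : U) : epsl (a *t u) = (ε a : K) *: u.
Proof. by rewrite /epsl tliftE //; lin. Qed.
Lemma epsrE U (a : A) (u : U) : epsr (u *t a) = (ε a : K) *: u.
Proof. by rewrite /epsr tliftE //; lin. Qed.

Definition reg_comod : comodule A := Comodule (@comulA K A) (@counitr K A).

Definition cofree_coact_fun U (t : U \ox A) : (U \ox A) \ox A :=
  \sw_(u, a <- t) \sw_(a1, a2 <- Δ a) (u *t a1) *t a2.

Lemma cofree_coact_linear U : linear (@cofree_coact_fun U).
Proof. by rewrite /cofree_coact_fun; lin. Qed.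

Lemma cofree_coactE U (u : U) (a : A) :
  cofree_coact_fun (u *t a) = \sw_(a1, a2 <- Δ a) (u *t a1) *t a2.
Proof. by rewrite /cofree_coact_fun tliftE //; lin. Qed.

Lemma cofree_coact_sw U W (b : U \ox A -> A -> W) u a : bilin b ->
  \sw_(x, y <- cofree_coact_fun (u *t a)) b x y =
  \sw_(a1, a2 <- Δ a) b (u *t a1) a2.
Proof.
move=> bb; rewrite cofree_coactE tlift_tlift //.
by apply: eq_tlift => x y; rewrite tliftE.
Qed.

Definition cofree_coact U := mklin (@cofree_coact_linear U).

Lemma cofree_coactA U (t : U \ox A) :
  \sw_(v0, v1 <- cofree_coact U t) \sw_(v00, v01 <- cofree_coact U v0)
     v00 *t (v01 *t v1) =
  \sw_(v0, v1 <- cofree_coact U t) v0 *t Δ v1.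
Proof.
move: t; apply: tens_ext => [||u a]; [by lin|by lin|].
have lf := @cofree_coact_linear U.
rewrite /= !cofree_coact_sw; [|by lin|].
- transitivity (\sw_(a1, a2 <- Δ a) \sw_(a11, a12 <- Δ a1)
    (u *t a11) *t (a12 *t a2)).
    by apply: eq_tlift => a1 a2; rewrite cofree_coact_sw //; lin.
  rewrite (coassoc (f := fun x y z => (u *t x) *t (y *t z))); try by lin.
  apply: eq_tlift => a1 a2.
  rewrite [in RHS](tensE (Δ a2)) [RHS]lin_tlift //; lin.
- apply: bilinI => [y|y]; last by lin.
  by apply: lin_tlift_arg; [lin|exact: lf].
Qed.

Lemma cofree_coact_counit U (t : U \ox A) :
  \sw_(v0, v1 <- cofree_coact U t) (ε v1 : K) *: v0 = t.
Proof.
move: t; apply: tens_ext => [||u a]; [by lin|by lin|].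
rewrite /= cofree_coact_sw; last by lin.
by rewrite (sw_counitr (f := fun a => u *t a)); last by lin.
Qed.

(** The comodule [U \ox A] coacting through [A] alone; colinear maps into it
    are the same as linear maps into [U]. *)
Definition cofree U : comodule A :=
  @Comodule K A (U \ox A) (cofree_coact U) (@cofree_coactA U)
    (@cofree_coact_counit U).

(** The colinear map into the cofree comodule on [U] that corresponds to the
    linear map [h]; for the identity it is the coaction. *)
Definition corep_fun X U (h : X -> U) (x : X) : U \ox A :=
  tmap h (fun a : A => a) (coact x).

Lemma corep_linear X U (h : X -> U) : linear h -> linear (corep_fun h).
Proof.
move=> lh; apply: (lin_comp (tmap_linear lh (@lin_id _ _))).
exact: linearP.
Qed.

Lemma corep_colinear X U (h : X -> U) :
  linear h -> @colinear K A X (cofree U) (corep_fun h).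
Proof.
move=> lh x; rewrite /= {1}/corep_fun /tmap lin_tlift; last first.
  exact: cofree_coact_linear.
transitivity (\sw_(x0, x1 <- coact x) \sw_(a1, a2 <- Δ x1)
   (h x0 *t a1) *t a2).
  by apply: eq_tlift => x0 x1; rewrite cofree_coactE.
rewrite -(coactA_sw (f := fun x a b => (h x *t a) *t b)); last by lin.
- apply: eq_tlift => x0 x1; symmetry.
  by apply: (lin_tlift (f := fun t : U \ox A => t *t x1)); lin.
- by move=> y z; apply: lin_tensl; apply: lin_tensl.
- by lin.
Qed.

Definition corep X U (h : X -> U) (lh : linear h) : comodHom X (cofree U) :=
  @mkComodHom K A X (cofree U) _ (corep_linear lh) (corep_colinear lh).

Lemma corepK X U (h : X -> U) (x : X) : linear h ->
  epsr (corep_fun h x) = h x.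
Proof.
move=> lh; rewrite /corep_fun /tmap (lin_tlift _ _ (@epsr_linear U)).
rewrite -[RHS](coact_counit_sw (f := h)) //.
by apply: eq_tlift => x0 x1; rewrite epsrE.
Qed.

Lemma cofree_tens_colinear U (u : U) :
  @colinear K A reg_comod (cofree U) (fun a : A => u *t a).
Proof. by move=> a; rewrite /= cofree_coactE. Qed.

Definition cofree_tens U (u : U) : comodHom reg_comod (cofree U) :=
  @mkComodHom K A reg_comod (cofree U) (fun a : A => u *t a)
    (lin_tensr u (@lin_id _ A)) (cofree_tens_colinear u).

End Cofree.
Arguments reg_comod {K} A.
Arguments cofree {K} A U.

Section HalfBraidingToYD.
Variables (K : fieldType) (A : hopfAlgebra K).
Implicit Types (V X Y : comodule A) (U : lmodType K).
Local Notation S := (@antipode K A).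
Local Notation Δ := (@comul K A).
Local Notation ε := (@counit K A).
Local Notation MA := (comodCat A).

Lemma epsl_brd (V : ydModule A) (v : V) (a : A) :
  epsl (@brd_fun K A V (reg_comod A) (v *t a)) = yd_act v a.
Proof.
rewrite brd_funE (lin_tlift _ _ (@epsl_linear K A V)) /=.
rewrite -[RHS](sw_counitl (f := fun a => yd_act v a)); last by lin.
by apply: eq_tlift => a1 a2; rewrite epslE.
Qed.

(** The action is recovered from the braiding with the regular comodule by
    applying the counit, which is a linear map only. *)
Lemma act_linear_brdP (V W : ydModule A) (f : comodHom V W) :
  act_linear f <->
  (forall X : MA, thom (idm MA X) (f : @chom _ MA (yd_comod V) (yd_comod W))
      \oc (brd V X : @chom _ MA _ _) =
    (brd W X : @chom _ MA _ _) \oc thom (f : @chom _ MA _ _) (idm MA X)).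
Proof.
have lf := comodHom_linear f.
split=> [af X|h v a].
  apply: comod_tens_ext => v x; rewrite /= tmapE // !brd_funE.
  rewrite (lin_tlift _ _ (tmap_linear (@lin_id _ X) lf)).
  by apply: eq_tlift => x0 x1; rewrite tmapE // af.
have := congr1 (fun g : comodHom (comod_tens V (reg_comod A)) _ => g (v *t a))
  (h (reg_comod A)).
move/(congr1 (@epsl K A W)).
rewrite /= (tmapE _ _ lf (@lin_id _ A)).
rewrite epsl_brd => <-; rewrite -epsl_brd.
move: (brd_fun _) => t.
have ll := tmap_linear (@lin_id _ (A : lmodType K)) lf.
move: t; apply: tens_ext => [||b w].
- exact: (lin_comp lf (@epsl_linear K A V)).
- exact: (lin_comp (@epsl_linear K A W) ll).
by rewrite tmapE // !epslE (linZ lf).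
Qed.

Section FromHB.
Variables (V : comodule A) (p : half_braiding (V : MA)).

Let g X : comodHom (comod_tens V X) (comod_tens X V) := p X.

Let g_linear X : linear (g X). Proof. exact: comodHom_linear. Qed.

Definition hb_act (v : V) (a : A) : V := epsl (g (reg_comod A) (v *t a)).

Lemma hb_act_bilin : bilin hb_act.
Proof.
have lg := @g_linear (reg_comod A); have le := @epsl_linear K A V.
have l := lin_comp le lg.
by apply: bilinI => [a|v]; apply: (lin_comp l); lin.
Qed.

Lemma g_nat X Y (f : comodHom X Y) (v : V) (x : X) :
  g Y (v *t f x) = tmap f (fun v => v) (g X (v *t x)).
Proof.
have := congr1 (fun h : comodHom (comod_tens V X) _ => h (v *t x))
  (hb_nat p (f : @chom _ MA X Y)).
rewrite /= => ->; rewrite tmapE //; exact: comodHom_linear.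
Qed.

(** Every comodule embeds into a cofree one, where naturality reduces the
    half braiding to the one of the regular comodule. *)
Lemma hbE X (v : V) (x : X) :
  g X (v *t x) = \sw_(x0, x1 <- coact x) x0 *t hb_act v x1.
Proof.
have lX := @lin_id K X; have lV := @lin_id K V.
have le := tmap_linear (@epsr_linear K A X) lV.
have lr := tmap_linear (corep_linear lX) lV.
transitivity (tmap (@epsr K A X) (fun v : V => v)
    (g (cofree A X) (v *t corep_fun (fun x => x) x))).
  rewrite (g_nat (corep lX)) /=.
  move: (g X _) => t; move: t; apply: tens_ext => [||y w] //.
    exact: (lin_comp le lr).
  by rewrite !tmapE ?corepK //; [exact: epsr_linear|exact: corep_linear].
have lv : linear (fun t : X \ox A => v *t t) by lin.
rewrite /corep_fun /tmap.
rewrite [LHS](lin_tlift _ _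
  (lin_comp le (lin_comp (@g_linear (cofree A X)) lv))).
apply: eq_tlift => x0 x1; rewrite (g_nat (cofree_tens _ x0) v x1) /= /hb_act.
have lt := lin_tensr x0 (@lin_id _ (A : lmodType K)).
have lx : linear (fun t : V => x0 *t t) by lin.
move: (g _ _) => t; move: t; apply: tens_ext => [||a w].
- exact: (lin_comp le (tmap_linear lt lV)).
- exact: (lin_comp lx (@epsl_linear K A V)).
rewrite !tmapE //; last exact: epsr_linear.
by rewrite epsrE epslE tensZl tensZr.
Qed.

(** The unit axiom of [p] at the element [v *t 1]. *)
Lemma hb_act1 (v : V) : hb_act v 1 = v.
Proof.
have := congr1 (fun h : comodHom (comod_tens V (comod_unit A)) _ =>
  h (v *t (1 : K^o))) (hb_unit p).
rewrite /= trunitE scale1r -[hb p _]/(g (comod_unit A)) hbE /=.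
rewrite /triv_coact_fun tliftE ?tlunitE ?scale1r //.
have [ll lr] := hb_act_bilin.
by apply: bilinI => *; [lin|apply: lin_tensr; apply: lr].
Qed.

(** Multiplicativity of [p] for two copies of the regular comodule, followed by
    the counit on both. *)
Lemma hb_actM (v : V) (a b : A) : hb_act v (a * b) = hb_act (hb_act v a) b.
Proof.
have [bl br] := hb_act_bilin; have bact := hb_act_bilin.
pose R := reg_comod A.
have := congr1 (fun h : comodHom (comod_tens (comod_tens V R) R) _ =>
  h ((v *t a) *t b)) (hb_mul p R R).
rewrite /= tassocE tmapE; [|exact: (@g_linear R)|exact: lin_id].
rewrite -[hb p _]/(g (comod_tens R R)) -[hb p _]/(g R).
move/(congr1 (fun t => epsl (tmap (fun a : A => a) (@epsl K A V) t))).
have le := @epsl_linear K A V.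
have lt := tmap_linear (@lin_id _ A) le.
have lf := lin_comp (@epsl_linear K A V) lt.
have la := @tassoc_linear K A A V.
have la' := @tassoc_linear K A V A.
have lg := tmap_linear (@lin_id _ A) (@g_linear R).
rewrite !hbE (tens_coact_sw (b := fun t c => t *t hb_act v c)); last first.
  by apply: bilinI => *; [lin|apply: lin_tensr; apply: br].
rewrite (lin_tlift _ _ (lin_comp lf la)) /=.
have -> : \sw_(a1, a2 <- Δ a) epsl (tmap id (@epsl K A V) (tassoc_fun
    (\sw_(b1, b2 <- Δ b) (a1 *t b1) *t hb_act v (a2 * b2)))) =
  hb_act v (a * b).
  rewrite -[RHS](sw_counitl (f := fun x => hb_act v (x * b))); last first.
    by apply: (lin_comp (br v)); lin.
  apply: eq_tlift => a1 a2; rewrite (lin_tlift _ _ (lin_comp lf la)).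
  rewrite -[RHS](sw_counitl (f := fun x => (ε a1 : K) *: hb_act v (a2 * x))).
    apply: eq_tlift => b1 b2; rewrite tassocE tmapE //.
    by rewrite !epslE !scalerA mulrC.
  by apply: lin_scaler; apply: (lin_comp (br v)); lin.
move=> ->.
have lb : linear (fun t : A \ox V => t *t b) by lin.
rewrite (lin_tlift _ _ (lin_comp lf (lin_comp lg (lin_comp la' lb)))).
have lh : linear (fun x : A => hb_act (hb_act v x) b).
  exact: (lin_comp (bl b) (br v)).
rewrite -[RHS](sw_counitl (f := fun x => hb_act (hb_act v x) b)) //.
apply: eq_tlift => a1 a2; rewrite tassocE tmapE //.
by rewrite tmapE // epslE.
Qed.

(** Colinearity of the half braiding at the regular comodule, followed by the
    counit on its first leg. *)
Lemma hb_compat_eq (v : V) (a : A) :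
  \sw_(a1, a2 <- Δ a) \sw_(w0, w1 <- coact (hb_act v a2)) w0 *t (a1 * w1) =
  \sw_(v0, v1 <- coact v) \sw_(a1, a2 <- Δ a) hb_act v0 a1 *t (v1 * a2).
Proof.
have [bl br] := hb_act_bilin; have bact := hb_act_bilin.
pose R := reg_comod A.
have lR := @g_linear R.
have le := @epsl_linear K A V.
have lt := tmap_linear le (@lin_id _ A).
have := comodHom_colinear (g R) (v *t a).
move/(congr1 (tmap (@epsl K A V) (fun a : A => a))).
rewrite /= (tens_coact_sw (b := fun t c => g R t *t c)); last first.
  by apply: bilinI => *; [apply: lin_tensl|lin].
rewrite hbE (lin_tlift _ _ (@tens_coact_linear _ _ R V)).
rewrite !(lin_tlift _ _ lt) => h.
transitivity (\sw_(x, y <- coact (a : R))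
      tmap (@epsl K A V) (fun a : A => a)
        (@tens_coact_fun K A R V (x *t hb_act v y))).
  apply: eq_tlift => a1 a2.
  rewrite (@tens_coactE K A R V) (lin_tlift _ _ lt) /=.
  rewrite -[LHS](sw_counitl (f := fun c =>
    \sw_(w0, w1 <- coact (hb_act v a2)) w0 *t (c * w1))); last by lin.
  apply: eq_tlift => b1 b2; rewrite tliftZr (lin_tlift _ _ lt).
  by apply: eq_tlift => w0 w1; rewrite tmapE // epslE tensZl.
rewrite [LHS]h; apply: eq_tlift => v0 v1.
rewrite (lin_tlift _ _ lt); apply: eq_tlift => a1 a2.
by rewrite tmapE.
Qed.

(** [hb_compat_eq] is the Yetter-Drinfeld condition with the antipode moved to
    the other side: multiplying by one more antipode leg moves it back. *)
Lemma hb_yd_compat (v : V) (a : A) : coact (hb_act v a) =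
  \sw_(v0, v1 <- coact v) \sw_(a1, a23 <- Δ a) \sw_(a2, a3 <- Δ a23)
    hb_act v0 a2 *t (S a1 * v1 * a3).
Proof.
have [bl br] := hb_act_bilin; have bact := hb_act_bilin.
have lc := lin_app (@coact K A V) (br v).
transitivity (\sw_(s, b <- Δ a) \sw_(q, a3 <- Δ b)
  \sw_(w0, w1 <- coact (hb_act v a3)) w0 *t (S s * (q * w1))).
  rewrite -(coassoc (f := fun s q a3 =>
     \sw_(w0, w1 <- coact (hb_act v a3)) w0 *t (S s * (q * w1)))); first last.
  - by move=> x y; apply: lin_tlift_arg => //; lin.
  - by move=> x y; lin.
  - by move=> x y; lin.
  rewrite -[LHS](sw_counitl (f := fun a => coact (hb_act v a))) //.
  apply: eq_tlift => r a3; rewrite tlift_exch [X in _ *: X]tensE tliftZr.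
  apply: eq_tlift => w0 w1.
  transitivity (\sw_(s, q <- Δ r) w0 *t (S s * q * w1)).
    rewrite (sw_antipodel (f := fun x => w0 *t (x * w1))) ?mul1r //; lin.
  by apply: eq_tlift => s q; rewrite mulrA.
rewrite [RHS]tlift_exch; apply: eq_tlift => s b.
have ls : linear (tmap (fun w : V => w) (fun d : A => S s * d)).
  by apply: tmap_linear; lin.
have := congr1 (tmap (fun w : V => w) (fun d : A => S s * d))
  (hb_compat_eq v b).
rewrite !(lin_tlift _ _ ls) => h.
transitivity (\sw_(x, y <- Δ b) tmap id [eta *%R (S s)]
        (\sw_(w0, w1 <- coact (hb_act v y)) w0 *t (x * w1))).
  apply: eq_tlift => q a3; rewrite (lin_tlift _ _ ls).
  by apply: eq_tlift => w0 w1; rewrite tmapE //; lin.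
rewrite h; apply: eq_tlift => v0 v1; rewrite (lin_tlift _ _ ls).
by apply: eq_tlift => a2 a3; rewrite tmapE ?mulrA //; lin.
Qed.

Definition yd_of_hb : ydModule A :=
  @YDModule K A V hb_act hb_act_bilin hb_act1 hb_actM hb_yd_compat.

Lemma brd_yd_of_hb (X : MA) :
  (brd yd_of_hb X : @chom _ MA (tob (V : MA) X) _) = p X.
Proof.
by apply: comod_tens_ext => v x; rewrite -[RHS]/(g X (v *t x)) hbE /= brd_funE.
Qed.

End FromHB.
End HalfBraidingToYD.

(** * The induced equivalence of Yetter-Drinfeld categories *)

Section LiftToYD.
Variables (K : fieldType) (A : hopfAlgebra K).
Implicit Types (V W : ydModule A).
Local Notation MA := (comodCat A).
Local Notation YA := (ydCat A).

Lemma yd_forget_inj V W (f g : ydHom V W) :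
  yd_forget_map f = yd_forget_map g -> f = g.
Proof.
move=> fg; apply: ydHomP => v.
exact: (congr1 (fun h : comodHom V W => h v) fg).
Qed.

Definition yd_lift V W (g : comodHom V W) (ag : act_linear g) : ydHom V W :=
  mkYDHom (comodHom_linear g) (comodHom_colinear g) ag.

Lemma yd_liftK V W (g : comodHom V W) (ag : act_linear g) :
  yd_forget_map (yd_lift ag) = g.
Proof. exact: comodHomP. Qed.

Section Iso.
Variables (V W : ydModule A).
Variable i : @ciso K MA (yd_comod V) (yd_comod W).
Hypothesis ai : @act_linear K A V W (iso_fw i : comodHom V W).

Lemma yd_lift_iso_bw : @act_linear K A W V (iso_bw i : comodHom W V).
Proof.
move: ai; apply: act_linear_inv => v.
- exact: (congr1 (fun h : comodHom V V => h v) (iso_fwK i)).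
- exact: (congr1 (fun h : comodHom W W => h v) (iso_bwK i)).
Qed.

Lemma yd_lift_isoK :
  (yd_lift yd_lift_iso_bw : @chom K YA W V) \oc yd_lift ai = idm YA V.
Proof.
apply: ydHomP => v.
exact: (congr1 (fun h : comodHom V V => h v) (iso_fwK i)).
Qed.

Lemma yd_lift_isoVK :
  (yd_lift ai : @chom K YA V W) \oc yd_lift yd_lift_iso_bw = idm YA W.
Proof.
apply: ydHomP => v.
exact: (congr1 (fun h : comodHom W W => h v) (iso_bwK i)).
Qed.

Definition yd_lift_iso : @ciso K YA V W := CIso yd_lift_isoK yd_lift_isoVK.

End Iso.

Lemma yd_forget_thom (V V' W W' : YA) (f : chom V V') (g : chom W W') :
  yd_forget_map (thom f g) =
  @thom K MA _ _ _ _ (yd_forget_map f) (yd_forget_map g).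
Proof. exact: comodHomP. Qed.

Lemma yd_forget_tassoc (V W X : YA) :
  yd_forget_map (iso_fw (tassoc V W X)) =
  iso_fw (@tassoc K MA (yd_comod V) (yd_comod W) (yd_comod X)).
Proof. exact: comodHomP. Qed.

Lemma yd_forget_tlunit (V : YA) :
  yd_forget_map (iso_fw (tlunit V)) = iso_fw (@tlunit K MA (yd_comod V)).
Proof. exact: comodHomP. Qed.

Lemma yd_forget_trunit (V : YA) :
  yd_forget_map (iso_fw (trunit V)) = iso_fw (@trunit K MA (yd_comod V)).
Proof. exact: comodHomP. Qed.

End LiftToYD.

Section TransportedFunctor.
Variables (K : fieldType) (A H : hopfAlgebra K).
Local Notation MA := (comodCat A).
Local Notation MH := (comodCat H).
Local Notation YA := (ydCat A).
Local Notation YH := (ydCat H).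
Variable F : tensorFunctor MA MH.
Hypotheses (faithF : faithful F) (fullF : full F) (surjF : ess_surj F).

(** The relation under which [V'] is an image of [V], up to the isomorphism [s]
    of underlying comodules. *)
Definition yd_compatible (V : ydModule A) (V' : ydModule H)
    (s : @ciso K MH (yd_comod V') (F (yd_comod V))) : Prop :=
  @hb_compat K MA MH F (yd_comod V) (yd_comod V') s (brd V) (brd V').

(** All action-linearity statements about the induced functor, its tensor
    constraints and its essential surjectivity are instances of this one. *)
Lemma yd_act_linear_compat (V W : ydModule A) (V' W' : ydModule H)
    (s : @ciso K MH (yd_comod V') (F (yd_comod V)))
    (t : @ciso K MH (yd_comod W') (F (yd_comod W)))
    (f : @chom K MA (yd_comod V) (yd_comod W))
    (g : @chom K MH (yd_comod V') (yd_comod W')) :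
  yd_compatible s -> yd_compatible t -> fsq (F := F) s t f g ->
  @act_linear K A V W (f : comodHom V W) <->
  @act_linear K H V' W' (g : comodHom V' W').
Proof.
move=> cs ct sq; have h := hb_morph_compat faithF surjF cs ct sq.
by split=> /act_linear_brdP/h/act_linear_brdP.
Qed.

(** The underlying comodule is [F (yd_comod V)] by computation, so that the
    forgetful functors commute strictly with the induced functor and [F]. *)
Definition that_ob (V : ydModule A) : ydModule H :=
  yd_of_hb (push_hb (iso_id (F (yd_comod V))) fullF surjF (yd_hb V)).

Lemma that_compat (V : ydModule A) :
  @yd_compatible V (that_ob V) (iso_id (F (yd_comod V))).
Proof.
move=> X X' m; rewrite brd_yd_of_hb.
exact: (push_hb_compat _ fullF surjF (yd_hb V)).
Qed.

Lemma that_act (V W : ydModule A) (f : ydHom V W) :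
  @act_linear K H (that_ob V) (that_ob W)
    (fhom F (yd_forget_map f : @chom K MA (yd_comod V) (yd_comod W)) :
       comodHom _ _).
Proof.
have sq : fsq (iso_id (F (yd_comod V))) (iso_id (F (yd_comod W)))
    (yd_forget_map f : @chom K MA (yd_comod V) (yd_comod W))
    (fhom F (yd_forget_map f : @chom K MA (yd_comod V) (yd_comod W))).
  by rewrite /fsq ccompf1 ccomp1f.
by apply/(yd_act_linear_compat (@that_compat V) (@that_compat W) sq)/ydHom_act.
Qed.

Definition that_hom (V W : YA) (f : chom V W) :
    @chom K YH (that_ob V) (that_ob W) :=
  yd_lift (that_act f).

Lemma that_homE (V W : YA) (f : chom V W) :
  yd_forget_map (that_hom f) =
  fhom F (yd_forget_map f : @chom K MA (yd_comod V) (yd_comod W)).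
Proof. exact: yd_liftK. Qed.

Lemma that_hom1 (V : YA) : that_hom (idm YA V) = idm YH (that_ob V).
Proof. by apply: yd_forget_inj; rewrite that_homE !yd_forget1 fhom1. Qed.

Lemma that_hom_comp (V W X : YA) (g : chom W X) (f : chom V W) :
  that_hom (g \oc f) = that_hom g \oc that_hom f.
Proof.
apply: yd_forget_inj.
by rewrite that_homE yd_forget_comp fhom_comp yd_forget_comp !that_homE.
Qed.

Lemma that_hom_linear (V W : YA) : linear (@that_hom V W).
Proof.
move=> a f g; apply: yd_forget_inj.
by rewrite that_homE (linP (@yd_forget_linear K A V W))
  (linP (fhom_linear F (Y := _))) (linP (@yd_forget_linear K H _ _)) !that_homE.
Qed.

Definition that_fun : linFunctor YA YH :=
  @LinFunctor K YA YH that_ob that_hom that_hom1 that_hom_comp that_hom_linear.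

Lemma yd_compatible_tens (V W : ydModule A) (V' W' : ydModule H)
    (s : @ciso K MH (yd_comod V') (F (yd_comod V)))
    (t : @ciso K MH (yd_comod W') (F (yd_comod W))) :
  yd_compatible s -> yd_compatible t ->
  @yd_compatible (yd_tens V W) (yd_tens V' W') (fbox_iso s t).
Proof.
by move=> cs ct X X' m; rewrite !brd_tens; apply: hb_compat_tens.
Qed.

Lemma yd_compatible_unit : @yd_compatible (yd_unit A) (yd_unit H) (tf_unit F).
Proof. by move=> X X' m; rewrite !brd_yd_unit; apply: hb_compat_unit. Qed.

(** The square with the identity on top, whose sides are the comparison maps
    [tf_mul] and the identity. *)
Lemma that_mul_act (V W : YA) :
  @act_linear K H (yd_tens (that_ob V) (that_ob W)) (that_ob (yd_tens V W))
    (iso_fw (tf_mul F (yd_comod V) (yd_comod W)) : comodHom _ _).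
Proof.
have := @yd_act_linear_compat (yd_tens V W) (yd_tens V W)
  (yd_tens (that_ob V) (that_ob W)) (that_ob (yd_tens V W)) _ _
  (idm MA (yd_comod (yd_tens V W))) (tf_mul F (yd_comod V) (yd_comod W))
  (yd_compatible_tens (@that_compat V) (@that_compat W))
  (@that_compat (yd_tens V W)).
case; last by move=> h _; apply: h.
by rewrite /fsq fhom1 ccomp1f [RHS]ccomp1f; apply: fbox1.
Qed.

Definition that_mul (V W : YA) :
    ciso (tob (that_fun V) (that_fun W)) (that_fun (tob V W)) :=
  yd_lift_iso (@that_mul_act V W).

Lemma that_unit_act :
  @act_linear K H (yd_unit H) (that_ob (yd_unit A))
    (iso_fw (tf_unit F) : comodHom _ _).
Proof.
have := @yd_act_linear_compat (yd_unit A) (yd_unit A)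
  (yd_unit H) (that_ob (yd_unit A)) _ _
  (idm MA (tunit MA)) (tf_unit F) yd_compatible_unit
  (@that_compat (yd_unit A)).
case; last by move=> h _; apply: h.
by rewrite /fsq fhom1 ccomp1f.
Qed.

Definition that_unit : ciso (tunit YH) (that_fun (tunit YA)) :=
  yd_lift_iso that_unit_act.

Lemma that_mul_nat (V V' W W' : YA) (f : chom V V') (g : chom W W') :
  fhom that_fun (thom f g) \oc that_mul V W =
  that_mul V' W' \oc thom (fhom that_fun f) (fhom that_fun g).
Proof.
apply: yd_forget_inj; rewrite !yd_forget_comp that_homE !yd_forget_thom.
rewrite !that_homE !yd_liftK.
exact: (@tf_mul_nat K MA MH F (yd_comod V) (yd_comod V') (yd_comod W)
  (yd_comod W')).
Qed.

Lemma that_assoc (V W X : YA) :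
  fhom that_fun (tassoc V W X) \oc that_mul (tob V W) X
    \oc thom (that_mul V W) (idm YH (that_fun X)) =
  that_mul V (tob W X) \oc thom (idm YH (that_fun V)) (that_mul W X)
    \oc tassoc (that_fun V) (that_fun W) (that_fun X).
Proof.
apply: yd_forget_inj; rewrite !yd_forget_comp that_homE !yd_forget_thom.
rewrite !yd_forget1 !yd_forget_tassoc !yd_liftK.
exact: (@tf_assoc K MA MH F (yd_comod V) (yd_comod W) (yd_comod X)).
Qed.

Lemma that_lunit (V : YA) :
  fhom that_fun (tlunit V) \oc that_mul (tunit YA) V
    \oc thom that_unit (idm YH (that_fun V)) = tlunit (that_fun V).
Proof.
apply: yd_forget_inj; rewrite !yd_forget_comp that_homE !yd_forget_thom.
rewrite !yd_forget1 !yd_forget_tlunit !yd_liftK.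
exact: (@tf_lunit K MA MH F (yd_comod V)).
Qed.

Lemma that_runit (V : YA) :
  fhom that_fun (trunit V) \oc that_mul V (tunit YA)
    \oc thom (idm YH (that_fun V)) that_unit = trunit (that_fun V).
Proof.
apply: yd_forget_inj; rewrite !yd_forget_comp that_homE !yd_forget_thom.
rewrite !yd_forget1 !yd_forget_trunit !yd_liftK.
exact: (@tf_runit K MA MH F (yd_comod V)).
Qed.

Definition that_tensor : tensorFunctor YA YH :=
  @TensorFunctor K YA YH that_fun that_mul that_mul_nat that_unit that_assoc
    that_lunit that_runit.

Lemma that_faithful : faithful that_fun.
Proof.
move=> V W f g /(congr1 (@yd_forget_map K H _ _)); rewrite !that_homE.
by move=> /faithF/yd_forget_inj.
Qed.

Lemma that_full : full that_fun.
Proof.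
move=> V W h.
pose h' : @chom K MH (F (yd_comod V)) (F (yd_comod W)) := yd_forget_map h.
pose f := flift fullF h'.
have sq : fsq (iso_id (F (yd_comod V))) (iso_id (F (yd_comod W))) f h'.
  by rewrite /fsq fliftK ccompf1 ccomp1f.
have af : @act_linear K A V W (f : comodHom V W).
  apply/(yd_act_linear_compat (@that_compat V) (@that_compat W) sq).
  exact: (ydHom_act h).
exists (yd_lift af); apply: yd_forget_inj.
by rewrite that_homE yd_liftK fliftK.
Qed.

(** A module [N] is reached by pulling its half braiding back to a comodule [X]
    with [F X] isomorphic to [N]. *)
Lemma that_ess_surj : ess_surj that_fun.
Proof.
move=> N; have [X [s]] := surjF (yd_comod N).
pose p := pull_hb s faithF fullF (yd_hb N).
have cs : @yd_compatible (yd_of_hb p) N s.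
  move=> Y Y' m; rewrite brd_yd_of_hb.
  exact: (pull_hb_compat _ fullF (yd_hb N)).
have acts : @act_linear K H N (that_ob (yd_of_hb p)) (iso_fw s : comodHom _ _).
  have := @yd_act_linear_compat (yd_of_hb p) (yd_of_hb p) N
    (that_ob (yd_of_hb p)) _ _ (idm MA X) s cs (@that_compat (yd_of_hb p)).
  case; last by move=> h _; apply: h.
  by rewrite /fsq fhom1.
by exists (yd_of_hb p); constructor; exact: (yd_lift_iso acts).
Qed.

Lemma that_equivalence : is_equivalence that_fun.
Proof.
exact: ff_ess_surj_equivalence that_faithful that_full that_ess_surj.
Qed.

Definition that_equiv : tensorEquiv YA YH :=
  @TensorEquiv K YA YH that_tensor that_equivalence.

Lemma that_forget_nat (V W : YA) (f : chom V W) :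
  iso_id (F (yd_comod W)) \oc fhom (compFunctor (yd_forget H) that_equiv) f =
  fhom (compFunctor F (yd_forget A)) f \oc iso_id (F (yd_comod V)).
Proof.
rewrite [LHS]ccomp1f [RHS]ccompf1; exact: that_homE.
Qed.

Definition that_forget : natIso (compFunctor (yd_forget H) that_equiv)
    (compFunctor F (yd_forget A)) :=
  @NatIso K YA MH (compFunctor (yd_forget H) that_equiv)
    (compFunctor F (yd_forget A)) _ that_forget_nat.

End TransportedFunctor.

(** * Free Yetter-Drinfeld modules *)

Section UniversalArrows.
Variables (K : fieldType) (C D : linCat K) (R : linFunctor D C).

Definition universal_arrow (X : C) (P : D) (u : chom X (R P)) : Prop :=
  forall (N : D) (g : chom X (R N)),
    exists2 f : chom P N, fhom R f \oc u = g &
      forall f', fhom R f' \oc u = g -> f' = f.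

Lemma universal_arrow_inj X P (u : chom X (R P)) N (f f' : chom P N) :
  universal_arrow u -> fhom R f \oc u = fhom R f' \oc u -> f = f'.
Proof.
move=> uu ff'; have [h _ hP] := uu N (fhom R f' \oc u).
by rewrite (hP f) // (hP f').
Qed.

Lemma universal_arrow_iso X P Q (u : chom X (R P)) (v : chom X (R Q)) :
  universal_arrow u -> universal_arrow v ->
  exists i : ciso P Q, fhom R i \oc u = v.
Proof.
move=> uu uv; have [i iP _] := uu Q v; have [j jP _] := uv P u.
have ij : j \oc i = idm D P.
  apply: (universal_arrow_inj uu).
  by rewrite fhom_comp -ccompA iP jP fhom1 ccomp1f.
have ji : i \oc j = idm D Q.
  apply: (universal_arrow_inj uv).
  by rewrite fhom_comp -ccompA jP iP fhom1 ccomp1f.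
by exists (CIso ij ji).
Qed.

End UniversalArrows.

Section FreeAdjunction.
Variables (K : fieldType) (A : hopfAlgebra K).
Implicit Types (V W : comodule A) (N : ydModule A).
Local Notation S := (@antipode K A).
Local Notation Δ := (@comul K A).

Lemma free_unit_linear V : linear (fun v : V => v *t (1 : A)).
Proof. by lin. Qed.

Lemma free_unit_colinear V :
  @colinear K A V (free_comod V) (fun v : V => v *t (1 : A)).
Proof.
move=> v; rewrite /= free_coactE; apply: eq_tlift => v0 v1.
rewrite comul1 tliftE; last by lin.
rewrite comul1 tliftE; last by lin.
by rewrite antipode1 mul1r mulr1.
Qed.

Definition free_unit V : comodHom V (free_comod V) :=
  @mkComodHom K A V (free_comod V) _ (@free_unit_linear V)
    (@free_unit_colinear V).

Section Extension.
Variables (V : comodule A) (N : ydModule A) (g : comodHom V N).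

Definition free_ext_fun (t : V \ox A) : N := \sw_(v, a <- t) yd_act (g v) a.

Lemma free_ext_linear : linear free_ext_fun.
Proof. by rewrite /free_ext_fun; lin. Qed.

Lemma free_ext_funE v a : free_ext_fun (v *t a) = yd_act (g v) a.
Proof. by rewrite /free_ext_fun tliftE //; lin. Qed.

Lemma free_ext_colinear : @colinear K A (free_comod V) N free_ext_fun.
Proof.
have lf := free_ext_linear.
have bt : bilin (fun x (y : A) => free_ext_fun x *t y).
  by apply: bilinI => [y|x]; [apply: lin_tensl|lin].
apply: tens_ext => [||v a].
- exact: lin_app.
- by apply: lin_tlift_arg bt _; exact: linearP.
rewrite free_ext_funE yd_compat /= (free_coact_sw _ _ bt).
rewrite colinear_sw; last exact: comodHom_colinear.
  apply: eq_tlift => v0 v1; apply: eq_tlift => a1 a23.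
  by apply: eq_tlift => a2 a3; rewrite free_ext_funE.
by lin.
Qed.

Lemma free_ext_act : @act_linear K A (free_yd V) N free_ext_fun.
Proof.
have lf := free_ext_linear.
move=> t b; move: t; apply: tens_ext => [||v a].
- exact: (lin_comp lf ((@free_act_bilin _ _ V).1 b)).
- exact: (lin_comp ((yd_act_bilin N).1 b) lf).
by rewrite /= free_actE !free_ext_funE yd_actM.
Qed.

Definition free_ext : ydHom (free_yd V) N :=
  @mkYDHom K A (free_yd V) N _ free_ext_linear free_ext_colinear free_ext_act.

End Extension.

(** Frobenius reciprocity: a Yetter-Drinfeld map out of [free_yd V] is
    determined by its values on the [v *t 1], as [v *t a = (v *t 1) . a]. *)
Lemma free_unit_universal V :
  @universal_arrow K (comodCat A) (ydCat A) (yd_forget A) V (free_yd V)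
    (free_unit V).
Proof.
move=> N g; exists (free_ext g).
  by apply: comodHomP => v; rewrite /= free_ext_funE yd_act1.
move=> f' E; apply: ydHomP.
have lf' := ydHom_linear f'; have lf := free_ext_linear g.
apply: tens_ext => // v a.
have -> : v *t a = @yd_act K A (free_yd V) (v *t (1 : A)) a.
  by rewrite /= free_actE mul1r.
rewrite ydHom_act (ydHom_act (free_ext g)); congr yd_act.
rewrite /= free_ext_funE yd_act1.
exact: (congr1 (fun h : comodHom V N => h v) E).
Qed.

Lemma free_unit_nat (V W : comodCat A) (f : chom V W) :
  (yd_forget_map (free_map f) : @chom K (comodCat A) (free_comod V) _)
    \oc (free_unit V : @chom K (comodCat A) V (free_comod V)) =
  (free_unit W : @chom K (comodCat A) W (free_comod W)) \oc f.
Proof.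
apply: comodHomP => v; rewrite /= tmapE //; exact: (comodHom_linear f).
Qed.

End FreeAdjunction.

Section FreeTransport.
Variables (K : fieldType) (A H : hopfAlgebra K).
Local Notation MA := (comodCat A).
Local Notation MH := (comodCat H).
Local Notation YA := (ydCat A).
Local Notation YH := (ydCat H).
Variable F : tensorFunctor MA MH.
Hypotheses (faithF : faithful F) (fullF : full F) (surjF : ess_surj F).
Local Notation That := (that_equiv faithF fullF surjF).

Let eta (V : MA) : @chom K MA V (yd_comod (free_yd V)) := free_unit V.

(** A map out of [F V] into [N], where [N] may be taken to be an image of the
    induced functor, is the image of a map out of [V], to which the
    universality of [free_unit V] applies. *)
Lemma that_free_universal (V : MA) :
  @universal_arrow K MH YH (yd_forget H) (F V) (That (free_yd V))
    (fhom F (eta V)).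
Proof.
move=> N g; have [M [j]] := that_ess_surj faithF fullF surjF N.
pose k := flift fullF (fhom (yd_forget H) (iso_fw j) \oc g).
have [h hP hU] := free_unit_universal k.
have homE (f : @chom K YA (free_yd V) M) :
  fhom (yd_forget H) (fhom That f) = fhom F (fhom (yd_forget A) f).
  exact: that_homE.
exists (iso_bw j \oc fhom That h).
  rewrite fhom_comp homE -[LHS]ccompA -[X in _ \oc X]fhom_comp hP fliftK.
  by rewrite ccompA fiso_fwK ccomp1f.
move=> f' f'P.
have [h' h'E] :=
  that_full (faithF := faithF) (surjF := surjF) (iso_fw j \oc f').
rewrite -(hU h').
  by rewrite [fhom That h']h'E iso_fwKf.
apply: faithF; rewrite fliftK -f'P ccompA -fhom_comp -h'E.
by rewrite fhom_comp -homE.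
Qed.

Definition free_iso (V : MA) : @ciso K YH (That (free_yd V)) (free_yd (F V)) :=
  sval (cid (universal_arrow_iso (@that_free_universal V)
    (@free_unit_universal K H (F V)))).

Lemma free_isoE (V : MA) :
  fhom (yd_forget H) (iso_fw (free_iso V)) \oc fhom F (eta V) =
  (free_unit (F V) : @chom K MH _ _).
Proof. by rewrite /free_iso; case: cid. Qed.

Lemma free_iso_nat (V W : MA) (f : chom V W) :
  free_iso W \oc fhom (compFunctor That (free_functor A)) f =
  fhom (compFunctor (free_functor H) F) f \oc free_iso V.
Proof.
apply: (universal_arrow_inj (@that_free_universal V)).
rewrite !fhom_comp -!ccompA free_isoE.
rewrite -[fhom (compFunctor That _) f]/(fhom That (free_map f)).
rewrite -[fhom (compFunctor (free_functor H) F) f]/(free_map (fhom F f)).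
rewrite [fhom (yd_forget H) (fhom That _)]that_homE.
have E := @free_unit_nat K A V W f.
have E' := @free_unit_nat K H (F V) (F W) (fhom F f).
rewrite -[in LHS]fhom_comp.
rewrite [X in _ \oc fhom F X]E fhom_comp ccompA free_isoE.
exact: esym E'.
Qed.

Definition free_natIso : natIso (compFunctor That (free_functor A))
    (compFunctor (free_functor H) F) :=
  @NatIso K MA YH (compFunctor That (free_functor A))
    (compFunctor (free_functor H) F) free_iso free_iso_nat.

End FreeTransport.

(** * Exact sequences of comodules *)

Section Projectors.
Variable K : fieldType.
Implicit Types V W : lmodType K.

(** Zorn's lemma gives a maximal subspace [W] that meets [S] only in 0; then
    [V] is the direct sum of [S] and [W]. *)
Lemma subspace_projector V (S : set V) :
  S 0 -> (forall a u v, S u -> S v -> S (a *: u + v)) ->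
  exists e : V -> V,
    [/\ linear e, forall v, S (e v) & forall v, S v -> e v = v].
Proof.
move=> S0 Slin.
pose P (W : set V) := (forall a u v, W u -> W v -> W (a *: u + v)) /\
  (forall v, S v -> W v -> v = 0).
have chainP (F : set (set V)) : (F `<=` P)%classic -> total_on F subset ->
    P (\bigcup_(X in F) X)%classic.
  move=> FP Ftot; split=> [a u v [X FX Xu] [Y FY Yv]|v Sv [X FX Xv]].
    have [XY|YX] := Ftot X Y FX FY.
      by exists Y => //; apply: (FP Y FY).1 => //; apply: XY.
    by exists X => //; apply: (FP X FX).1 => //; apply: YX.
  exact: (FP X FX).2.
have [W [[Wlin SW] Wmax]] := Zorn_bigcup chainP.
(* P also admits the empty set, as the union of the empty chain *)
have [w0 Ww0] : exists w, W w.
  apply: contrapT => /forallNP W0.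
  apply: (Wmax [set 0]%classic); last first.
    by split=> [a u v -> ->|v _ ->] //=; rewrite scaler0 addr0.
  split=> [|/(_ 0 erefl)]; first by move=> w /W0.
  exact: W0.
have W0 : W 0 by have := Wlin (-1) _ _ Ww0 Ww0; rewrite scaleN1r addNr.
have Wsum v : exists s, S s /\ W (v - s).
  apply: contrapT => /forallNP nv.
  (* the span of W and v, which would contradict the maximality of W *)
  pose W' : set V := fun x => exists c, W (x - c *: v).
  apply: (Wmax W').
    split=> [w Ww|/(_ v) W'v]; first by exists 0; rewrite scale0r subr0.
    apply: (nv 0); split=> //; rewrite subr0; apply: W'v.
    by exists 1; rewrite scale1r subrr.
  split=> [a x y [c Wx] [d Wy]|x Sx [c Wx]].
    exists (a * c + d).
    suff -> : a *: x + y - (a * c + d) *: v = a *: (x - c *: v) + (y - d *: v).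
      exact: Wlin.
    by rewrite scalerDl scalerBr scalerA opprD addrACA.
  have [c0|cN0] := eqVneq c 0.
    by apply: SW => //; move: Wx; rewrite c0 scale0r subr0.
  exfalso; apply: (nv (c^-1 *: x)); split.
    by rewrite -[_ *: x]addr0; apply: Slin.
  have := Wlin (- c^-1) _ _ Wx W0; rewrite addr0 scalerBr scalerA mulNr.
  by rewrite mulVf // !scaleNr scale1r opprK addrC.
pose e v := sval (cid (Wsum v)).
have eP v : S (e v) /\ W (v - e v) by exact: svalP (cid (Wsum v)).
have eU v s : S s -> W (v - s) -> e v = s.
  move=> Ss Wvs; have [Se We] := eP v.
  have Ssub a b : S a -> S b -> S (a - b).
    by move=> Sa Sb; rewrite addrC -scaleN1r; apply: Slin.
  apply/eqP; rewrite -subr_eq0; apply/eqP; apply: SW; first exact: Ssub.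
  have := Wlin (-1) _ _ We Wvs.
  by rewrite scaleN1r opprB addrA subrK.
exists e; split.
- move=> a u v; have [Su Wu] := eP u; have [Sv Wv] := eP v.
  apply: eU; first exact: Slin.
  suff -> : a *: u + v - (a *: e u + e v) = a *: (u - e u) + (v - e v).
    exact: Wlin.
  by rewrite scalerBr opprD addrACA.
- by move=> v; have [] := eP v.
- by move=> v Sv; apply: eU; rewrite ?subrr.
Qed.

(** A section of [j] over its image, extended to the whole target by a
    projector. *)
Lemma linear_pinv V W (j : V -> W) : linear j ->
  exists2 t : W -> V, linear t & forall v, j (t (j v)) = j v.
Proof.
move=> lj.
have [|a u v ju jv|p [lp jp kerp]] := @subspace_projector V (fun v => j v = 0).
- exact: lin0.
- by rewrite (linP lj) ju jv scaler0 addr0.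
have [||e [le je ime]] := @subspace_projector W (fun w => exists v, j v = w).
- by exists 0; exact: lin0.
- by move=> a _ _ [u <-] [v <-]; exists (a *: u + v); rewrite (linP lj).
pose x w := sval (cid (je w)).
have xP w : j (x w) = e w by exact: svalP (cid (je w)).
have jB u v : j (u - v) = j u - j v.
  by rewrite addrC -scaleN1r (linP lj) scaleN1r addrC.
have pU u v : j u = j v -> u - p u = v - p v.
  move=> juv; have /kerp : j (u - v) = 0 by rewrite jB juv subrr.
  rewrite [u - v]addrC -scaleN1r (linP lp) !scaleN1r => E.
  by apply/eqP; rewrite subr_eq -addrA E addrA subrr add0r.
exists (fun w => x w - p (x w)) => [a u v|v].
  rewrite (pU _ (a *: x u + x v)); last by rewrite xP (linP le) (linP lj) !xP.
  by rewrite (linP lp) opprD addrACA scalerBr.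
by rewrite jB jp subr0 xP ime //; exists v.
Qed.

End Projectors.

Section Kernel.
Variables (K : fieldType) (A : hopfAlgebra K) (Y Z : comodule A).
Variable g : comodHom Y Z.

Definition ker_pred : {pred Y} := fun y => g y == 0.

Lemma ker_submod : submod_closed ker_pred.
Proof.
have lg := comodHom_linear g.
split=> [|a u v]; rewrite !unfold_in; first by rewrite (lin0 lg).
by move=> /eqP gu /eqP gv; rewrite (linP lg) gu gv scaler0 addr0.
Qed.

HB.instance Definition _ :=
  GRing.isSubmodClosed.Build K Y ker_pred ker_submod.

Record ker_type := KerType { ker_val :> Y; ker_valP : ker_val \in ker_pred }.

HB.instance Definition _ := [isSub for ker_val].
HB.instance Definition _ := [Choice of ker_type by <:].
HB.instance Definition _ := [SubChoice_isSubLmodule of ker_type by <:].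

(* A generalised inverse of g: it provides the projection y - t (g y) onto the
   kernel, which replaces the exactness of tensoring with A. *)
Variables (t : Z -> Y) (lt : linear t) (tK : forall y, g (t (g y)) = g y).

Let lg := comodHom_linear g.

Lemma ker_proj_subproof (y : Y) : y - t (g y) \in ker_pred.
Proof.
rewrite unfold_in addrC -scaleN1r (linP lg) tK scaleN1r addNr; exact: eqxx.
Qed.

Definition ker_proj (y : Y) : ker_type := KerType (ker_proj_subproof y).

Lemma ker_val_linear : linear ker_val. Proof. by []. Qed.

Lemma ker_proj_linear : linear ker_proj.
Proof.
move=> a u v; apply: val_inj => /=.
rewrite /= (linP lg) (linP lt).
by rewrite -[RHS]/(a *: (u - t (g u)) + (v - t (g v))) scalerBr opprD addrACA.
Qed.

Lemma ker_valK (k : ker_type) : ker_proj (ker_val k) = k.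
Proof.
apply: val_inj => /=; have /eqP -> := ker_valP k.
by rewrite (lin0 lt) subr0.
Qed.

(** The coaction of [Y] followed by the projection onto the kernel;
    [ker_proj_sw] shows that the projection changes nothing. *)
Definition ker_coact_fun (k : ker_type) : ker_type \ox A :=
  tmap ker_proj (fun a : A => a) (coact (ker_val k)).

Lemma ker_coact_linear : linear ker_coact_fun.
Proof.
apply: (lin_comp (tmap_linear ker_proj_linear (@lin_id _ A))).
exact: (lin_app _ ker_val_linear).
Qed.

Definition ker_coact := mklin ker_coact_linear.

Lemma ker_coact_sw (U : lmodType K) (b : ker_type -> A -> U) (k : ker_type) :
  bilin b ->
  \sw_(k0, k1 <- ker_coact k) b k0 k1 =
  \sw_(y0, y1 <- coact (ker_val k)) b (ker_proj y0) y1.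
Proof.
move=> bb; rewrite /= /ker_coact_fun /tmap tlift_tlift //.
by apply: eq_tlift => y0 y1; rewrite tliftE.
Qed.

(** Applying the coaction of [Z] to [g k = 0] shows that the projection does
    not change the coaction of an element [k] of the kernel. *)
Lemma ker_proj_sw (U : lmodType K) (b : Y -> A -> U) (k : ker_type) : bilin b ->
  \sw_(y0, y1 <- coact (ker_val k)) b (ker_val (ker_proj y0)) y1 =
  \sw_(y0, y1 <- coact (ker_val k)) b y0 y1.
Proof.
move=> bb; have [bl br] := bb.
have E : \sw_(y0, y1 <- coact (ker_val k)) b (t (g y0)) y1 = 0.
  rewrite -(colinear_sw (f := g) (b := fun z a => b (t z) a)).
  - have /eqP -> := ker_valP k.
    rewrite linear0; apply: (lin0 (tlift_linear _)).
    by apply: bilinI => [a|z]; [exact: (lin_comp (bl a) lt)|exact: br].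
  - by apply: bilinI => [a|z]; [exact: (lin_comp (bl a) lt)|exact: br].
  - exact: comodHom_colinear.
rewrite -[RHS]subr0 -[X in _ = _ - X]E -sumrB; apply: eq_bigr => q _ /=.
by rewrite addrC -scaleN1r (linP (bl _)) scaleN1r addrC.
Qed.

Lemma ker_coactA (k : ker_type) :
  \sw_(v0, v1 <- ker_coact k) \sw_(v00, v01 <- ker_coact v0)
     v00 *t (v01 *t v1) =
  \sw_(v0, v1 <- ker_coact k) v0 *t comul v1.
Proof.
have lp := ker_proj_linear.
rewrite !ker_coact_sw; [|by lin|]; last first.
  apply: bilinI => [a|k']; last by lin.
  by apply: lin_tlift_arg; [lin|exact: lin_app].
pose b (y : Y) (a : A) : ker_type \ox (A \ox A) :=
  \sw_(w0, w1 <- coact y) ker_proj w0 *t (w1 *t a).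
have bb0 (a : A) : bilin (fun (w0 : Y) (w1 : A) => ker_proj w0 *t (w1 *t a)).
  by apply: bilinI => *; [apply: lin_tensl|lin].
have bb : bilin b.
  apply: bilinI => [a|y]; last by rewrite /b; lin.
  by apply: lin_tlift_arg; [exact: bb0|exact: linearP].
transitivity (\sw_(y0, y1 <- coact (ker_val k)) b (ker_val (ker_proj y0)) y1).
  apply: eq_tlift => y0 y1; rewrite ker_coact_sw //; lin.
rewrite ker_proj_sw //.
rewrite (coactA_sw (f := fun w x a => ker_proj w *t (x *t a))); try by lin.
apply: eq_tlift => y0 y1; rewrite [in RHS](tensE (comul y1)).
by rewrite [RHS]lin_tlift //; lin.
Qed.

Lemma ker_coact_counit (k : ker_type) :
  \sw_(v0, v1 <- ker_coact k) (counit v1 : K) *: v0 = k.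
Proof.
rewrite ker_coact_sw; last by lin.
rewrite (coact_counit_sw (f := ker_proj)) ?ker_valK //.
exact: ker_proj_linear.
Qed.

Definition ker_comod : comodule A := Comodule ker_coactA ker_coact_counit.

Lemma ker_val_colinear : @colinear K A ker_comod Y ker_val.
Proof.
move=> k; rewrite ker_coact_sw; last first.
  by apply: bilinI => *; [apply: lin_tensl|lin].
by rewrite (ker_proj_sw _ (@tens_bilin K Y A)) -tensE.
Qed.

Definition ker_incl : comodHom ker_comod Y :=
  @mkComodHom K A ker_comod Y _ ker_val_linear ker_val_colinear.

End Kernel.

Section Exactness.
Variable K : fieldType.

(** The test morphisms [u] and [h] stand for the kernel of [g] and the cokernel
    of [f]; quantifying over them gives a condition that every equivalence
    preserves. *)
Definition cat_exact (C : linCat K) (X Y Z : C) (f : chom X Y) (g : chom Y Z) :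
    Prop :=
  g \oc f = 0 /\
  forall (U W : C) (u : chom U Y) (h : chom Y W),
    g \oc u = 0 -> h \oc f = 0 -> h \oc u = 0.

Lemma cat_exact_fun (C D : linCat K) (F : linFunctor C D) (X Y Z : C)
    (f : chom X Y) (g : chom Y Z) :
  faithful F -> full F -> ess_surj F ->
  cat_exact f g -> cat_exact (fhom F f) (fhom F g).
Proof.
move=> faithF fullF surjF [gf ex]; split; first by rewrite -fhom_comp gf fhom0.
move=> U W u h gu hf.
have [U0 [iU]] := surjF U; have [W0 [iW]] := surjF W.
have [u0 u0E] := fullF _ _ (u \oc iso_bw iU).
have [h0 h0E] := fullF _ _ (iW \oc h).
have z : h0 \oc u0 = 0.
  apply: ex; apply: faithF; rewrite fhom_comp fhom0.
    by rewrite u0E ccompA gu comp0.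
  by rewrite h0E -ccompA hf compf0.
apply: (iso_mono (i := iW)); apply: (iso_epi (i := iso_sym iU)).
rewrite compf0 comp0 /= ccompA -ccompA -u0E -h0E -fhom_comp z.
exact: fhom0.
Qed.

Lemma cat_exact_iso (C : linCat K) (X Y Z X' Y' Z' : C) (f : chom X Y)
    (g : chom Y Z) (f' : chom X' Y') (g' : chom Y' Z')
    (i : ciso X X') (j : ciso Y Y') (k : ciso Z Z') :
  f' \oc i = j \oc f -> g' \oc j = k \oc g ->
  cat_exact f g -> cat_exact f' g'.
Proof.
move=> ff' gg' [gf ex].
have f'E : f' = j \oc f \oc iso_bw i by rewrite -ff' iso_fwfK.
have g'E : g' = k \oc g \oc iso_bw j by rewrite -gg' iso_fwfK.
split; first by rewrite f'E !ccompA gg' -(ccompA k g f) gf compf0 comp0.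
move=> U W u h gu hf.
have : (h \oc j) \oc (iso_bw j \oc u) = 0.
  apply: ex.
    by apply: (iso_mono (i := k)); rewrite compf0 !ccompA -g'E gu.
  apply: (iso_epi (i := iso_sym i)); rewrite comp0 /=.
  by rewrite -!ccompA (ccompA j f) -f'E.
by rewrite -ccompA iso_bwKf.
Qed.

Section Comodules.
Variable A : hopfAlgebra K.
Local Notation MA := (comodCat A).

Definition comod_exact (X Y Z : comodule A) (f : comodHom X Y)
    (g : comodHom Y Z) : Prop :=
  forall y, g y = 0 <-> exists x, f x = y.

(** From right to left, [u] is the inclusion of the kernel of [g] and [h] the
    map into a cofree comodule induced by [id - e], where [e] projects onto the
    image of [f]; the counit recovers [id - e] from [h]. *)
Lemma comod_exactP (X Y Z : MA) (f : chom X Y) (g : chom Y Z) :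
  @comod_exact X Y Z f g <-> cat_exact f g.
Proof.
split=> [ex|[gf ex] y].
  split; first by apply: comodHomP => x; apply/ex; exists x.
  move=> U W u h gu hf; apply: comodHomP => v.
  have /ex[x fx] : (g : comodHom Y Z) ((u : comodHom U Y) v) = 0.
    exact: (congr1 (fun m : comodHom U Z => m v) gu).
  rewrite /= -fx; exact: (congr1 (fun m : comodHom X W => m x) hf).
split=> [gy|[x <-]]; last first.
  exact: (congr1 (fun m : comodHom X Z => m x) gf).
have lf := comodHom_linear (f : comodHom X Y).
have lg := comodHom_linear (g : comodHom Y Z).
have [||e [le ime ek]] := @subspace_projector K Y
  (fun y => exists x, (f : comodHom X Y) x = y).
- by exists 0; apply: lin0.
- by move=> a _ _ [u <-] [v <-]; exists (a *: u + v); rewrite (linP lf).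
have [t lt tK] := linear_pinv lg.
have lh : linear (fun y : Y => y - e y).
  by move=> a u v; rewrite (linP le) opprD addrACA scalerBr.
pose h : @chom K MA Y (cofree A Y) := corep lh.
pose u : @chom K MA (ker_comod lt tK) Y := ker_incl lt tK.
have hu : h \oc u = 0.
  apply: ex.
    by apply: comodHomP => k; have /eqP := ker_valP k.
  apply: comodHomP => x; rewrite /= /corep_fun /tmap.
  rewrite (colinear_sw (f := f : comodHom X Y)
    (b := fun y a => (y - e y) *t a)).
  - rewrite /tlift big1 // => q _.
    by rewrite ek ?subrr ?(lin0 (lin_tensl _ (@lin_id _ _))) //; exists q.1.
  - by apply: bilinI => *; [apply: lin_tensl|lin].
  - exact: comodHom_colinear.
have ky : y \in ker_pred (g : comodHom Y Z).
  by rewrite unfold_in gy; apply: eqxx.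
have : y - e y = 0.
  rewrite -(corepK y lh).
  have E := congr1 (fun m : comodHom (ker_comod lt tK) (cofree A Y) =>
    m (KerType ky)) hu.
  rewrite [corep_fun _ _]E; exact: (lin0 (@epsr_linear K A Y)).
by move/eqP; rewrite subr_eq0 => /eqP ->; apply: ime.
Qed.

End Comodules.
End Exactness.

(** * Transport of resolutions *)

Section Resolutions.
Variables (K : fieldType) (A H : hopfAlgebra K).
Local Notation MA := (comodCat A).
Local Notation MH := (comodCat H).
Local Notation YA := (ydCat A).
Local Notation YH := (ydCat H).
Variable F : tensorFunctor MA MH.
Hypotheses (faithF : faithful F) (fullF : full F) (surjF : ess_surj F).
Local Notation That := (that_equiv faithF fullF surjF).

(** Surjectivity is exactness in front of a zero map, so that the augmentation
    is covered by the same transport lemma as the differentials. *)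
Lemma yd_surjective_exact (B : hopfAlgebra K) (X Y : ydCat B) (f : chom X Y) :
  yd_surjective f <-> yd_exact f (0 : chom Y Y).
Proof. by split=> h y; [split=> // _; apply: h|apply/h]. Qed.

Lemma that_exact (X Y Z : YA) (f : chom X Y) (g : chom Y Z)
    (X' Y' Z' : YH) (i : ciso (That X) X') (j : ciso (That Y) Y')
    (k : ciso (That Z) Z') :
  yd_exact f g ->
  yd_exact (j \oc fhom That f \oc iso_bw i) (k \oc fhom That g \oc iso_bw j).
Proof.
move=> ex.
have /comod_exactP ex' : comod_exact (yd_forget_map f) (yd_forget_map g) by [].
have ex1 := cat_exact_fun faithF fullF surjF ex'.
suff /comod_exactP :
  @cat_exact K MH _ _ _
    (fhom (yd_forget H) (j \oc fhom That f \oc iso_bw i))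
    (fhom (yd_forget H) (k \oc fhom That g \oc iso_bw j)) by [].
apply: (@cat_exact_iso K MH _ _ _ _ _ _ _ _ _ _ (fiso (yd_forget H) i)
  (fiso (yd_forget H) j) (fiso (yd_forget H) k) _ _ ex1).
- rewrite -[LHS]fhom_comp (iso_bwfK i) fhom_comp; congr (_ \oc _).
  exact: that_homE.
- rewrite -[LHS]fhom_comp (iso_bwfK j) fhom_comp; congr (_ \oc _).
  exact: that_homE.
Qed.

Variable phi : natIso (compFunctor That (free_functor A))
  (compFunctor (free_functor H) F).

Lemma transport_augments (V : nat -> MA)
    (d : forall n, chom (free_functor A (V n.+1)) (free_functor A (V n)))
    (eps : chom (free_functor A (V 0%N)) (tunit YA)) :
  augments d eps ->
  augments (fun n => transport_map phi (d n)) (transport_aug phi eps).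
Proof.
move=> [/yd_surjective_exact se e0 es]; split.
- apply/yd_surjective_exact.
  pose k := iso_sym (tf_unit That); have := that_exact (phi _) k k se.
  by rewrite fhom0 compf0 comp0.
- exact: (that_exact (phi _) (phi _) (iso_sym (tf_unit That)) e0).
- by move=> n; exact: (that_exact (phi _) (phi _) (phi _) (es n)).
Qed.

Lemma transport_resolution (V : nat -> MA)
    (d : forall n, chom (free_functor A (V n.+1)) (free_functor A (V n))) :
  free_yd_resolution (tunit YA) d ->
  free_yd_resolution (tunit YH) (fun n => transport_map phi (d n)).
Proof.
move=> [_ dd [eps de]]; split.
- by move=> n; exists (F (V n)); constructor; exact: iso_id.
- move=> n; rewrite /transport_map.
  rewrite !ccompA (iso_bwfK (phi (V n.+1))).
  by rewrite -(ccompA (phi _)) -fhom_comp dd fhom0 compf0 comp0.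
- by exists (transport_aug phi eps); exact: transport_augments.
Qed.

End Resolutions.


Theorem theorem4p1 (R : realType) (A H : hopfAlgebra R[i])
    (Theta : tensorEquiv (comodCat A) (comodCat H)) :
  exists That : tensorEquiv (ydCat A) (ydCat H),
    inhabited (natIso (compFunctor (yd_forget H) That)
                      (compFunctor Theta (yd_forget A))) /\
    exists phi : natIso (compFunctor That (free_functor A))
                        (compFunctor (free_functor H) Theta),
      forall (V : nat -> comodCat A)
        (d : forall n, chom (free_functor A (V n.+1)) (free_functor A (V n))),
        free_yd_resolution (tunit (ydCat A)) d ->
        free_yd_resolution (tunit (ydCat H)) (fun n => transport_map phi (d n)) /\
        forall eps : chom (free_functor A (V 0%N)) (tunit (ydCat A)),
          augments d eps ->
          augments (fun n => transport_map phi (d n)) (transport_aug phi eps).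
Proof.
have eqF := te_equiv Theta.
have faithF := equivalence_faithful eqF.
have fullF := equivalence_full eqF.
have surjF := equivalence_ess_surj eqF.
exists (that_equiv faithF fullF surjF); split.
  by constructor; exact: that_forget.
exists (free_natIso faithF fullF surjF) => V d res; split.
  exact: transport_resolution res.
by move=> eps; exact: transport_augments.
Qed.
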